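(* Fix an integer $n\ge 3$ and real numbers $0<s_n<\cdots<s_2<s_1<\infty$, and let $S=\{s_n,\dots,s_1\}$. Consider $(S,\mu)$-bullet processes with exponential spacings. (i) If $\mu$ is the uniform measure on $S$, then $\mathbf{P}[b_1\text{ survives}\mid s(b_1)=s_2]>0$. (ii) If $\mu$ is the uniform measure on $S$, then $\mathbf{P}[b_1\text{ survives}\mid s(b_1)=s_n]=0$. (iii) There exists a probability measure $\mu$ supported on $S$ with $\mu(s_2)<\mu(s_1)$ such that $\mathbf{P}[b_1\text{ survives}\mid s(b_1)=s_2]>0$.
   Context: $(S,\mu)$-bullet process with exponential spacings: let $(\zeta_i)_{i\ge1}$ be i.i.d. exponential random variables with mean $1$; bullet $b_1$ is fired at time $t_1=\zeta_1$ and $b_i$ at time $t_i=t_{i-1}+\zeta_i$ for $i\ge2$, all from the origin along the positive real line. The speeds $s(b_i)$ are i.i.d. with law $\mu$ on $S$ and independent of $(\zeta_i)$; $\mu(s)$ abbreviates $\mu(\{s\})$. As long as it has not been annihilated, $b_i$ is at position $s(b_i)(t-t_i)$ at time $t\ge t_i$. When two or more bullets collide (are at the same position at the same time), all of them are annihilated (removed). Conditioning on $s(b_1)=s$ means that $b_1$ has speed $s$ and the other speeds are i.i.d. with law $\mu$. For $i>j$ write $b_i\mapsto b_j$ (''$b_i$ catches $b_j$'') for the event that $b_i$ and $b_j$ collide, with $b_i$ the faster one, resulting in their mutual annihilation. We say $b_1$ survives if there is no index $i$ with $b_i\mapsto b_1$. *)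

(* Defs.v *)
From HB Require Import structures.
From mathcomp Require Import all_boot all_order all_algebra.
From mathcomp Require Import all_classical all_reals all_analysis.

Set Implicit Arguments.
Unset Strict Implicit.
Unset Printing Implicit Defensive.

Import Order.TTheory GRing.Theory Num.Theory.

Local Open Scope classical_set_scope.
Local Open Scope ring_scope.

(* Bullets are numbered from 0: the bullet b_(i+1) of the text has index i, so
   that b_1 has index 0.  In this section z lists the spacings (z i is the
   delay before bullet i) and s the speeds of one realization. *)
Section Dynamics.
Variables (R : realType) (z s : nat -> R).

Definition fire_time (i : nat) : R := \sum_(j < i.+1) z j.

Definition position (i : nat) (u : R) : R := s i * (u - fire_time i).

Definition meet (i j : nat) (u : R) : Prop :=
  [/\ i <> j, fire_time i <= u, fire_time j <= u &
      position i u = position j u].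

(* [set0] has infimum +oo: no further collision takes place. *)
Definition next_collision (A : set nat) : \bar R :=
  ereal_inf [set u%:E | u in [set u | exists i j, [/\ A i, A j & meet i j u]]].

Definition collide_next (A : set nat) (i j : nat) : Prop :=
  [/\ A i, A j & exists2 u, meet i j u & next_collision A = u%:E].

(* [remaining k] is the set of the bullets, already fired or not, that are not
   annihilated at any of the first k collision instants.  All the bullets
   involved in a collision at the next instant are removed together, whether
   they meet two by two or in larger groups.  When the firing times increase to
   infinity (almost surely the case), only finitely many bullets are fired
   before any given time, hence every infimum is attained and the instants
   either are finite in number or tend to infinity: every collision of the
   process happens at some finite stage k. *)
Fixpoint remaining (k : nat) : set nat :=
  if k is k'.+1 then
    [set i | remaining k' i /\ ~ exists j, collide_next (remaining k') i j]
  else setT.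

Definition collide (i j : nat) : Prop :=
  exists k, collide_next (remaining k) i j.

Definition catches (i j : nat) : Prop :=
  [/\ (j < i)%N, s j < s i & collide i j].

Definition first_survives : Prop := ~ exists i, catches i 0%N.

End Dynamics.

Section Process.
Context {d : measure_display} {T : measurableType d} {R : realType}.
Variable P : probability T R.

Definition mutually_independent (I : eqType) (Y : I -> {RV P >-> R}) : Prop :=
  forall (J : seq I) (B : I -> set R),
    uniq J -> (forall i, measurable (B i)) ->
    P (\big[setI/setT]_(i <- J) (Y i @^-1` B i)) =
      (\big[mule/1]_(i <- J) P (Y i @^-1` B i))%E.

Definition has_law (Y : {RV P >-> R}) (nu : set R -> \bar R) : Prop :=
  forall B : set R, measurable B -> distribution P Y B = nu B.

(* Independence of the joint family: the spacings are independent, the speeds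
   are independent, and the two sequences are independent of each other. *)
Definition bullet_process (mu : probability R R)
    (zeta speed : nat -> {RV P >-> R}) : Prop :=
  [/\ forall i, has_law (zeta i) (exponential_prob 1),
      forall i, has_law (speed i) mu &
      mutually_independent (fun k : nat + nat =>
        match k with inl i => zeta i | inr i => speed i end)].

Definition cond_prob (A B : set T) : R := fine (P (A `&` B)) / fine (P B).

(* P[b_1 survives | s(b_1) = c] *)
Definition first_survival_prob (zeta speed : nat -> {RV P >-> R}) (c : R) : R :=
  cond_prob
    [set w | first_survives (fun i => zeta i w) (fun i => speed i w)]
    [set w | speed 0%N w = c].

End Process.

(* The set {v 1, ..., v n}. *)
Definition speed_set (R : realType) (n : nat) (v : nat -> R) : set R :=
  v @` [set i | (1 <= i <= n)%N].

(* Meaningful when S is finite with exactly n elements. *)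
Definition uniform_on (R : realType) (n : nat) (S : set R)
    (mu : probability R R) : Prop :=
  mu S = 1%E /\ forall x, S x -> mu [set x] = (n%:R^-1)%:E.

(* For a finite S: the support of mu is exactly S. *)
Definition supported_on (R : realType) (S : set R)
    (mu : probability R R) : Prop :=
  mu S = 1%E /\ forall x, S x -> (0 < mu [set x])%E.

(* Main.v *)
(* A bullet of speed [s] fired at time [f] is at position [x] at time [f + w x],
   where [w = 1 / s]: the bullets become half-lines of slopes [w] started from the
   points [f], and a survival event depends on finitely many of them up to a limit.
   Let [u1 < u2 < un] be the smallest two slownesses and the largest one, and let
   [a N] be the expected number of bullets of slowness [u2] surviving among the
   bullets [0, ..., N].

   Adding a bullet of slowness [u1] removes at most one survivor of slowness [u2];
   whenever it does, a bullet of slowness [u2] fired in its place survives. So [a]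
   is nondecreasing if [u1] and [u2] have equal masses. Moreover the pattern
   [un], [u2], with suitable spacings, annihilates itself before a bullet of
   slowness [u1] fired next can reach any survivor, while a bullet of slowness [u2]
   would survive there if it did before the pattern. Hence [a N] increases by at
   least [c h (N - 2)] at each step, [h k] being the probability that a bullet of
   slowness [u2] in position [k] is not hit by the previous ones. On the other hand,
   [a N] is at most the mass of [u2] times the sum of the [h j * rho (N - j)], where
   [rho m] is the probability that a bullet of slowness [u2] is not hit by the next
   [m] ones. The two bounds force [rho m] to stay above a positive constant, also
   if the mass of [u1] slightly exceeds that of [u2].

   Reversing time negates the slownesses, and the same bound says that a bullet of
   the second lowest speed catches no previous bullet with probability bounded
   below. Let [E j] be the event that [j] is such a bullet and that [j + 1] is a
   surviving bullet of the lowest speed. The [E j] are disjoint for non-adjacent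
   indices, since [j] would catch an earlier surviving bullet of the lowest speed,
   while their probabilities are at least a constant times the survival
   probability of the slowest bullet. *)

Require Import Defs.
From HB Require Import structures.
From mathcomp Require Import all_boot all_order all_algebra.
From mathcomp Require Import all_classical all_reals all_analysis.
From mathcomp Require Import measurable_realfun.
From mathcomp Require Import ring lra zify.

Set Implicit Arguments.
Unset Strict Implicit.
Unset Printing Implicit Defensive.

Import Order.TTheory GRing.Theory Num.Theory.
Import numFieldNormedType.Exports.

Local Open Scope classical_set_scope.
Local Open Scope ring_scope.

(** Processes on different sets of bullets have unrelated sequences of collision stages, so stages
    give way to death instants: [annihilation] describes these intrinsically, and at the earliest
    discrepancy between two processes the partner always lies outside of their common part
    ([first_difference]). Geometry then excludes that partner, since to interfere it would have to
    cross the line of a survivor.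

    Collisions are ordered by position rather than by time. This survives time reversal, where
    slownesses become negative while meeting positions stay positive, so that one estimate serves
    both ends of the range of speeds. The price is paid for infinite families, where finiteness is
    available in time only; [clock] passes from one order to the other.

    The pattern costs no survivor for this reason: a bullet of slowness [u1] fired next hits the
    bullet of slowness [u2] of the pattern, which the bullet of slowness [un] in front of it had
    doomed anyway. The constant [c] is the probability of the pattern. The exponential law matters
    only through the positivity of the spacings, the divergence of the firing times and the
    positivity of [kappa]. *)

Lemma count_lt (T : eqType) (a b : pred T) (s : seq T) (p : T) :
  (forall y, b y -> a y) -> p \in s -> a p -> ~~ b p ->
  (count b s < count a s)%N.
Proof.
move=> ba; elim: s => //= y s IH; rewrite in_cons => /orP[/eqP <-|ps] ap bp.
  by rewrite ap (negbTE bp) add0n add1n ltnS; exact: sub_count.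
rewrite -addnS leq_add ?IH//.
by case: (b y) (ba y) => // ->.
Qed.

(** * Annihilation at given meeting times *)

Section Annihilation.
Variable R : realType.
Implicit Types (x : nat -> nat -> \bar R) (A : set nat) (D : nat -> \bar R).
Local Open Scope ereal_scope.

(** [closest], [left_over] and [hits] mirror [collide_next], [remaining] and [collide] for arbitrary
    meeting instants and an arbitrary set of objects, so that they also apply to positions and to
    finite windows. *)
Definition closest x A i j :=
  [/\ A i, A j, x i j < +oo & forall k l, A k -> A l -> x i j <= x k l].

Fixpoint left_over x A (k : nat) : set nat :=
  if k is k'.+1 then
    [set i | left_over x A k' i /\ ~ exists j, closest x (left_over x A k') i j]
  else A.

Definition hits x A i j := exists k, closest x (left_over x A k) i j.

Definition survives x A i := forall k, left_over x A k i.

Definition death x A i : \bar R :=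
  ereal_inf [set x i j | j in [set j | hits x A i j]].

(* The intrinsic description of the dynamics: [D i] is the instant at which
   [i] disappears, and two objects that would meet while both still present
   disappear at that instant. *)
Definition annihilation x A D :=
  (forall i j, A i -> A j -> x i j < +oo -> x i j <= D i -> x i j <= D j ->
     D i = x i j) /\
  (forall i, A i -> D i < +oo -> exists j, [/\ A j, x i j = D i & D j = D i]).

Definition locally_finite x A := forall t, t < +oo ->
  finite_set [set i | A i /\ exists j, A j /\ x i j <= t].

Lemma left_over_subset x A k : left_over x A k `<=` A.
Proof. by elim: k => //= k IH i [li _]; exact: IH. Qed.

Lemma left_over_anti x A k l : (k <= l)%N ->
  left_over x A l `<=` left_over x A k.
Proof.
move=> /subnK <-; by elim: (l - k)%N => //= m IH i [li _]; exact: IH.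
Qed.

Lemma closest_sym x A i j : (forall i j, x i j = x j i) ->
  closest x A i j -> closest x A j i.
Proof. by move=> xC [Ai Aj xoo xmin]; split=> //; rewrite xC. Qed.

Lemma hits_sym x A i j : (forall i j, x i j = x j i) ->
  hits x A i j -> hits x A j i.
Proof. by move=> xC [k /(closest_sym xC)]; exists k. Qed.

(** An object collides at one stage only, and all its partners at that stage realize the same
    minimum. Hence the infimum in [death] is over at most one value. *)
Lemma hitsE x A i j j' : hits x A i j -> hits x A i j' -> x i j = x i j'.
Proof.
move=> [k c] [k' c'].
have [lt|lt|eq] := ltngtP k k'.
- have [+ _ _ _] := c'; move=> /(left_over_anti lt) /= [_]; case; by exists j.
- have [+ _ _ _] := c; move=> /(left_over_anti lt) /= [_]; case; by exists j'.
- subst k'; case: c => [? ? _ m]; case: c' => [? ? _ m'].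
  by apply/eqP; rewrite eq_le m ?m'.
Qed.

Lemma death_hits x A i j : hits x A i j -> death x A i = x i j.
Proof.
move=> h; apply/eqP; rewrite eq_le; apply/andP; split.
  by apply: ereal_inf_lbound; exists j.
by apply: le_ereal_inf_tmp => _ [j' h' <-]; rewrite (hitsE h h').
Qed.

Lemma death_noo x A i : death x A i < +oo -> exists j, hits x A i j.
Proof.
move=> d; apply: contrapT => N; move: d; rewrite /death.
rewrite (_ : [set x i j | j in _] = set0) ?ereal_inf0 ?ltxx//.
by rewrite -subset0 => t [j h _]; apply: N; exists j.
Qed.

Lemma survivesP x A i : A i -> survives x A i <-> death x A i = +oo.
Proof.
move=> Ai; split=> [s|d].
  apply/eqP; rewrite -leye_eq leNgt; apply/negP => /death_noo[j [k c]].
  by have := s k.+1; move=> /= [_]; apply; exists j.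
elim=> //= k IH; split=> // -[j c].
have h : hits x A i j by exists k.
by move: d; rewrite (death_hits h) => e; case: c; rewrite e ltxx.
Qed.

Lemma finite_min (F : set nat) x i0 j0 : finite_set F -> F i0 -> F j0 ->
  exists i j, [/\ F i, F j & forall k l, F k -> F l -> x i j <= x k l].
Proof.
move=> finF Fi Fj.
have /finite_seqP[s sE] : finite_set (F `*` F) by exact: finite_setX.
have s0 : (i0, j0) \in s by have : [set` s] (i0, j0) by rewrite -sE.
pose h := fun p => x p.1 p.2.
have [p [ps pm]] : exists p, p \in s /\ forall q, q \in s -> h p <= h q.
  elim: s {sE} (i0, j0) s0 => // a s IH b _.
  case: s IH => [|c s] IH.
    by exists a; split; rewrite ?mem_seq1// => q; rewrite mem_seq1 => /eqP ->.
  have [p [ps pm]] := IH c (mem_head _ _).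
  have [le|lt] := leP (h a) (h p).
    exists a; split=> [|q]; first exact: mem_head.
    by rewrite in_cons => /orP[/eqP->//|/pm]; exact: le_trans.
  exists p; split=> [|q]; first by rewrite in_cons ps orbT.
  by rewrite in_cons => /orP[/eqP->|/pm//]; exact: ltW.
have : (F `*` F) p by rewrite sE.
move=> [Fp1 Fp2]; exists p.1, p.2; split=> // k l Fk Fl.
apply: (pm (k, l)); have : (F `*` F) (k, l) by []. by rewrite sE.
Qed.

(** As long as [i] and [j] are both left, the closest pair meets no later than [x i j], hence lies
    in a finite set that loses an element at each stage. So at some stage [i] or [j] belongs to a
    closest pair; its instant is at most [x i j] by minimality and at least [x i j] by the
    assumption on deaths, which makes [i], [j] a closest pair too. *)
Lemma death_annihilation x A : (forall i j, x i j = x j i) ->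
  locally_finite x A -> annihilation x A (death x A).
Proof.
move=> xC lf; split; last first.
  move=> i Ai /death_noo[j h]; exists j.
  rewrite (death_hits h) (death_hits (hits_sym xC h)) (xC j); split=> //.
  by case: h => k [_ /left_over_subset].
move=> i j Ai Aj xoo lei lej.
set t := x i j in xoo lei lej *.
pose F := [set i | A i /\ exists j, A j /\ x i j <= t].
have finF : finite_set F by exact: lf.
suff [k [li lj [i' [ii' [j' c]]]]] : exists k, [/\ left_over x A k i,
    left_over x A k j & exists i', (i' = i \/ i' = j) /\
      exists j', closest x (left_over x A k) i' j'].
  have h : hits x A i' j' by exists k.
  have le : x i' j' <= t by case: c => _ _ _; apply.
  have ge : t <= x i' j' by rewrite -(death_hits h); case: ii' => ->.
  have e : x i' j' = t by apply/eqP; rewrite eq_le le ge.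
  apply: death_hits; exists k; split=> // p q lp lq; rewrite -/t -e.
  by case: c => _ _ _; apply.
have {finF} [s sE] : exists s : seq nat, forall i, F i <-> i \in s.
  move/finite_seqP: finF => [s sE]; exists s => p; split=> [|ps].
    by rewrite sE.
  by rewrite sE.
pose cnt k := size [seq p <- s | `[<left_over x A k p>]].
suff : forall m k, (cnt k <= m)%N -> left_over x A k i -> left_over x A k j ->
  exists k, [/\ left_over x A k i,
    left_over x A k j & exists i', (i' = i \/ i' = j) /\
      exists j', closest x (left_over x A k) i' j'].
  by move=> /(_ (cnt 0%N) 0%N (leqnn _)); apply.
have Fi : F i by split=> //; exists j.
have Fj : F j by split=> //; exists i; split=> //; rewrite xC.
elim=> [|m IH] k cm li lj.
  have : i \in [seq p <- s | `[<left_over x A k p>]].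
    by rewrite mem_filter; apply/andP; split; [exact/asboolP|apply/sE].
  by move: cm; rewrite leqn0 /cnt => /nilP ->.
have [[i' [ii' c]]|N] := pselect (exists i', (i' = i \/ i' = j) /\
      exists j', closest x (left_over x A k) i' j').
  by exists k; split=> //; exists i'.
have : finite_set (F `&` left_over x A k).
  apply: (sub_finite_set (@subIsetl _ _ _)).
  by apply/finite_seqP; exists s; apply/seteqP; split=> p /sE.
move=> /(@finite_min _ x i j)[]// p [q [[Fp lp] [Fq lq] pm]].
have pt : x p q <= t by exact: pm.
have cl : closest x (left_over x A k) p q.
  split=> // [|a b la lb]; first exact: le_lt_trans xoo.
  have [lt|lt] := leP (x a b) t.
    apply: pm; split=> //; split; try exact: (@left_over_subset x A k).
      by exists b; split=> //; exact: (@left_over_subset x A k).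
    by exists a; rewrite xC; split=> //; exact: (@left_over_subset x A k).
  exact: le_trans pt (ltW lt).
apply: (IH k.+1).
- rewrite -ltnS; apply: leq_trans cm; rewrite /cnt !size_filter.
  apply: (@count_lt _ _ _ _ p); first by move=> a /asboolP[la _]; exact/asboolP.
  + by apply/sE.
  + exact/asboolP.
  + by apply/negP => /asboolP -[_]; apply; exists q.
- by split=> // -[b cb]; apply: N; exists i; split; [left|exists b].
- by split=> // -[b cb]; apply: N; exists j; split; [right|exists b].
Qed.

(** The two processes start to disagree on [i] at [mine (D i) (D' i)]; take [j] in [B] minimizing
    it. If the partner of [j] were in [B], it would be alive until then in both processes, since no
    discrepancy is earlier, and the other process would make the same pair collide. *)
Lemma first_difference x x' A A' D D' (B : set nat) j0 :
  annihilation x A D -> annihilation x' A' D' -> B `<=` A -> B `<=` A' ->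
  (forall i j, B i -> B j -> x i j = x' i j) ->
  finite_set [set i | B i /\ mine (D i) (D' i) <= mine (D j0) (D' j0)] ->
  B j0 -> D j0 <> D' j0 ->
  exists j, [/\ B j, mine (D j) (D' j) <= mine (D j0) (D' j0),
    forall i, B i -> D i <> D' i -> mine (D j) (D' j) <= mine (D i) (D' i) &
    (D j < D' j /\ exists k, [/\ A k, ~ B k, x j k = D j & D k = D j]) \/
    (D' j < D j /\ exists k, [/\ A' k, ~ B k, x' j k = D' j & D' k = D' j])].
Proof.
move=> [Da Db] [Da' Db'] BA BA' xx' finF Bj0 neq0.
set m := fun i => mine (D i) (D' i) in finF *.
pose F := [set i | (B i /\ m i <= m j0) /\ D i <> D' i].
have finF' : finite_set F by apply: sub_finite_set finF => i [].
have Fj0 : F j0 by split.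
have [j [_ [[[Bj jj0] nej] _ jm]]] :=
  finite_min (fun i _ => m i) finF' Fj0 Fj0.
have jmin i : B i -> D i <> D' i -> m j <= m i.
  move=> Bi nei; have [le|lt] := leP (m i) (m j0).
    by apply: (jm i i).
  exact: le_trans jj0 (ltW lt).
exists j; split=> //.
have alive k : B k -> m j <= D k /\ m j <= D' k \/ D k = D' k.
  move=> Bk; have [e|ne] := pselect (D k = D' k); first by right.
  by left; have := jmin k Bk ne; rewrite /m le_min => /andP[].
have [lt|lt|e] := ltgtP (D j) (D' j); last by [].
- have mj : m j = D j by rewrite /m /mine lt.
  left; split=> //; have [|k [Ak xk Dk]] := Db j (BA _ Bj).
    by apply: lt_le_trans lt _; exact: leey.
  exists k; split=> // Bk; have le : D j <= D' k.
    by case: (alive k Bk) => [[_]|<-]; rewrite ?mj// Dk.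
  have := Da' j k (BA' _ Bj) (BA' _ Bk).
  rewrite -xx'// xk => /(_ (lt_le_trans lt (leey _)) (ltW lt) le) e.
  by rewrite e ltxx in lt.
- have mj : m j = D' j by rewrite /m /mine ltNge ltW.
  right; split=> //; have [|k [Ak xk Dk]] := Db' j (BA' _ Bj).
    by apply: lt_le_trans lt _; exact: leey.
  exists k; split=> // Bk; have le : D' j <= D k.
    by case: (alive k Bk) => [[]|->]; rewrite ?mj// Dk.
  have := Da j k (BA _ Bj) (BA _ Bk).
  rewrite xx'// xk => /(_ (lt_le_trans lt (leey _)) (ltW lt) le) e.
  by rewrite e ltxx in lt.
Qed.

(** With [B] equal to [A], the outside partner of [first_difference] cannot exist. Finiteness
    provides an earliest discrepancy. *)
Lemma annihilation_unique x A D D' :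
  annihilation x A D -> annihilation x A D' ->
  (forall t, t < +oo -> finite_set [set i | A i /\ mine (D i) (D' i) <= t]) ->
  forall i, A i -> D i = D' i.
Proof.
move=> aD aD' fin i Ai; apply: contrapT => ne.
have fin' : finite_set [set k | A k /\
    mine (D k) (D' k) <= mine (D i) (D' i)].
  apply: fin; have [lt|lt|e] := ltgtP (D i) (D' i); last by [].
  - exact: lt_le_trans lt (leey _).
  - exact: lt_le_trans lt (leey _).
have [j [Aj _ _]] :=
  first_difference aD aD' (@subset_refl _ A) (@subset_refl _ A)
    (fun _ _ _ _ => erefl) fin' Ai ne.
by case=> -[_ [k []]].
Qed.

(** Each of [i] and [j] may have been removed with another partner at the same instant. At the
    earlier of the two stages both are still present and the minimum equals [x i j], so they form a
    closest pair as well. *)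
Lemma hitsP x A i j : (forall i j, x i j = x j i) ->
  hits x A i j <-> [/\ x i j < +oo, death x A i = x i j & death x A j = x i j].
Proof.
move=> xC; split=> [h|[xo di dj]].
  rewrite (death_hits h) (death_hits (hits_sym xC h)) (xC j); split=> //.
  by case: h => k [].
have [|i' hi] := @death_noo x A i; first by rewrite di.
have [|j' hj] := @death_noo x A j; first by rewrite dj.
have xi' : x i i' = x i j by rewrite -di (death_hits hi).
have xj' : x j j' = x i j by rewrite -dj (death_hits hj).
case: hi => k [li _ _ mi]; case: hj => l [lj _ _ mj].
rewrite xi' in mi; rewrite xj' in mj.
have [kl|lk] := leqP k l.
  by exists k; split=> //; exact: left_over_anti lj.
by exists l; split=> //; exact: left_over_anti (ltnW lk) _ li.
Qed.

Lemma finite_locally_finite x A : finite_set A -> locally_finite x A.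
Proof. by move=> finA t _; apply: sub_finite_set finA => i []. Qed.

(** Relabelling of the objects, applied below to the identity, to shifts of the indices and to time
    reversal. *)
Lemma left_over_image x x' A B (phi : nat -> nat) :
  (forall i, B i -> A (phi i)) -> (forall j, A j -> exists2 i, B i & phi i = j) ->
  (forall i j, B i -> B j -> x' i j = x (phi i) (phi j)) ->
  forall k i, B i -> left_over x' B k i <-> left_over x A k (phi i).
Proof.
move=> BA AB xx'; elim=> [|k IH] i Bi /=; first by split=> // _; exact: BA.
have cl p q : B p -> B q -> closest x' (left_over x' B k) p q <->
    closest x (left_over x A k) (phi p) (phi q).
  move=> Bp Bq; split=> -[lp lq xo mi].
    split; [exact/IH|exact/IH|by rewrite -xx'|].
    move=> a b la lb; have [a' Ba ea] := AB _ (left_over_subset la).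
    have [b' Bb eb] := AB _ (left_over_subset lb); subst a b.
    by rewrite -!xx'//; apply: mi; apply/IH.
  split; [exact/IH|exact/IH|by rewrite xx'|].
  move=> a b la lb; have Ba := left_over_subset la.
  have Bb := left_over_subset lb.
  by rewrite !xx'//; apply: mi; apply/IH.
split=> -[li N]; (split; first exact/IH) => -[j c]; apply: N.
  have Aj : A j by case: c => _ /left_over_subset.
  have [j' Bj ej] := AB _ Aj; subst j.
  by exists j'; apply/cl.
have Bj : B j by case: c => _ /left_over_subset.
by exists (phi j); apply/cl.
Qed.

Lemma hits_image x x' A B (phi : nat -> nat) :
  (forall i, B i -> A (phi i)) -> (forall j, A j -> exists2 i, B i & phi i = j) ->
  (forall i j, B i -> B j -> x' i j = x (phi i) (phi j)) ->
  forall i j, B i -> B j -> hits x' B i j <-> hits x A (phi i) (phi j).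
Proof.
move=> BA AB xx' i j Bi Bj.
have im := left_over_image BA AB xx'.
split=> -[k [li lj xo mi]]; exists k.
  split; [exact/im|exact/im|by rewrite -xx'|].
  move=> a b la lb; have [a' Ba ea] := AB _ (left_over_subset la).
  have [b' Bb eb] := AB _ (left_over_subset lb); subst a b.
  by rewrite -!xx'//; apply: mi; apply/im.
split; [exact/im|exact/im|by rewrite xx'|].
move=> a b la lb; have Ba := left_over_subset la.
have Bb := left_over_subset lb.
by rewrite !xx'//; apply: mi; apply/im.
Qed.

End Annihilation.

(** * Bullets as half-lines *)

Definition window (a b : nat) : set nat := [set i | (a <= i <= b)%N].

Lemma window_subset a b c d : (c <= a)%N -> (b <= d)%N ->
  window a b `<=` window c d.
Proof. by move=> ca bd i; rewrite /window /=; lia. Qed.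

Lemma window_last N k : window 0 N.+1 k -> ~ window 0 N k -> k = N.+1.
Proof. by rewrite /window /=; lia. Qed.

Lemma in_window a b i : (a <= i)%N -> (i <= b)%N -> window a b i.
Proof. by move=> ai ib; apply/andP. Qed.

Section Lines.
Variable R : realType.
Implicit Types (f w : nat -> R) (A : set nat) (D : nat -> \bar R).

(* The position at which bullets [i] and [j] meet: a bullet fired at time [f i]
   with slowness [w i] is at position [r] at time [f i + w i * r]. *)
Definition meeting f w i j : \bar R :=
  if (i < j)%N && (w j < w i) then ((f j - f i) / (w i - w j))%:E
  else if (j < i)%N && (w i < w j) then ((f i - f j) / (w j - w i))%:E
  else +oo%E.

Definition line f w i (r : R) : R := f i + w i * r.

Lemma finite_window a b : finite_set (window a b).
Proof.
apply/finite_seqP; exists (iota a (b.+1 - a)); apply/seteqP; split=> i; rewrite /window /=;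
  rewrite mem_iota => H; lia.
Qed.

Lemma meetingC f w i j : meeting f w i j = meeting f w j i.
Proof. by rewrite /meeting; case: (ltngtP i j) => //=; case: ltgtP. Qed.

Lemma meeting_eq f w w' i j : w i = w' i -> w j = w' j ->
  meeting f w i j = meeting f w' i j.
Proof. by rewrite /meeting => -> ->. Qed.

Lemma death_window f w a b :
  annihilation (meeting f w) (window a b) (death (meeting f w) (window a b)).
Proof.
apply: death_annihilation; first exact: meetingC.
exact/finite_locally_finite/finite_window.
Qed.

Section Increasing.
Variable f : nat -> R.
Hypothesis f_incr : forall i j, (i < j)%N -> f i < f j.

Lemma meetingP w i j : (meeting f w i j < +oo)%E -> exists r,
  [/\ meeting f w i j = r%:E, 0 < r, line f w i r = line f w j r &
      ((i < j)%N /\ w j < w i) \/ ((j < i)%N /\ w i < w j)].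
Proof.
rewrite /meeting; case: ifP => [/andP[ij wji] _|_].
  have fij := f_incr ij; exists ((f j - f i) / (w i - w j)); split=> //; last by left.
    by rewrite divr_gt0 ?subr_gt0.
  by rewrite /line; field; rewrite subr_eq0 gt_eqF.
case: ifP => [/andP[ij wji] _|_]; last by rewrite ltxx.
have fij := f_incr ij; exists ((f i - f j) / (w j - w i)); split=> //; last by right.
  by rewrite divr_gt0 ?subr_gt0.
by rewrite /line; field; rewrite subr_eq0 gt_eqF.
Qed.

Lemma meetingPlt w i j : (i < j)%N -> (meeting f w i j < +oo)%E -> exists r,
  [/\ meeting f w i j = r%:E, 0 < r, line f w i r = line f w j r & w j < w i].
Proof.
move=> ij /meetingP[r [e r0 l [[_ ?]|[ji _]]]]; last by lia.
by exists r.
Qed.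

Lemma meeting_lt w i j : (i < j)%N -> w j < w i -> exists r,
  [/\ meeting f w i j = r%:E, 0 < r & line f w i r = line f w j r].
Proof.
move=> ij wji; have [|r [? ? ? _]] := @meetingPlt w i j ij; last by exists r.
by rewrite /meeting ij wji ltry.
Qed.

(** The lines start in the order of the firing times, so a reversed order at [r] means that they
    have crossed by then. *)
Lemma crossing w i j r : (i < j)%N -> 0 <= r -> line f w j r <= line f w i r ->
  exists r', [/\ meeting f w i j = r'%:E, r' <= r, 0 < r' & w j < w i] /\
    (line f w j r = line f w i r -> r' = r).
Proof.
move=> ij r0 le; have fij := f_incr ij.
have wji : w j < w i by move: le; rewrite /line; nra.
have [r' [e r'0 l]] := meeting_lt ij wji.
exists r'; split.
  by split=> //; move: le l; rewrite /line; nra.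
move: l; rewrite /line => l l'.
have : (w i - w j) * (r' - r) = 0 by nra.
by move=> /eqP; rewrite mulf_eq0 !subr_eq0 gt_eqF//= => /eqP.
Qed.

(** A crossing strictly before [r] would be a meeting of two live bullets, hence their death before
    [r]. *)
Lemma noncrossing w A D i j r : annihilation (meeting f w) A D -> A i -> A j ->
  (i <= j)%N -> 0 <= r -> (r%:E <= D i)%E -> (r%:E <= D j)%E ->
  line f w i r <= line f w j r.
Proof.
move=> [Da _] Ai Aj; rewrite leq_eqVlt => /orP[/eqP->//|ij] r0 ri rj.
rewrite leNgt; apply/negP => lt.
have [r' [[e le r'0 _] _]] := crossing ij r0 (ltW lt).
have := Da i j Ai Aj; rewrite e ltry => /(_ isT).
have lr : r' < r.
  rewrite lt_neqAle le andbT; apply/eqP => er.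
  have [|r2 [e2 _ l _]] := @meetingPlt w i j ij; first by rewrite e ltry.
  by move: e2 l; rewrite e er => -[<-] l; rewrite l ltxx in lt.
have le' : (r'%:E <= r%:E)%E by rewrite lee_fin.
move=> /(_ (le_trans le' ri) (le_trans le' rj)) Di.
by move: ri; rewrite Di lee_fin leNgt lr.
Qed.

(** The recurrent way to exclude an interference: a bullet reaching some [k] beyond a live bullet is
    squeezed between the line of [k] and that of the live bullet, hence kills the latter at that
    very position. *)
Lemma meet_alive w A D i j r : annihilation (meeting f w) A D -> A i -> A j ->
  (i < j)%N -> 0 <= r -> (r%:E <= D i)%E -> (r%:E <= D j)%E ->
  line f w j r <= line f w i r ->
  [/\ meeting f w i j = r%:E, D i = r%:E & D j = r%:E].
Proof.
move=> aD Ai Aj ij r0 ri rj le.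
have ge := noncrossing aD Ai Aj (ltnW ij) r0 ri rj.
have [r' [[e _ _ _] H]] := crossing ij r0 le.
have {H}er : r' = r by apply: H; apply/eqP; rewrite eq_le le ge.
subst r'; case: aD => Da _.
have := Da i j Ai Aj; have := Da j i Aj Ai; rewrite (meetingC _ _ j) e ltry.
by move=> -> // ->.
Qed.

(* Nothing outside of the window between two bullets that annihilate each other
   interferes with it: the line of an outer bullet reaches the region between
   them only by crossing one of the two. *)
Lemma hits_window w A D i k : annihilation (meeting f w) A D ->
  window i k `<=` A -> (i < k)%N -> (meeting f w i k < +oo)%E ->
  D i = meeting f w i k -> D k = meeting f w i k ->
  hits (meeting f w) (window i k) i k.
Proof.
move=> aD WA ik xoo Di Dk; apply/hitsP; first exact: meetingC.
have [r0 [xE r00 l0 _]] := meetingPlt ik xoo.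
set D' := death _ _; have aD' : annihilation (meeting f w) (window i k) D'.
  exact: death_window.
have Wi : window i k i by rewrite /window /=; lia.
have Wk : window i k k by rewrite /window /=; lia.
suff : (r0%:E <= D' i)%E /\ (r0%:E <= D' k)%E.
  case: aD' => Da _ [li lk]; have := Da i k Wi Wk; have := Da k i Wk Wi.
  by rewrite (meetingC _ _ k) xE ltry => -> // ->.
have diff e : window i k e -> D e = r0%:E -> D e <> D' e ->
    (r0%:E <= D' i)%E /\ (r0%:E <= D' k)%E.
  move=> We De ne.
  have [|j [Wj jm mini]] := first_difference aD aD' WA (@subset_refl _ _)
    (fun _ _ _ _ => erefl) _ We ne.
    by apply: sub_finite_set (finite_window i k) => ? [].
  case=> -[lt [m [Am nWm xm Dm]]]; last by [].
  have mE : (mine (D j) (D' j) = D j)%E by rewrite /mine lt.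
  rewrite mE in jm mini.
  have [|r [er rgt0 ljm _]] := @meetingP w j m.
    by rewrite xm; apply: lt_le_trans lt _; exact: leey.
  rewrite xm in er; rewrite er in jm mini lt xm Dm.
  have rr0 : r <= r0.
    by rewrite -lee_fin; apply: (le_trans jm); rewrite De ge_min lexx.
  have Aj := WA _ Wj; have Ai := WA _ Wi; have Ak := WA _ Wk.
  have ri : (r%:E <= D i)%E by rewrite Di xE lee_fin.
  have rk : (r%:E <= D k)%E by rewrite Dk xE lee_fin.
  (* The outer bullet [m] reaches the window through [i] or [k] and kills it at [r]; since both die
     at [r0], the discrepancy does not start before [r0]. *)
  suff eqr : r = r0.
    rewrite eqr in mini; split.
      have [<-|ne'] := pselect (D i = D' i); first by rewrite Di xE.
      by apply: (le_trans (mini i Wi ne')); rewrite ge_min lexx orbT.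
    have [<-|ne'] := pselect (D k = D' k); first by rewrite Dk xE.
    by apply: (le_trans (mini k Wk ne')); rewrite ge_min lexx orbT.
  have Dj : (r%:E <= D j)%E by rewrite er.
  have Dm' : (r%:E <= D m)%E by rewrite Dm.
  move: Wj nWm; rewrite /window /= => Wj nWm.
  have [mi|im] := ltnP m i.
    have le : line f w i r <= line f w m r.
      by rewrite -ljm; apply: (noncrossing aD) => //; [lia|exact: ltW].
    have [_ _] := meet_alive aD Am Ai mi (ltW rgt0) Dm' ri le.
    by rewrite Di xE => -[].
  have km : (k < m)%N by lia.
  have le : line f w m r <= line f w k r.
    by rewrite -ljm; apply: (noncrossing aD) => //; [lia|exact: ltW].
  have [_ + _] := meet_alive aD Ak Am km (ltW rgt0) rk Dm' le.
  by rewrite Dk xE => -[].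
have [ei|ni] := pselect (D i = D' i); last by apply: (diff i) => //; rewrite Di.
have [ek|nk] := pselect (D k = D' k); last by apply: (diff k) => //; rewrite Dk.
by rewrite -ei -ek Di Dk xE.
Qed.

(** As [j] is the last bullet of the window, a partner of [j] lies before it, and [hits_window]
    confines their collision to the window between them. *)
Lemma unhit_survives w a j : (a <= j)%N ->
  (forall i, (a <= i < j)%N -> ~ hits (meeting f w) (window i j) i j) ->
  death (meeting f w) (window a j) j = +oo%E.
Proof.
move=> aj nh; apply/eqP; rewrite -leye_eq leNgt; apply/negP => dj.
have aD := death_window f w a j; have [_ Db] := aD.
have [|i [Wi xi Di]] := Db j _ dj; first by rewrite /window /=; lia.
have [r [e _ _ ij]] : exists r, [/\ meeting f w j i = r%:E, 0 < r,
  line f w j r = line f w i r & ((j < i)%N /\ w i < w j) \/ ((i < j)%N /\ w j < w i)].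
  by apply: meetingP; rewrite xi.
have lij : (i < j)%N by move: Wi; rewrite /window /=; case: ij => -[]; lia.
move: Wi; rewrite /window /= => Wi.
apply: (nh i); first by lia.
apply: (hits_window aD) => //; rewrite ?(meetingC _ _ i) ?xi//.
by move=> k; rewrite /window /=; lia.
Qed.

End Increasing.
End Lines.

(** * The two fastest speeds and the slowest one *)

Lemma meet_slower_later (R : realType) (fa fN wa u1 u2 r r' : R) :
  u1 < u2 -> u2 < wa -> 0 < r ->
  fa + wa * r = fN + u1 * r -> fa + wa * r' = fN + u2 * r' -> r < r'.
Proof.
move=> u12 u2a r0 e e'; rewrite ltNge; apply/negP => le.
have : 0 <= (wa - u2) * (r - r') by rewrite mulr_ge0// subr_ge0// ltW.
have : 0 < (u2 - u1) * r by rewrite mulr_gt0// subr_gt0.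
lra.
Qed.

Lemma meet_behind_later (R : realType) (fi fa fN wa u1 u2 r r' : R) :
  u1 < u2 -> u2 < wa -> 0 < r -> fi < fa ->
  fa + wa * r = fN + u1 * r -> fi + u2 * r' = fN + u1 * r' -> r < r'.
Proof.
move=> u12 u2a r0 fia e e'; rewrite ltNge; apply/negP => le.
have : 0 <= (u2 - u1) * (r - r') by rewrite mulr_ge0// subr_ge0// ltW.
have : 0 < (wa - u2) * r by rewrite mulr_gt0// subr_gt0.
lra.
Qed.

Section ThreeSpeeds.
Variables (R : realType) (f : nat -> R) (u1 u2 un : R).
Hypothesis f_incr : forall i j, (i < j)%N -> f i < f j.
Implicit Types (w : nat -> R) (A : set nat) (D : nat -> \bar R).

(** No sign is imposed, so that the negated slownesses of the reversed process qualify too. *)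
Definition admissible (c : R) := [\/ c = u1, c = u2 | u2 < c <= un].

Lemma parallel w i j : w i = w j -> meeting f w i j = +oo%E.
Proof. by rewrite /meeting => ->; rewrite ltxx !andbF. Qed.

(** If removing the bullets after [i] changed anything up to [i], the first change would be a bullet
    after [i] reaching some [j <= i]; by [meet_alive] it would kill the survivor [i]. *)
Lemma survives_prefix w N i D D' : (i <= N)%N ->
  annihilation (meeting f w) (window 0 N) D ->
  annihilation (meeting f w) (window 0 i) D' ->
  D i = +oo%E -> D' i = +oo%E.
Proof.
move=> iN aD aD' Di; apply: contrapT => ne.
have Wi : window 0 i i by rewrite /window /=; lia.
have Ni : window 0 N i by rewrite /window /=; lia.
have ne' : D i <> D' i by rewrite Di; exact: nesym.
have [||j [Wj jm _]] := first_difference aD aD' _ (@subset_refl _ _)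
    (fun _ _ _ _ => erefl) _ Wi ne'.
- by move=> k; rewrite /window /=; lia.
- by apply: sub_finite_set (finite_window 0 i) => k [].
case=> -[lt [m [Am nWm xm Dm]]]; last by [].
have [|r [er rgt0 ljm _]] := @meetingP _ f f_incr w j m.
  by rewrite xm; apply: lt_le_trans lt _; exact: leey.
rewrite xm in er.
have im : (i < m)%N by move: Am nWm; rewrite /window /=; lia.
have rDi : (r%:E <= D i)%E by rewrite Di leey.
have Nj : window 0 N j by move: Wj; rewrite /window /=; lia.
rewrite er in Dm; have rm : (r%:E <= D m)%E by rewrite Dm.
have ji : (j <= i)%N by move: Wj; rewrite /window /=; lia.
have le : line f w m r <= line f w i r.
  by rewrite -ljm; apply: (noncrossing f_incr aD) => //; rewrite ?er// ltW.
have [_ + _] := meet_alive f_incr aD Ni Am im (ltW rgt0) rDi rm le.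
by rewrite Di.
Qed.

Hypotheses (u12 : u1 < u2) (u2n : u2 < un).

Let lineS w i j r : (i < j)%N -> w i = u2 -> w j = u2 ->
  line f w i r < line f w j r.
Proof. by move=> /f_incr; rewrite /line => + -> ->; lra. Qed.

(* Only a bullet of the extreme slowness [u1] can hit one of slowness [u2] from
   the right, and such a bullet cannot be hit from its own right. *)
Lemma survives_suffix w A D i k : annihilation (meeting f w) A D ->
  window i k `<=` A -> (forall j, A j -> admissible (w j)) ->
  (i < k)%N -> w i = u2 -> D i = +oo%E -> ~ hits (meeting f w) (window i k) i k.
Proof.
move=> aD WA adm ik wi Di /hitsP[|xoo]; first exact: meetingC.
set D' := death _ _; have aD' : annihilation (meeting f w) (window i k) D'.
  exact: death_window.
move=> D'i D'k.
have [r0 [xE r00 l0 wki]] := meetingPlt f_incr ik xoo.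
have Wi : window i k i by rewrite /window /=; lia.
have Wk : window i k k by rewrite /window /=; lia.
have Ai := WA _ Wi; have Ak := WA _ Wk.
have wk : w k = u1.
  by case: (adm _ Ak) wki => [//|->|/andP[]]; rewrite wi; lra.
have ne : D i <> D' i by rewrite Di D'i xE.
have [|j [Wj jm _]] := first_difference aD aD' WA (@subset_refl _ _)
    (fun _ _ _ _ => erefl) _ Wi ne.
  by apply: sub_finite_set (finite_window i k) => ? [].
case=> -[lt [m [Am nWm xm Dm]]]; last by [].
have [|r [er rgt0 ljm _]] := @meetingP _ f f_incr w j m.
  by rewrite xm; apply: lt_le_trans lt _; exact: leey.
rewrite xm in er; rewrite er in lt Dm.
have rr0 : (r%:E <= r0%:E)%E.
  move: jm; rewrite D'i xE er Di {1}/mine lt; move/le_trans; apply.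
  by rewrite ge_min lexx orbT.
have Aj := WA _ Wj.
have rm : (r%:E <= D m)%E by rewrite Dm.
have rj : (r%:E <= D j)%E by rewrite er.
have ri : (r%:E <= D i)%E by rewrite Di leey.
move: (Wj) nWm; rewrite /window /= => Wj' nWm.
have [mi|im] := ltnP m i.
  have le : line f w i r <= line f w m r.
    rewrite -ljm; apply: (noncrossing f_incr aD Ai Aj _ (ltW rgt0) ri rj).
    by clear -Wj'; lia.
  have [_ _] := meet_alive f_incr aD Am Ai mi (ltW rgt0) rm ri le.
  by rewrite Di.
(* The bullet [m] is fired after [k], which has the smallest slowness, so the line of [m] stays
   strictly beyond that of [k], whereas the meeting with [j] would put it on the other side. *)
have km : (k < m)%N by clear -im nWm; lia.
have jk : (j <= k)%N by clear -Wj'; lia.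
have : line f w j r <= line f w k r.
  apply: (noncrossing f_incr aD' Wj Wk jk (ltW rgt0)).
  - exact: ltW.
  - by rewrite D'k xE.
have := f_incr km; rewrite ljm /line wk.
by case: (adm _ Am) => [->|->|/andP[? ?]]; nra.
Qed.

(** A partner of [i] on its right must be the new bullet, by [hits_window] and [survives_suffix]. A
    partner on its left is a discrepancy caused by some bullet fired after [i]; [meet_alive] shows
    that this bullet meets [i] at the same position, which leads back to the first case. *)
Lemma survives_extend w N i D D' : (i <= N)%N ->
  annihilation (meeting f w) (window 0 N) D ->
  annihilation (meeting f w) (window 0 N.+1) D' ->
  (forall j, window 0 N j -> admissible (w j)) ->
  w i = u2 -> D i = +oo%E ->
  D' i = +oo%E \/ [/\ (meeting f w i N.+1 < +oo)%E, D' i = meeting f w i N.+1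
    & D' N.+1 = meeting f w i N.+1].
Proof.
move=> iN aD aD' adm wi Di.
have Ni : window 0 N i by rewrite /window /=; lia.
have Ni' : window 0 N.+1 i by rewrite /window /=; lia.
have sub : window 0 N `<=` window 0 N.+1 by move=> k; rewrite /window /=; lia.
have right_partner k : window 0 N.+1 k -> (i < k)%N -> (D' i < +oo)%E ->
    meeting f w i k = D' i -> D' k = D' i -> k = N.+1.
  move=> Wk ik oo xi Dk; apply: contrapT => neq.
  have kN : (k <= N)%N by move: Wk; rewrite /window /=; lia.
  have WA : window i k `<=` window 0 N by move=> p; rewrite /window /=; lia.
  apply: (survives_suffix aD WA adm ik wi Di).
  apply: (hits_window f_incr aD') => //; rewrite ?xi//.
  by move=> p /WA /sub.
have [->|ne] := pselect (D' i = +oo%E); [by left|right].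
have oo : (D' i < +oo)%E by rewrite ltey; apply/eqP.
suff [k [Wk ik xi Dk]] : exists k, [/\ window 0 N.+1 k, (i < k)%N,
    meeting f w i k = D' i & D' k = D' i].
  by have e := right_partner k Wk ik oo xi Dk; subst k; rewrite xi Dk.
have [c [Wc xc Dc]] := aD'.2 i Ni' oo.
have [ci|ic|eic] := ltngtP c i; [|by exists c|]; last first.
  by move: xc oo; rewrite eic parallel// => <-; rewrite ltxx.
have ne' : D i <> D' i by rewrite Di; exact: nesym.
have Wi : window 0 i i by rewrite /window /=; lia.
have [|||j [Wj jm _]] := first_difference (B := window 0 i) aD aD' _ _
    (fun _ _ _ _ => erefl) _ Wi ne'.
- by move=> k; rewrite /window /=; lia.
- by move=> k; rewrite /window /=; lia.
- by apply: sub_finite_set (finite_window 0 i) => k [].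
have Nj : window 0 N j by move: Wj; rewrite /window /=; lia.
have ji : (j <= i)%N by move: Wj; rewrite /window /=; lia.
case=> -[lt [m [Am nWm xm Dm]]].
  have [|r [er rgt0 ljm _]] := @meetingP _ f f_incr w j m.
    by rewrite xm; apply: lt_le_trans lt _; exact: leey.
  rewrite xm in er; rewrite er in Dm.
  have im : (i < m)%N by move: Am nWm; rewrite /window /=; lia.
  have rDi : (r%:E <= D i)%E by rewrite Di leey.
  have rm : (r%:E <= D m)%E by rewrite Dm.
  have le : line f w m r <= line f w i r.
    by rewrite -ljm; apply: (noncrossing f_incr aD) => //; rewrite ?er// ltW.
  have [_ + _] := meet_alive f_incr aD Ni Am im (ltW rgt0) rDi rm le.
  by rewrite Di.
have [|r [er rgt0 ljm _]] := @meetingP _ f f_incr w j m.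
  by rewrite xm; apply: lt_le_trans lt _; exact: leey.
rewrite xm in er; rewrite er in Dm.
have im : (i < m)%N by move: Am nWm; rewrite /window /=; lia.
have rDi : (r%:E <= D' i)%E.
  have mj : mine (D j) (D' j) = D' j by rewrite /mine ltNge ltW.
  by rewrite mj er in jm; apply: (le_trans jm); rewrite ge_min lexx orbT.
have rm : (r%:E <= D' m)%E by rewrite Dm.
have Nj' := sub _ Nj.
have le : line f w m r <= line f w i r.
  by rewrite -ljm; apply: (noncrossing f_incr aD') => //; rewrite ?er// ltW.
have [xim D'i D'm] := meet_alive f_incr aD' Ni' Am im (ltW rgt0) rDi rm le.
by exists m; rewrite xim D'i D'm.
Qed.

(* The coupling behind the monotonicity of the expected number of survivors: it
   exchanges the slownesses [u1] and [u2] of the last bullet. *)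
Lemma last_survives w wL wS N i D DL DS : (i <= N)%N ->
  annihilation (meeting f w) (window 0 N) D ->
  annihilation (meeting f wL) (window 0 N.+1) DL ->
  annihilation (meeting f wS) (window 0 N.+1) DS ->
  (forall j, (j <= N)%N -> wL j = w j) -> (forall j, (j <= N)%N -> wS j = w j) ->
  wL N.+1 = u1 -> wS N.+1 = u2 ->
  (forall j, window 0 N j -> admissible (w j)) ->
  w i = u2 -> D i = +oo%E ->
  DL N.+1 = meeting f wL i N.+1 -> DS N.+1 = +oo%E.
Proof.
move=> iN aD aDL aDS eL eS wLN wSN adm wi Di DLN.
have eqM v : (forall j, (j <= N)%N -> v j = w j) ->
    annihilation (meeting f v) (window 0 N) D.
  move=> ev; case: aD => Da Db.
  have e p q : window 0 N p -> window 0 N q -> meeting f v p q = meeting f w p q.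
    by move=> Wp Wq; apply: meeting_eq; apply: ev; move: Wp Wq; rewrite /window /=; lia.
  split=> [p q Wp Wq|p Wp oo]; first by rewrite e//; exact: Da.
  by have [q [Wq xq Dq]] := Db p Wp oo; exists q; rewrite e.
have wSi : wS i = u2 by rewrite eS.
have wLi : wL i = u2 by rewrite eL.
have [rs [xs rs0 ls]] : exists r, [/\ meeting f wL i N.+1 = r%:E, 0 < r &
    line f wL i r = line f wL N.+1 r].
  by apply: (meeting_lt f_incr); rewrite ?wLi ?wLN//; lia.
rewrite xs in DLN.
have DSi : DS i = +oo%E.
  have [//|[]] := survives_extend iN (eqM wS eS) aDS
    (fun j Wj => eq_ind_r admissible (adm j Wj) (eS j (proj2 (andP Wj)))) wSi Di.
  by rewrite parallel ?ltxx// wSi wSN.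
apply: contrapT => ne.
have WN : window 0 N.+1 N.+1 by rewrite /window /=; lia.
have Wi : window 0 N.+1 i by rewrite /window /=; lia.
have oo : (DS N.+1 < +oo)%E by rewrite ltey; apply/eqP.
have [a [Wa xa Da]] := aDS.2 _ WN oo.
have aN : (a < N.+1)%N.
  rewrite ltn_neqAle; apply/andP; split; last by move: Wa; rewrite /window /=; lia.
  by apply/eqP => e; move: xa oo; rewrite e parallel// => <-; rewrite ltxx.
rewrite meetingC in xa.
have [|r' [xr r'0 lr wNa]] := @meetingPlt _ f f_incr wS a N.+1 aN; first by rewrite xa.
rewrite xr in xa; rewrite -xa in Da; rewrite wSN in wNa.
have [ai|ia|e] := ltngtP a i; last first.
- by move: Da; rewrite e DSi.
(* Here [a] lies between [i] and the last bullet. The fast version of the last bullet would meet [a]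
   at [rc], before meeting [i], so [a] must have died before [rc] in that process but not in the
   slow one. Such a discrepancy can only come from the last bullet, which is alive at [rc] in
   both. *)
- have wa : wL a = wS a by rewrite eL ?eS//; lia.
  have [rc [xc rc0 lc]] : exists r, [/\ meeting f wL a N.+1 = r%:E, 0 < r &
      line f wL a r = line f wL N.+1 r].
    by apply: (meeting_lt f_incr) => //; rewrite wLN wa; exact: lt_trans wNa.
  have fai := f_incr ia.
  have rcr' : rc < r'.
    by move: lc lr; rewrite /line wLN wSN wa; exact: meet_slower_later.
  have rcrs : rc < rs.
    by move: lc ls; rewrite /line wLN wLi wa; exact: meet_behind_later.
  have DLa : (DL a < rc%:E)%E.
    rewrite ltNge; apply/negP => le.
    have := aDL.1 N.+1 a WN Wa; rewrite meetingC xc DLN ltry lee_fin ltW//.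
    by move=> /(_ isT isT le) [e]; rewrite e ltxx in rcrs.
  have neq : DL a <> DS a.
    by move=> e; move: DLa; rewrite e Da lte_fin ltNge ltW.
  have W0a : window 0 N a by exact: in_window.
  have [||||j [Wj jm _]] := first_difference (B := window 0 N) aDL aDS _ _
    _ _ W0a neq.
  + exact: window_subset.
  + exact: window_subset.
  + by move=> p q /andP[_ pN] /andP[_ qN]; apply: meeting_eq; rewrite eL ?eS.
  + by apply: sub_finite_set (finite_window 0 N) => k [].
  have {}jm : (mine (DL j) (DS j) < rc%:E)%E.
    by apply: (le_lt_trans jm); rewrite gt_min DLa.
  case=> -[lt [k [Ak nWk xk Dk]]].
    have ek := window_last Ak nWk; subst k.
    by move: jm; rewrite /mine lt -Dk DLN lte_fin ltNge ltW.
  have ek := window_last Ak nWk; subst k.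
  have mj : mine (DL j) (DS j) = DS j by rewrite /mine ltNge ltW.
  by move: jm; rewrite mj -Dk -xa lte_fin ltNge ltW.
(* Here [a] lies before [i]; to meet the last bullet it would have to cross the survivor [i], whose
   line is parallel to that bullet. *)
- have rDi : (r'%:E <= DS i)%E by rewrite DSi leey.
  have rDa : (r'%:E <= DS a)%E by rewrite Da.
  have := noncrossing f_incr aDS Wa Wi (ltnW ai) (ltW r'0) rDa rDi.
  have := lineS r' (_ : i < N.+1)%N wSi wSN; rewrite ltnS lr => /(_ iN).
  by move=> /lt_le_trans H /H; rewrite ltxx.
Qed.

End ThreeSpeeds.

(** * The pattern of a slowest bullet followed by one of slowness [u2] *)

Lemma meet_slowest_first (R : realType) (fc fp fN wc u un r r' : R) :
  u < un -> wc <= un -> 0 < r -> fc < fp ->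
  fc + wc * r = fN + u * r -> fp + un * r' = fN + u * r' -> r' < r.
Proof.
move=> uun wcn r0 fcp e e'; rewrite ltNge; apply/negP => le.
have : 0 <= (un - u) * (r' - r) by rewrite mulr_ge0// subr_ge0// ltW.
have : 0 <= (un - wc) * r by rewrite mulr_ge0// ?subr_ge0// ltW.
lra.
Qed.

Section Pattern.
Variables (R : realType) (f : nat -> R) (u1 u2 un : R).
Hypothesis f_incr : forall i j, (i < j)%N -> f i < f j.
Hypothesis u2n : u2 < un.
Implicit Types (w : nat -> R) (D : nat -> \bar R).
Variable p : nat.

Lemma slowest_hits_next w c : w p = un -> w p.+1 = u2 -> w c <= un ->
  (c <= p)%N -> (meeting f w p p.+1 <= meeting f w c p.+1)%E.
Proof.
move=> wp wp1 wc; rewrite leq_eqVlt => /orP[/eqP ->//|cp].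
have [xoo|] := boolP (meeting f w c p.+1 < +oo)%E; last first.
  by rewrite -leNgt leye_eq => /eqP ->; rewrite leey.
have [r [-> r0 l _]] := meetingPlt f_incr (ltnW cp : (c < p.+1)%N) xoo.
have [|r1 [-> r10 l1]] := meeting_lt f_incr (ltnSn p : (p < p.+1)%N) (_ : w p.+1 < w p).
  by rewrite wp wp1.
rewrite lee_fin ltW//; move: l l1; rewrite /line wp wp1.
exact: meet_slowest_first (f_incr cp).
Qed.

Lemma slowest_hits_next_lt w c : w p = un -> w p.+1 = u2 -> w c <= un ->
  (c < p)%N -> (meeting f w p p.+1 < meeting f w c p.+1)%E.
Proof.
move=> wp wp1 wc cp.
have [|r1 [-> r10 l1]] := meeting_lt f_incr (ltnSn p : (p < p.+1)%N) (_ : w p.+1 < w p).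
  by rewrite wp wp1.
have [xoo|] := boolP (meeting f w c p.+1 < +oo)%E; last first.
  by rewrite -leNgt leye_eq => /eqP ->; rewrite ltry.
have [r [-> r0 l _]] := meetingPlt f_incr (ltnW cp : (c < p.+1)%N) xoo.
rewrite lte_fin; move: l l1; rewrite /line wp wp1.
exact: meet_slowest_first (f_incr cp).
Qed.

Lemma slowest_partner w A D c : annihilation (meeting f w) A D -> w p = un ->
  w c <= un -> meeting f w p c = D p -> (D p < +oo)%E -> (p < c)%N.
Proof.
move=> aD wp wc xc oo; rewrite -xc in oo.
have [r [_ _ _ []]] := meetingP f_incr oo; first by case.
by rewrite wp => -[_]; rewrite ltNge wc.
Qed.

(** The slowest bullet can only be hit from its right, where [p.+1] precedes the parallel [p.+2];
    and [p.+1] can only meet a bullet on its left, the first candidate being the nearest and slowest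
    one, [p]. *)
Lemma pattern_hits w D : w p = un -> w p.+1 = u2 -> w p.+2 = u2 ->
  (forall j, (j <= p)%N -> w j <= un) ->
  annihilation (meeting f w) (window 0 p.+2) D ->
  [/\ (meeting f w p p.+1 < +oo)%E, D p = meeting f w p p.+1
    & D p.+1 = meeting f w p p.+1].
Proof.
move=> wp wp1 wp2 wn aD.
have W0 : window 0 p.+2 p by apply: in_window; lia.
have W1 : window 0 p.+2 p.+1 by apply: in_window; lia.
have [|r1 [e1 r10 l1]] := meeting_lt f_incr (ltnSn p : (p < p.+1)%N) (_ : w p.+1 < w p).
  by rewrite wp wp1.
have [|r2 [e2 r20 l2]] := meeting_lt f_incr (ltnW (ltnSn p.+1) : (p < p.+2)%N)
  (_ : w p.+2 < w p).
  by rewrite wp wp2.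
suff [le0 le1] : (meeting f w p p.+1 <= D p)%E /\ (meeting f w p p.+1 <= D p.+1)%E.
  have := aD.1 p p.+1 W0 W1; have := aD.1 p.+1 p W1 W0.
  by rewrite (meetingC _ _ p.+1) e1 ltry -e1 => -> // ->.
split; rewrite leNgt; apply/negP => lt.
  have oo := lt_le_trans lt (leey _).
  have [c [Wc xc Dc]] := aD.2 p W0 oo.
  have wc : w c <= un.
    have [cp|pc] := leqP c p; first exact: wn.
    suff : c = p.+1 \/ c = p.+2 by case=> ->; rewrite ?wp1 ?wp2 ltW.
    by move: Wc pc; clear; rewrite /window /=; lia.
  have pc := slowest_partner aD wp wc xc oo.
  have [ec|ec] : c = p.+1 \/ c = p.+2.
    by move: Wc pc; clear; rewrite /window /=; lia.
    by subst c; rewrite xc ltxx in lt.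
  subst c; move: lt; rewrite -xc e1 e2 lte_fin ltNge => /negP; apply.
  have := f_incr (ltnSn p.+1).
  move: l1 l2; rewrite /line wp wp1 wp2 => l1 l2 ff.
  rewrite leNgt; apply/negP => r21.
  have : 0 < (un - u2) * (r1 - r2) by rewrite mulr_gt0// subr_gt0.
  by move: l1 l2 ff; lra.
have oo := lt_le_trans lt (leey _).
have [c [Wc xc Dc]] := aD.2 p.+1 W1 oo.
have [cp|pc] := leqP c p.
  move: lt; rewrite -xc (meetingC _ _ p.+1) ltNge => /negP; apply.
  by apply: slowest_hits_next => //; exact: wn.
have [ec|ec] : c = p.+1 \/ c = p.+2.
  by move: Wc pc; clear; rewrite /window /=; lia.
  by move: oo; rewrite -xc ec parallel ?ltxx.
by move: oo; rewrite -xc ec parallel ?ltxx// wp1.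
Qed.

(** Suppose [p.+2] meets [a] at [r']. Fired in position [p] instead, it would meet [a] at [rc < r'],
    and it survives, so [a] dies before [rc] in the process [w0] but not in [w]. The bullet causing
    the first such discrepancy is none of [p] (not hit from the left), [p.+1] (killed by [p] first)
    and [p.+2] (dies at [r']). *)
Lemma pattern_survives w w0 D D0 : w p = un -> w p.+1 = u2 -> w p.+2 = u2 ->
  w0 p = u2 -> (forall j, (j < p)%N -> w0 j = w j) ->
  (forall j, (j <= p)%N -> w j <= un) ->
  annihilation (meeting f w0) (window 0 p) D0 ->
  annihilation (meeting f w) (window 0 p.+2) D ->
  D0 p = +oo%E -> D p.+2 = +oo%E.
Proof.
move=> wp wp1 wp2 w0p w0e wn aD0 aD D0p.
have [xoo Dp Dp1] := pattern_hits wp wp1 wp2 wn aD.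
apply: contrapT => ne.
have W2 : window 0 p.+2 p.+2 by apply: in_window; lia.
have oo : (D p.+2 < +oo)%E by rewrite ltey; apply/eqP.
have [a [Wa xa Da]] := aD.2 _ W2 oo.
have [|r1 [e1 r10 l1]] := meeting_lt f_incr (ltnSn p : (p < p.+1)%N) (_ : w p.+1 < w p).
  by rewrite wp wp1.
have ap : (a < p)%N.
  have : (a <= p.+2)%N by case/andP: Wa.
  rewrite leq_eqVlt => /orP[/eqP e|]; first by rewrite -xa e parallel ?ltxx in oo.
  rewrite ltnS leq_eqVlt => /orP[/eqP e|].
    by rewrite -xa e parallel ?ltxx ?wp1 ?wp2 in oo.
  rewrite ltnS leq_eqVlt => /orP[/eqP e|//].
  have [|r2 [e2 r20 l2]] := meeting_lt f_incr (ltnW (ltnSn p.+1) : (p < p.+2)%N)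
    (_ : w p.+2 < w p).
    by rewrite wp wp2.
  have : r1%:E = r2%:E by rewrite -e1 -Dp -e Da -xa e meetingC.
  case=> er; subst r2; move: l1 l2; rewrite /line wp wp1 wp2 => ->.
  by have := f_incr (ltnSn p.+1); lra.
have apN : (a < p.+2)%N by apply: ltn_trans ap _; lia.
rewrite meetingC in xa.
have [|r' [xr r'0 lr wNa]] := @meetingPlt _ f f_incr w a p.+2 apN; first by rewrite xa.
rewrite xr in xa; rewrite -xa in Da; rewrite wp2 in wNa.
have [|rc [xc rc0 lc]] := meeting_lt f_incr ap (_ : w0 p < w0 a).
  by rewrite w0p w0e.
have rcr' : rc < r'.
  have ff := f_incr (ltnW (ltnSn p.+1) : (p < p.+2)%N).
  move: lc lr; rewrite /line w0p w0e// wp2 => lc lr.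
  rewrite ltNge; apply/negP => le.
  have : 0 <= (w a - u2) * (rc - r') by rewrite mulr_ge0// subr_ge0// ltW.
  by move: lc lr ff; lra.
have Wa0 : window 0 p a by apply: in_window => //; exact: ltnW.
have Wp0 : window 0 p p by exact: in_window.
have D0a : (D0 a < rc%:E)%E.
  rewrite ltNge; apply/negP => le.
  have := aD0.1 p a Wp0 Wa0; rewrite meetingC xc D0p ltry leey.
  by move=> /(_ isT isT le).
have neq : D0 a <> D a.
  by move=> e; move: D0a; rewrite e Da lte_fin ltNge ltW.
(* Since [a < p], the index [p] is positive and [window 0 p.-1] consists exactly of the bullets
   shared by [w0] and [w]. *)
have Wa1 : window 0 p.-1 a by apply: in_window => //; move: ap; clear; lia.
have [||||j [Wj jm _]] := first_difference (B := window 0 p.-1) aD0 aD _ _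
    _ _ Wa1 neq.
- by apply: window_subset => //; exact: leq_pred.
- by apply: window_subset => //; clear; lia.
- move=> i k /andP[_ ip] /andP[_ kp]; apply: meeting_eq; apply: w0e;
  by move: ip kp ap; clear; lia.
- by apply: sub_finite_set (finite_window 0 p.-1) => k [].
have {}jm : (mine (D0 j) (D j) < rc%:E)%E.
  by apply: (le_lt_trans jm); rewrite gt_min D0a.
have jp : (j < p)%N by case/andP: Wj => _; move: ap; clear; lia.
have wjn : w j <= un by apply: wn; exact: ltnW.
case=> -[lt [k [Ak nWk xk Dk]]].
  have ek : k = p by move: Ak nWk ap; clear; rewrite /window /=; lia.
  by subst k; move: lt; rewrite -Dk D0p ltNge leey.
have ek : [\/ k = p, k = p.+1 | k = p.+2].
  by move: Ak nWk ap; clear; rewrite /window /= => ? ? ?;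
    case: (ltngtP k p.+1) => ?; [apply: Or31|apply: Or33|apply: Or32]; lia.
have mj : mine (D0 j) (D j) = D j by rewrite /mine ltNge ltW.
have Djoo : (D j < +oo)%E by exact: lt_le_trans lt (leey _).
case: ek => ek; subst k.
- have := slowest_partner aD wp wjn; rewrite (meetingC _ _ p) xk Dk.
  by move=> /(_ erefl Djoo); rewrite ltnNge ltnW.
- by have := slowest_hits_next_lt wp wp1 wjn jp; rewrite xk -Dk Dp1 ltxx.
- by move: jm; rewrite mj -Dk -xa lte_fin ltNge ltW.
Qed.

Hypothesis u12 : u1 < u2.

(** The condition on the gaps says that [p.+2] catches [p.+1] at [r2], before [p.+1] would catch [p]
    at [r1]. As parallel lines are not met at the same position, [i] can only be [p.+1]; but without
    [p.+2] that bullet does not survive, because nothing else removes [p] in time. *)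
Lemma pattern_no_loss w D DL i : w p = un -> w p.+1 = u2 -> w p.+2 = u1 ->
  (forall j, (j <= p)%N -> w j <= un) ->
  (f p.+2 - f p.+1) * (un - u2) < (f p.+1 - f p) * (u2 - u1) ->
  annihilation (meeting f w) (window 0 p.+1) D ->
  annihilation (meeting f w) (window 0 p.+2) DL ->
  (i <= p.+1)%N -> w i = u2 -> D i = +oo%E -> DL p.+2 <> meeting f w i p.+2.
Proof.
move=> wp wp1 wp2 wn gap aD aDL ip wi Di DLi.
have W2 : window 0 p.+2 p.+2 by apply: in_window; lia.
have W1 : window 0 p.+2 p.+1 by apply: in_window; lia.
have V0 : window 0 p.+1 p by apply: in_window; lia.
have V1 : window 0 p.+1 p.+1 by apply: in_window; lia.
have [|r1 [e1 r10 l1]] := meeting_lt f_incr (ltnSn p : (p < p.+1)%N) (_ : w p.+1 < w p).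
  by rewrite wp wp1.
have [|r2 [e2 r20 l2]] := meeting_lt f_incr (ltnSn p.+1 : (p.+1 < p.+2)%N)
  (_ : w p.+2 < w p.+1).
  by rewrite wp1 wp2.
have r21 : r2 < r1.
  move: l1 l2; rewrite /line wp wp1 wp2 => l1 l2.
  have E1 : (un - u2) * r1 = f p.+1 - f p by move: l1; lra.
  have E2 : (u2 - u1) * r2 = f p.+2 - f p.+1 by move: l2; lra.
  move: gap; rewrite -E1 -E2 => gap.
  have : 0 < ((u2 - u1) * (un - u2)) * (r1 - r2) by move: gap; lra.
  by rewrite pmulr_rgt0 ?subr_gt0// mulr_gt0// subr_gt0.
have D1 : (r2%:E <= DL p.+1)%E.
  rewrite leNgt; apply/negP => lt.
  have oo := lt_le_trans lt (leey _).
  have [c [Wc xc Dc]] := aDL.2 _ W1 oo.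
  have [cp|pc] := leqP c p.
    have := slowest_hits_next wp wp1 (wn c cp) cp.
    by rewrite (meetingC _ _ c) xc e1 => /le_lt_trans/(_ lt); rewrite lte_fin ltNge ltW.
  have [ec|ec] : c = p.+1 \/ c = p.+2.
    by move: Wc pc; clear; rewrite /window /=; lia.
    by move: oo; rewrite -xc ec parallel ?ltxx.
  by move: lt; rewrite -xc ec e2 ltxx.
have D2 : DL p.+2 = r2%:E.
  have [lt|ge] := ltP (DL p.+2) r2%:E; last first.
    have := aDL.1 p.+2 p.+1 W2 W1; rewrite meetingC e2 ltry.
    by move=> /(_ isT ge D1).
  have oo := lt_le_trans lt (leey _).
  have [c [Wc xc Dc]] := aDL.2 _ W2 oo.
  have cp : (c <= p.+1)%N.
    rewrite -ltnS ltn_neqAle; apply/andP; split; last by case/andP: Wc.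
    by apply/eqP => ec; move: oo; rewrite -xc ec parallel ?ltxx.
  have := xc; rewrite meetingC => xc'.
  have [|r [er r0 lr _]] := @meetingPlt _ f f_incr w c p.+2 cp; first by rewrite xc'.
  rewrite er in xc'; rewrite -xc' in Dc lt.
  have rr : (r%:E <= DL p.+1)%E by apply: le_trans D1; exact: ltW.
  have rc : (r%:E <= DL c)%E by rewrite Dc.
  have := noncrossing f_incr aDL Wc W1 cp (ltW r0) rc rr.
  rewrite lr; move: lt l2; rewrite lte_fin /line wp1 wp2 => lt l2.
  have : 0 < (u2 - u1) * (r2 - r) by rewrite mulr_gt0// subr_gt0.
  by move=> *; exfalso; lra.
have ei : i = p.+1.
  move: ip; rewrite leq_eqVlt => /orP[/eqP//|lt].
  have [|r3 [e3 r30 l3]] := meeting_lt f_incr (ltnW lt : (i < p.+2)%N)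
    (_ : w p.+2 < w i).
    by rewrite wp2 wi.
  have [er] : r2%:E = r3%:E by rewrite -D2 DLi e3.
  subst r3; move: l2 l3; rewrite /line wi wp1 => <- e.
  by have := f_incr lt; move: e => *; exfalso; lra.
subst i.
have [lt|ge] := ltP (D p) (meeting f w p p.+1); last first.
  have := aD.1 p.+1 p V1 V0; rewrite meetingC e1 ltry Di leey.
  by rewrite -e1 => /(_ isT isT ge); rewrite e1.
have oo := lt_le_trans lt (leey _).
have [c [Wc xc Dc]] := aD.2 _ V0 oo.
have [cp|pc] := leqP c p.
  by have := slowest_partner aD wp (wn c cp) xc oo; rewrite ltnNge cp.
have ec : c = p.+1 by move: Wc pc; clear; rewrite /window /=; lia.
by subst c; move: lt; rewrite xc ltxx.
Qed.

End Pattern.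

(** * From the collisions to the half-lines *)

Section Process.
Variables (R : realType).
Implicit Types (z s : nat -> R) (A : set nat).

(** An infimum, because two bullets of equal speed fired at the same time coincide forever; this is
    not excluded for arbitrary spacings. *)
Definition first_meeting z s i j : \bar R :=
  ereal_inf [set u%:E | u in meet z s i j].

Lemma meet_min z s i j u : meet z s i j u ->
  exists2 u0, meet z s i j u0 & forall u, meet z s i j u -> u0 <= u.
Proof.
move=> [ij iu ju e]; have [sij|sij] := eqVneq (s i) (s j).
  exists (Num.max (fire_time z i) (fire_time z j)).
    split=> //; rewrite ?le_max ?lexx ?orbT//.
    by move: e; rewrite /position sij !mulrBr => /addrI/oppr_inj ->.
  by move=> v [_ iv jv _]; rewrite ge_max iv jv.
exists u => // v [_ _ _ e']; suff -> : u = v by [].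
move: e e'; rewrite /position => e e'.
have : (s i - s j) * (u - v) = 0 by lra.
by move=> /eqP; rewrite mulf_eq0 !subr_eq0 (negbTE sij) => /eqP.
Qed.

Lemma first_meeting_meet z s i j u0 : meet z s i j u0 ->
  (forall u, meet z s i j u -> u0 <= u) -> first_meeting z s i j = u0%:E.
Proof.
move=> m0 mi; apply/eqP; rewrite eq_le; apply/andP; split.
  by apply: ereal_inf_lbound; exists u0.
by apply: le_ereal_inf_tmp => _ [u m <-]; rewrite lee_fin mi.
Qed.

Lemma first_meeting_oo z s i j : (first_meeting z s i j < +oo)%E ->
  exists2 u0, meet z s i j u0 & first_meeting z s i j = u0%:E.
Proof.
move=> oo; have [u mu] : exists u, meet z s i j u.
  apply: contrapT => N; move: oo; rewrite /first_meeting.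
  rewrite (_ : [set _ | _ in _] = set0) ?ereal_inf0 ?ltxx//.
  by rewrite -subset0 => t [u mu _]; apply: N; exists u.
have [u0 m0 mi] := meet_min mu.
by exists u0 => //; exact: first_meeting_meet.
Qed.

Lemma next_collision_le z s A i j : A i -> A j ->
  (next_collision z s A <= first_meeting z s i j)%E.
Proof.
move=> Ai Aj; apply: le_ereal_inf_tmp => _ [u m <-].
by apply: ereal_inf_lbound; exists u => //; exists i, j.
Qed.

Lemma collide_nextE z s A i j :
  collide_next z s A i j <-> closest (first_meeting z s) A i j.
Proof.
split=> [[Ai Aj [u m e]]|[Ai Aj oo mi]].
  have eu : first_meeting z s i j = u%:E.
    apply/eqP; rewrite eq_le -{2}e next_collision_le// andbT.
    by apply: ereal_inf_lbound; exists u.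
  split=> //; first by rewrite eu ltry.
  by move=> k l Ak Al; rewrite eu -e; exact: next_collision_le.
have [u0 m0 e0] := first_meeting_oo oo.
split=> //; exists u0 => //; apply/eqP; rewrite eq_le -{1}e0.
rewrite next_collision_le//=; apply: le_ereal_inf_tmp.
move=> _ [u [k [l [Ak Al m]]] <-]; rewrite -e0.
apply: le_trans (mi _ _ Ak Al) _.
by apply: ereal_inf_lbound; exists u.
Qed.

Lemma remainingE z s k : remaining z s k = left_over (first_meeting z s) setT k.
Proof.
elim: k => //= k ->; apply/seteqP; split=> i [li N]; split=> // -[j c]; apply: N;
  by exists j; apply/collide_nextE.
Qed.

Lemma collideE z s i j : collide z s i j <-> hits (first_meeting z s) setT i j.
Proof.
by split=> -[k c]; exists k; move: c; rewrite remainingE => /collide_nextE.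
Qed.

Definition regular z s :=
  [/\ forall i, 0 < z i, forall i, 0 < s i & forall M, exists i, M < fire_time z i].

Lemma fire_timeS z i : fire_time z i.+1 = fire_time z i + z i.+1.
Proof. by rewrite /fire_time big_ord_recr. Qed.

Lemma fire_time_incr z : (forall i, 0 < z i) -> forall i j, (i < j)%N ->
  fire_time z i < fire_time z j.
Proof.
move=> z0 i; elim=> // j IH; rewrite ltnS leq_eqVlt fire_timeS => /orP[/eqP->|/IH].
  by rewrite ltrDl.
by move/lt_le_trans; apply; rewrite lerDl ltW.
Qed.

(* [clock] turns positions into times. *)
Definition clock (f w : nat -> R) i (d : \bar R) : \bar R :=
  ((f i)%:E + (w i)%:E * d)%E.

Lemma clock_fin f w i r : clock f w i r%:E = (line f w i r)%:E.
Proof. by []. Qed.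

Lemma clock_oo f w i : 0 < w i -> clock f w i +oo%E = +oo%E.
Proof. by move=> w0; rewrite /clock gt0_muley ?lte_fin. Qed.

Lemma clock_le f w i d d' : 0 < w i ->
  (clock f w i d <= clock f w i d')%E = (d <= d')%E.
Proof.
move=> w0; rewrite /clock leeD2lE// lee_pmul2l//.
Qed.

Lemma clock_inj f w i : 0 < w i -> injective (clock f w i).
Proof.
move=> w0 d d' e; apply/eqP; rewrite eq_le -(clock_le f d d' w0) -(clock_le f d' d w0) e.
by rewrite lexx.
Qed.

Lemma clock_ltoo f w i d : 0 < w i -> (clock f w i d < +oo)%E = (d < +oo)%E.
Proof. by move=> w0; rewrite -{1}(clock_oo f w0) !ltNge clock_le. Qed.

Section Regular.
Variables (f w : nat -> R).
Hypothesis f_incr : forall i j, (i < j)%N -> f i < f j.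
Hypothesis w_gt0 : forall i, 0 < w i.

Definition meeting_time i j := clock f w i (meeting f w i j).

Lemma meeting_timeE i j : (meeting f w i j < +oo)%E -> 
  meeting_time i j = clock f w j (meeting f w i j).
Proof. by move=> /(meetingP f_incr)[r [e _ l _]]; rewrite /meeting_time e !clock_fin l. Qed.

(** Each bullet has its own increasing change of clock, and two of these agree where the bullets
    meet, as their lines cross there. *)
Lemma annihilation_time A D T : (forall i, A i -> T i = clock f w i (D i)) ->
  annihilation meeting_time A T <-> annihilation (meeting f w) A D.
Proof.
move=> TD; split=> -[Da Db]; split.
- move=> i j Ai Aj oo; rewrite -(clock_le f (meeting f w i j) (D i) (w_gt0 i)).
  rewrite -(clock_le f (meeting f w i j) (D j) (w_gt0 j)) -meeting_timeE// -/(meeting_time i j).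
  rewrite -!TD// => li lj; apply: (clock_inj (f := f) (w_gt0 i)); rewrite -TD//.
  by apply: Da => //; rewrite /meeting_time clock_ltoo.
- move=> i Ai; rewrite -(clock_ltoo f _ (w_gt0 i)) -TD// => oo.
  have [j [Aj xj Tj]] := Db i Ai oo.
  have xi : meeting f w i j = D i.
    by apply: (clock_inj (f := f) (w_gt0 i)); rewrite -TD// -xj.
  exists j; split=> //; apply: (clock_inj (f := f) (w_gt0 j)).
  rewrite -TD// Tj -xi -meeting_timeE//.
  by rewrite xi -(clock_ltoo f _ (w_gt0 i)) -TD.
- move=> i j Ai Aj; rewrite /meeting_time clock_ltoo// => oo.
  rewrite !TD// clock_le// -/(meeting_time i j) meeting_timeE// clock_le// => li lj.
  by rewrite -meeting_timeE// /meeting_time; congr clock; exact: Da.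
- move=> i Ai; rewrite TD// clock_ltoo// => oo.
  have [j [Aj xj Dj]] := Db i Ai oo; exists j; split=> //.
    by rewrite /meeting_time xj.
  by rewrite TD// Dj -xj -meeting_timeE// xj.
Qed.

Lemma annihilation_ge0 A D i : annihilation (meeting f w) A D -> A i ->
  (0 <= D i)%E.
Proof.
move=> [_ Db] Ai; have [oo|] := ltP (D i) +oo%E; last first.
  by rewrite leye_eq => /eqP ->.
have [j [_ xj _]] := Db i Ai oo; rewrite -xj in oo *.
by have [r [-> r0 _ _]] := meetingP f_incr oo; rewrite lee_fin ltW.
Qed.

(** Infinitely many bullets may collide below a given position, but only finitely many are fired
    before a given time; hence the detour through [clock]. *)
Lemma tail_unique a D D' : (forall M, exists i, M < f i) ->
  annihilation (meeting f w) [set i | (a <= i)%N] D ->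
  annihilation (meeting f w) [set i | (a <= i)%N] D' ->
  forall i, (a <= i)%N -> D i = D' i.
Proof.
move=> f_unb aD aD' i ai; apply: (clock_inj (f := f) (w_gt0 i)).
have aT : annihilation meeting_time [set i | (a <= i)%N] (fun i => clock f w i (D i)).
  exact/(annihilation_time (D := D)).
have aT' : annihilation meeting_time [set i | (a <= i)%N] (fun i => clock f w i (D' i)).
  exact/(annihilation_time (D := D')).
apply: (annihilation_unique aT aT') => // t too.
have [m mM] : exists m, (t < (f m)%:E)%E.
  case: t too => [t _|//|_]; last by exists 0%N; rewrite ltNyr.
  by have [m mt] := f_unb t; exists m; rewrite lte_fin.
apply: (sub_finite_set _ (finite_window 0 m)) => k [ak le].
have fk : ((f k)%:E <= t)%E.
  apply: le_trans le; rewrite le_min -[X in (X <= _ k _)%E]adde0 -(mule0 (w k)%:E).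
  rewrite -/(clock f w k 0) clock_le// (annihilation_ge0 aD)//=.
  rewrite -[X in (X <= _)%E]adde0 -(mule0 (w k)%:E).
  by rewrite -/(clock f w k 0) clock_le// (annihilation_ge0 aD').
apply: in_window => //; rewrite leqNgt; apply/negP => mk.
have h : ((f m)%:E < (f k)%:E)%E by rewrite lte_fin f_incr.
by have := lt_trans (lt_le_trans h fk) mM; rewrite ltxx.
Qed.

(* A bullet [j] surviving among [a, ..., j] and the slowest bullet [j.+1]
   surviving in the process started from it never interact, so that the two
   processes evolve independently. *)
Lemma tail_glue a j un D D1 D2 : (a <= j)%N ->
  (forall M, exists i, M < f i) -> (forall i, w i <= un) -> w j.+1 = un ->
  annihilation (meeting f w) [set i | (a <= i)%N] D ->
  annihilation (meeting f w) (window a j) D1 ->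
  annihilation (meeting f w) [set i | (j.+1 <= i)%N] D2 ->
  D1 j = +oo%E -> D2 j.+1 = +oo%E -> forall i, window a j i -> D i = D1 i.
Proof.
move=> aj f_unb wn wj1 aD aD1 aD2 D1j D2j.
pose D3 i := if (i <= j)%N then D1 i else D2 i.
have D3l i : (i <= j)%N -> D3 i = D1 i by rewrite /D3 => ->.
have D3r i : (j < i)%N -> D3 i = D2 i by move=> ji; rewrite /D3 leqNgt ji.
(* At any position, the line of [i] is not beyond that of the survivor [j], that of [j.+1] is
   strictly beyond the line of [j], being fired later and at least as slow, and that of [k] is not
   short of the survivor [j.+1]. *)
have nomeet i k : (a <= i)%N -> (i <= j)%N -> (j < k)%N ->
    (meeting f w i k < +oo)%E -> (meeting f w i k <= D1 i)%E ->
    (meeting f w i k <= D2 k)%E -> False.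
  move=> ai ij jk oo; have ik := leq_ltn_trans ij jk.
  have [r [-> r0 l _]] := meetingPlt f_incr ik oo => li lk.
  have Wi : window a j i by exact: in_window.
  have Wj : window a j j by exact: in_window.
  have := noncrossing f_incr aD1 Wi Wj ij (ltW r0) li.
  rewrite D1j leey => /(_ isT) l1.
  have := noncrossing f_incr aD2 (leqnn _ : [set i | (j.+1 <= i)%N] j.+1) jk jk (ltW r0).
  rewrite D2j leey => /(_ isT lk) l2.
  have := f_incr (ltnSn j); have : 0 <= (un - w j) * r.
    by rewrite mulr_ge0 ?subr_ge0// ltW.
  by move: l l1 l2; rewrite /line wj1; lra.
have aD3 : annihilation (meeting f w) [set i | (a <= i)%N] D3.
  split.
    move=> i k /= ai ak oo; have [ij|ji] := leqP i j; have [kj|jk] := leqP k j.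
    - by rewrite !D3l//; apply: aD1.1 => //; exact: in_window.
    - by rewrite D3l// D3r// => li lk; case: (nomeet i k).
    - rewrite D3r// D3l// => li lk; case: (nomeet k i) => //; rewrite meetingC//.
    - by rewrite !D3r//; exact: aD2.1.
  move=> i /= ai; have [ij|ji] := leqP i j.
    rewrite D3l// => oo; have [|k [Wk xk Dk]] := aD1.2 i _ oo; first exact: in_window.
    by exists k; case/andP: Wk => ak kj; rewrite D3l.
  rewrite D3r// => oo; have [k [Wk xk Dk]] := aD2.2 i ji oo.
  by exists k; rewrite D3r//; split=> //; exact: leq_trans aj (ltnW Wk).
by move=> i /andP[ai ij]; rewrite (tail_unique f_unb aD aD3)// D3l.
Qed.

End Regular.

End Process.

Definition shifted (T : Type) (a : nat) (z : nat -> T) : nat -> T := fun i => z (a + i)%N.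

(** * Agreement of the collision dynamics with the half-lines *)

Section Link.
Variables (R : realType).
Implicit Types (z s : nat -> R).

Lemma meetC z s i j u : meet z s i j u -> meet z s j i u.
Proof. by move=> [? ? ? ?]; split=> //; exact: nesym. Qed.

Lemma first_meetingC z s i j : first_meeting z s i j = first_meeting z s j i.
Proof.
rewrite /first_meeting; congr (ereal_inf (image _ _)).
by apply/seteqP; split=> u /meetC.
Qed.

Definition slowness s i : R := (s i)^-1.

Lemma slowness_gt0 z s : regular z s -> forall i, 0 < slowness s i.
Proof. by move=> [_ s0 _] i; rewrite invr_gt0. Qed.

Lemma first_meetingE z s i j : regular z s ->
  first_meeting z s i j = meeting_time (fire_time z) (slowness s) i j.
Proof.
move=> reg; have w_gt0 := slowness_gt0 reg; have [z0 s0 _] := reg.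
have f_incr := fire_time_incr z0.
have mtC p q : meeting_time (fire_time z) (slowness s) p q =
    meeting_time (fire_time z) (slowness s) q p.
  have [oo|] := boolP (meeting (fire_time z) (slowness s) p q < +oo)%E.
    by rewrite meeting_timeE// /meeting_time meetingC.
  rewrite -leNgt leye_eq /meeting_time (meetingC _ _ q) => /eqP ->.
  by rewrite !clock_oo.
wlog ij : i j / (i < j)%N => [H|].
  have [ij|ji|->] := ltngtP i j; [exact: H|by rewrite first_meetingC mtC H|].
  rewrite /meeting_time parallel// clock_oo//; apply/eqP.
  rewrite -leye_eq leNgt; apply/negP => /first_meeting_oo[u [+ _ _ _] _].
  by [].
have fij := f_incr _ _ ij.
have sw k : s k * slowness s k = 1 by rewrite divff// gt_eqF.
have [oo|] := boolP (first_meeting z s i j < +oo)%E.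
  have [u [_ iu ju e] ->] := first_meeting_oo oo.
  set r := position z s i u.
  have r0 : 0 < r by rewrite mulr_gt0// subr_gt0; exact: lt_le_trans ju.
  have li : line (fire_time z) (slowness s) i r = u.
    by rewrite /line /r /position mulrA (mulrC (slowness s i)) sw; lra.
  have lj : line (fire_time z) (slowness s) j r = u.
    by rewrite /line /r e /position mulrA (mulrC (slowness s j)) sw; lra.
  have [|r' [[e' _ _ _] H]] := @crossing _ _ f_incr (slowness s) i j r ij (ltW r0).
    by rewrite li lj.
  by rewrite /meeting_time e' H ?li ?lj// clock_fin li.
rewrite -leNgt leye_eq => /eqP e; rewrite e; apply: contrapT => ne.
have : (meeting_time (fire_time z) (slowness s) i j < +oo)%E.
  by rewrite ltey; apply/eqP => e'; apply: ne.
rewrite /meeting_time clock_ltoo// => /(meetingPlt f_incr ij)[r [er r0 l wji]].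
suff : meet z s i j (line (fire_time z) (slowness s) i r).
  move=> /meet_min[u m mi].
  by move: e; rewrite (first_meeting_meet m mi).
split.
- by move=> ee; rewrite ee ltnn in ij.
- by rewrite /line lerDl mulr_ge0 ?ltW.
- by rewrite l /line lerDl mulr_ge0 ?ltW.
- rewrite {2}l /position /line !(addrC (fire_time z _)) !addrK !mulrA !sw.
  by rewrite !mul1r.
Qed.

Lemma regular_dynamics z s : regular z s -> exists D,
  annihilation (meeting (fire_time z) (slowness s)) setT D /\
  (first_survives z s <-> D 0%N = +oo%E).
Proof.
move=> reg; have w_gt0 := slowness_gt0 reg; have [z0 s0 unb] := reg.
have f_incr := fire_time_incr z0.
pose T := death (first_meeting z s) setT.
have aT : annihilation (first_meeting z s) setT T.
  apply: death_annihilation; first exact: first_meetingC.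
  move=> t too.
  have [m mM] : exists m, (t < (fire_time z m)%:E)%E.
    case: t too => [t _|//|_]; last by exists 0%N; rewrite ltNyr.
    by have [m mt] := unb t; exists m; rewrite lte_fin.
  apply: (sub_finite_set _ (finite_window 0 m)) => k [_ [j [_ le]]].
  have oo := le_lt_trans le too.
  have [u [_ ku _ _] eu] := first_meeting_oo oo.
  rewrite eu in le.
  apply: in_window => //; rewrite leqNgt; apply/negP => mk.
  have := lt_le_trans mM (_ : (fire_time z m)%:E <= t)%E; rewrite ltxx.
  have lt : ((fire_time z m)%:E <= u%:E)%E.
    by rewrite lee_fin (le_trans _ ku)// ltW// f_incr.
  by have := lt_le_trans mM (le_trans lt le); rewrite ltxx.
(* The inverse of [clock]: the position of the bullet at its death time. *)
pose D i := ((T i - (fire_time z i)%:E) * (s i)%:E)%E.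
have sw k : slowness s k * s k = 1 by rewrite mulVf// gt_eqF.
have TD i : T i = clock (fire_time z) (slowness s) i (D i).
  rewrite /clock /D; case: (T i) => [r| |].
  - rewrite -EFinB -!EFinM -EFinD mulrCA sw mulr1; congr (_%:E); lra.
  - by rewrite addye// gt0_mulye ?lte_fin// gt0_muley ?lte_fin.
  - by rewrite addNye gt0_mulNye ?lte_fin// gt0_muleNy ?lte_fin.
have e : first_meeting z s = meeting_time (fire_time z) (slowness s).
  by apply/funext => i; apply/funext => j; exact: first_meetingE.
have aD : annihilation (meeting (fire_time z) (slowness s)) setT D.
  by apply/(annihilation_time f_incr w_gt0 (fun i _ => TD i)); rewrite -e.
exists D; split=> //.
have DT : D 0%N = +oo%E <-> T 0%N = +oo%E.
  split=> [d0|t0]; first by rewrite TD d0 clock_oo.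
  by apply: (clock_inj (f := fire_time z) (w_gt0 0%N)); rewrite -TD t0 clock_oo.
apply: (iff_trans _ (iff_sym DT)); split=> [fs|t0].
  apply: contrapT => ne; apply: fs.
  have oo : (T 0%N < +oo)%E by rewrite ltey; apply/eqP.
  have [j h] := death_noo oo.
  have := oo; rewrite /T (death_hits h) e /meeting_time clock_ltoo//.
  move=> /(meetingP f_incr)[r [_ _ _ [[j0 wj]|[]//]]].
  exists j; split=> //; first by move: wj; rewrite ltf_pV2 ?posrE.
  by apply/collideE; apply: hits_sym h; exact: first_meetingC.
move=> [i [i0 _ /collideE h]].
have h' := hits_sym (first_meetingC z s) h.
have : (first_meeting z s 0 i < +oo)%E by case: h' => k [].
by rewrite -(death_hits h') -/T t0 ltxx.
Qed.

(** Reduces the fate of the first bullet in the infinite process to events that each depend on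
    finitely many bullets. *)
Lemma caught_hits z s : regular z s -> ~ first_survives z s ->
  exists2 k, (0 < k)%N & hits (meeting (fire_time z) (slowness s)) (window 0 k) 0 k.
Proof.
move=> reg nfs; have [D [aD DE]] := regular_dynamics reg; have [z0 s0 unb] := reg.
have f_incr := fire_time_incr z0.
have oo : (D 0%N < +oo)%E by rewrite ltey; apply/eqP => /DE.
have [k [_ xk Dk]] := aD.2 0%N I oo; rewrite -xk in oo.
have k0 : (0 < k)%N by have [r [_ _ _ []//[]]] := meetingP f_incr oo.
by exists k => //; apply: (hits_window f_incr aD) => //; rewrite xk.
Qed.

Lemma fire_time_shift z a i :
  fire_time (shifted a z) i = fire_time z (a + i)%N - \sum_(j < a) z j.
Proof.
apply/eqP; rewrite eq_sym subr_eq eq_sym; apply/eqP.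
by rewrite /fire_time -addnS big_split_ord/= addrC.
Qed.

Lemma regular_shift z s a : regular z s -> regular (shifted a z) (shifted a s).
Proof.
move=> [z0 s0 unb]; split=> [i|i|M]; [exact: z0|exact: s0|].
have [m mM] := unb (M + \sum_(j < a) z j); exists m; rewrite fire_time_shift.
rewrite ltrBrDr (lt_le_trans mM)//.
have [->|n] := eqVneq a 0%N; first by rewrite add0n.
by rewrite ltW// fire_time_incr//; move: n; clear; lia.
Qed.

Lemma meeting_shift z w a i j :
  meeting (fire_time (shifted a z)) (shifted a w) i j =
  meeting (fire_time z) w (a + i)%N (a + j)%N.
Proof.
by rewrite /meeting !fire_time_shift !ltn_add2l /shifted !opprB !addrA !subrK.
Qed.

Lemma shift_dynamics z s a : regular z s -> exists D,
  annihilation (meeting (fire_time z) (slowness s)) [set i | (a <= i)%N] D /\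
  (first_survives (shifted a z) (shifted a s) <-> D a = +oo%E).
Proof.
move=> reg; have [D [[Da Db] DE]] := regular_dynamics (regular_shift a reg).
have mE i j : (a <= i)%N -> (a <= j)%N -> 
  meeting (fire_time (shifted a z)) (slowness (shifted a s)) (i - a) (j - a) =
  meeting (fire_time z) (slowness s) i j.
  move=> ai aj; rewrite (_ : slowness (shifted a s) = shifted a (slowness s))//.
  by rewrite meeting_shift !subnKC.
exists (fun i => D (i - a)%N); rewrite subnn; split=> //; split.
  by move=> i j ai aj; rewrite -mE//; exact: Da.
move=> i ai oo; have [j [_ xj Dj]] := Db _ I oo; exists (a + j)%N.
by rewrite /= leq_addr -mE ?leq_addr// addKn.
Qed.

(* By [tail_glue] the bullets [i] and [j] would both survive among [i, ..., j],
   although [j] is faster than [i] and fired after it. *)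
Lemma no_two_survivors z s un i j : regular z s ->
  (forall l, slowness s l <= un) -> slowness s i = un -> slowness s j.+1 = un ->
  slowness s j < un -> (i < j)%N ->
  first_survives (shifted i z) (shifted i s) ->
  first_survives (shifted j.+1 z) (shifted j.+1 s) ->
  ~ (forall k, (i <= k < j)%N ->
       ~ hits (meeting (fire_time z) (slowness s)) (window k j) k j).
Proof.
move=> reg wn wi wj1 wj ij fsi fsj nh.
have w_gt0 := slowness_gt0 reg; have [z0 s0 unb] := reg.
have f_incr := fire_time_incr z0.
have [D [aD /iffLR/(_ fsi) Di]] := shift_dynamics i reg.
have [D2 [aD2 /iffLR/(_ fsj) D2j]] := shift_dynamics j.+1 reg.
have D1j := unhit_survives f_incr (ltnW ij) nh.
have aD1 := death_window (fire_time z) (slowness s) i j.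
have Wi : window i j i by apply: in_window => //; exact: ltnW.
have Wj : window i j j by apply: in_window => //; exact: ltnW.
have := tail_glue f_incr w_gt0 (ltnW ij) unb wn wj1 aD aD1 aD2 D1j D2j Wi.
rewrite Di => /esym D1i.
have [|r [er r0 l]] := meeting_lt f_incr ij (_ : slowness s j < slowness s i).
  by rewrite wi.
have := aD1.1 i j Wi Wj.
by rewrite D1i D1j er ltry leey => /(_ isT isT isT).
Qed.

End Link.

(** * Laws of independent families *)

Section LawUnique.
Context d (T : measurableType d) d' (T' : measurableType d') (R : realType).
Variables (U : Type) (G : set (set U)) (X : T -> U) (X' : T' -> U).
Variables (m : {measure set T -> \bar R}) (m' : {measure set T' -> \bar R}).
Local Open Scope ereal_scope.

Let agree C := [/\ measurable (X @^-1` C), measurable (X' @^-1` C) &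
  m (X @^-1` C) = m' (X' @^-1` C)].

(** Dynkin's argument on preimages. Measurability is part of the property [agree], so the case of
    equal maps and measures also yields the measurability of the preimages, as in
    [measurable_joint]. *)
Lemma law_unique : setI_closed G -> m setT = m' setT -> m setT < +oo ->
  (forall C, G C -> agree C) -> forall C, <<s G >> C -> agree C.
Proof.
move=> GI mT moo GX C; have moo' : m' setT < +oo by rewrite -mT.
rewrite -setI_closed_g_dynkin_g_sigma_algebra//.
move: C; apply: smallest_sub => //; split.
- have e1 : X @^-1` setT = setT by apply/seteqP.
  have e2 : X' @^-1` setT = setT by apply/seteqP.
  by split; [rewrite e1; exact: measurableT|rewrite e2; exact: measurableT|rewrite e1 e2].
- move=> A [mA mA' e]; split.
  + by rewrite -(preimage_setC X); exact: measurableC.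
  + by rewrite -(preimage_setC X'); exact: measurableC.
  + rewrite -(preimage_setC X) -(preimage_setC X') -!setTD (measureD measurableT mA moo).
    rewrite (measureD measurableT mA' moo') !setTI. congr (_ - _); [exact: mT|exact: e].
- move=> F tF aF; have tF1 S (f : S -> U) : trivIset setT (fun k => f @^-1` F k).
    move=> i j _ _ [x [Fi Fj]]; apply: tF => //.
    by exists (f x).
  split; rewrite !preimage_bigcup.
  + by apply: bigcupT_measurable => k; case: (aF k).
  + by apply: bigcupT_measurable => k; case: (aF k).
  + rewrite !measure_bigcup//; try by move=> k _; case: (aF k).
    by apply: eq_eseriesr => k _; case: (aF k).
Qed.

End LawUnique.

Section Boxes.
Variables (R : realType) (I : eqType).

(** Cylinders over finite subsets of [J]. The algebra they generate expresses that an event depends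
    only on the coordinates in [J]. *)
Definition boxes (J : set I) : set (set (I -> R)) :=
  [set C | exists (s : seq I) (B : I -> set R), [/\ uniq s,
    forall i, i \in s -> J i, forall i, measurable (B i) &
    C = [set y | forall i, i \in s -> B i (y i)]]].

Lemma boxes_setI J : setI_closed (boxes J).
Proof.
move=> _ _ [s [B [us sJ mB ->]]] [s' [B' [us' sJ' mB' ->]]].
exists (undup (s ++ s')); exists (fun i => (if i \in s then B i else setT) `&`
  (if i \in s' then B' i else setT)); split.
- exact: undup_uniq.
- by move=> i; rewrite mem_undup mem_cat => /orP[/sJ|/sJ'].
- by move=> i; apply: measurableI; case: ifP.
- apply/seteqP; split=> y /=.
    by move=> [H H'] i _; split; case: ifP => // ?; [exact: H|exact: H'].
  move=> H; split=> i si; have := H i; rewrite mem_undup mem_cat si ?orbT => -[]//.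
Qed.

Definition coordinate_algebra (J : set I) : set (set (I -> R)) := <<s boxes J >>.

Lemma boxes_sub J J' : J `<=` J' -> boxes J `<=` boxes J'.
Proof.
by move=> JJ' _ [s [B [us sJ mB ->]]]; exists s, B; split=> // i /sJ /JJ'.
Qed.

Lemma coordinate_algebra_sub J J' : J `<=` J' ->
  coordinate_algebra J `<=` coordinate_algebra J'.
Proof. by move=> JJ'; apply: sub_smallest2r (boxes_sub JJ'). Qed.

Lemma coordinate_measurable J i B : J i -> measurable B ->
  coordinate_algebra J [set y | B (y i)].
Proof.
move=> Ji mB; apply: sub_gen_smallest; exists [:: i], (fun=> B); split=> //.
- by move=> j; rewrite mem_seq1 => /eqP ->.
- apply/seteqP; split=> y /= H; first by move=> j; rewrite mem_seq1 => /eqP ->.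
  by apply: H; rewrite mem_head.
Qed.

Definition joint (T : Type) (Y : I -> T -> R) : T -> I -> R := fun t i => Y i t.

Lemma joint_box (T : Type) (Y : I -> T -> R) s B :
  joint Y @^-1` [set y | forall i, i \in s -> B i (y i)] =
  \big[setI/setT]_(i <- s) (Y i @^-1` B i).
Proof.
elim: s => [|i s IH]; first by rewrite big_nil; apply/seteqP; split.
rewrite big_cons -IH; apply/seteqP; split=> t /=.
  move=> H; split=> [|j js]; first by apply: H; rewrite mem_head.
  by apply: H; rewrite in_cons js orbT.
by move=> [Hi H] j; rewrite in_cons => /orP[/eqP ->//|]; exact: H.
Qed.

End Boxes.

Section Independence.
Context d (T : measurableType d) (R : realType) (P : probability T R).
Variable I : eqType.
Implicit Types (Y : I -> T -> R) (J : set I).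
Local Open Scope ereal_scope.

Definition independent Y := forall (s : seq I) (B : I -> set R),
  uniq s -> (forall i, measurable (B i)) ->
  P (\big[setI/setT]_(i <- s) (Y i @^-1` B i)) =
    \big[mule/1]_(i <- s) P (Y i @^-1` B i).

Lemma measurable_box Y (s : seq I) (B : I -> set R) : (forall i, measurable_fun setT (Y i)) ->
  (forall i, measurable (B i)) ->
  measurable (joint Y @^-1` [set y | forall i, i \in s -> B i (y i)]).
Proof.
move=> mY mB; rewrite joint_box; apply: bigsetI_measurable => i _.
by rewrite -[X in measurable X]setTI; exact: mY.
Qed.

Lemma measurable_joint Y J C : (forall i, measurable_fun setT (Y i)) ->
  coordinate_algebra J C -> measurable (joint Y @^-1` C).
Proof.
move=> mY sC.
have [||||//] := @law_unique _ T _ T R _ (boxes J) (joint Y) (joint Y) P P _ _ _ _ C sC.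
- exact: boxes_setI.
- by [].
- exact: le_lt_trans (probability_le1 P measurableT) (ltry 1).
- by move=> _ [s [B [us sJ mB ->]]]; split=> //; exact: measurable_box.
Qed.

Lemma fin_prob (A : set T) : measurable A -> P A \is a fin_num.
Proof.
move=> mA; rewrite ge0_fin_numE ?measure_ge0//.
exact: le_lt_trans (probability_le1 P mA) (ltry 1).
Qed.

(** One event is replaced at a time: for a fixed event [D], the restriction of [P] to [D] and [P]
    scaled by [P D] agree on boxes, hence on the algebra they generate. Two passes reduce the claim
    to a pair of boxes on disjoint coordinates. *)
Lemma independent_events Y J J' A C : (forall i, measurable_fun setT (Y i)) ->
  independent Y -> J `&` J' = set0 ->
  coordinate_algebra J A -> coordinate_algebra J' C ->
  P (joint Y @^-1` A `&` joint Y @^-1` C) =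
    P (joint Y @^-1` A) * P (joint Y @^-1` C).
Proof.
move=> mY ind JJ' sA sC.
have prod_law D K K' : measurable D -> (forall C, boxes K C ->
    P (D `&` joint Y @^-1` C) = P D * P (joint Y @^-1` C)) ->
    coordinate_algebra K K' -> P (D `&` joint Y @^-1` K') = P D * P (joint Y @^-1` K').
  move=> mD H sK.
  have p0 : (0 <= fine (P D))%R by exact: fine_ge0.
  have [||||_ _] := @law_unique _ T _ T R _ (boxes K) (joint Y) (joint Y)
    (mrestr P mD) (mscale (NngNum p0) P) _ _ _ _ K' sK.
  - exact: boxes_setI.
  - change (P (setT `&` D) = (fine (P D))%:E * P setT).
    rewrite setTI fineK ?fin_prob//; transitivity (P D * 1); first by rewrite mule1.
    by congr (_ * _); exact: esym (probability_setT P).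
  - change (P (setT `&` D) < +oo).
    by rewrite setTI ltey_eq fin_prob.
  - move=> L bL; have mL := measurable_joint mY (sub_gen_smallest bL).
    split=> //; change (P (joint Y @^-1` L `&` D) =
      (fine (P D))%:E * P (joint Y @^-1` L)).
    by rewrite setIC H// fineK// fin_prob.
  change (P (joint Y @^-1` K' `&` D) = (fine (P D))%:E * P (joint Y @^-1` K') ->
    P (D `&` joint Y @^-1` K') = P D * P (joint Y @^-1` K')).
  by rewrite setIC fineK// fin_prob.
apply: (prod_law _ J') => //; first exact: measurable_joint sA.
move=> _ [s [B [us sJ mB ->]]].
rewrite setIC muleC; apply: (prod_law _ J) => //; first exact: measurable_box.
move=> _ [s' [B' [us' sJ' mB' ->]]].
pose B2 i := if i \in s then B i else B' i.
have dis i : i \in s -> i \in s' -> False.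
  by move=> /sJ Ji /sJ' Ji'; have : (J `&` J') i by []; rewrite JJ'.
have e1 : \big[setI/setT]_(i <- s) (Y i @^-1` B i) =
    \big[setI/setT]_(i <- s) (Y i @^-1` B2 i).
  by apply: eq_big_seq => i si; rewrite /B2 si.
have e2 : \big[setI/setT]_(i <- s') (Y i @^-1` B' i) =
    \big[setI/setT]_(i <- s') (Y i @^-1` B2 i).
  by apply: eq_big_seq => i si; rewrite /B2; case: ifP => // /dis; case.
have mB2 i : measurable (B2 i) by rewrite /B2; case: ifP.
rewrite !joint_box e1 e2 -big_cat !ind ?big_cat//.
rewrite cat_uniq us us' andbT; apply/hasPn => i si'.
by apply/negP => /dis; exact.
Qed.

(** Covers the inversion of the speeds, the shifts and the time reversal. The sets [B' i] are [setT]
    outside of the image of [phi]. *)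
Lemma independent_comp (K : eqType) (phi : K -> I) (g : K -> R -> R) Y :
  injective phi -> (forall k, measurable_fun setT (g k)) -> independent Y ->
  forall (s : seq K) (B : K -> set R), uniq s -> (forall k, measurable (B k)) ->
  P (\big[setI/setT]_(k <- s) ((fun t => g k (Y (phi k) t)) @^-1` B k)) =
    \big[mule/1]_(k <- s) P ((fun t => g k (Y (phi k) t)) @^-1` B k).
Proof.
move=> iphi mg ind s B us mB.
pose B' i := [set x | forall k, phi k = i -> B k (g k x)].
have B'E k : B' (phi k) = g k @^-1` B k.
  apply/seteqP; split=> x /=; first exact.
  by move=> H k' /iphi ->.
have mB' i : measurable (B' i).
  have [[k <-]|N] := pselect (exists k, phi k = i).
    by rewrite B'E -[X in measurable X]setTI; exact: mg.
  rewrite (_ : B' i = setT)//; apply/seteqP; split=> x //= _ k e.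
  by case: N; exists k.
have := ind (map phi s) B'; rewrite map_inj_uniq// => /(_ us mB').
rewrite !big_map; under eq_bigr do rewrite B'E.
by under [in RHS]eq_bigr do rewrite B'E.
Qed.

End Independence.

Section EqualLaws.
Context d (T : measurableType d) d' (T' : measurableType d') (R : realType).
Variables (P : probability T R) (P' : probability T' R) (I : eqType).

Lemma equal_laws (Y : I -> T -> R) (Y' : I -> T' -> R) J C :
  (forall i, measurable_fun setT (Y i)) -> (forall i, measurable_fun setT (Y' i)) ->
  independent P Y -> independent P' Y' ->
  (forall i B, measurable B -> P (Y i @^-1` B) = P' (Y' i @^-1` B)) ->
  coordinate_algebra J C -> P (joint Y @^-1` C) = P' (joint Y' @^-1` C).
Proof.
move=> mY mY' ind ind' e sC.
have [||||//] := @law_unique _ T _ T' R _ (boxes J) (joint Y) (joint Y') P P' _ _ _ _ C sC.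
- exact: boxes_setI.
- exact: etrans (probability_setT P) (esym (probability_setT P')).
- exact: le_lt_trans (probability_le1 P measurableT) (ltry 1).
- move=> _ [s [B [us sJ mB ->]]]; split=> //; try exact: measurable_box.
  rewrite !joint_box; apply: etrans (ind s B us mB) _; apply: esym.
  by apply: etrans (ind' s B us mB) _; apply: eq_bigr => i _; exact/esym/e.
Qed.

End EqualLaws.

Notation coordinate := (nat + nat)%type.

(** * Measurability *)

Section MeasurableDynamics.
Context d (U : measurableType d) (R : realType).
Variables (x : U -> nat -> nat -> \bar R) (A : set nat).
Hypothesis mx : forall i j, A i -> A j -> measurable_fun setT ((fun y => x y i j) : U -> \bar R).

Lemma measurable_forall_nat (Q : nat -> U -> Prop) :
  (forall n, measurable [set y | Q n y]) -> measurable [set y | forall n, Q n y].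
Proof.
move=> mQ; rewrite (_ : [set y | _] = \bigcap_n [set y | Q n y]).
  exact: bigcapT_measurable.
by apply/seteqP; split=> y /= H n; [move=> _; exact: H|exact: (H n I)].
Qed.

Lemma measurable_exists_nat (Q : nat -> U -> Prop) :
  (forall n, measurable [set y | Q n y]) -> measurable [set y | exists n, Q n y].
Proof.
move=> mQ; rewrite (_ : [set y | _] = \bigcup_n [set y | Q n y]).
  exact: bigcupT_measurable.
by apply/seteqP; split=> y /= [n]; [exists n|move=> _; exists n].
Qed.

Lemma measurable_impl (Q Q' : U -> Prop) : measurable [set y | Q y] ->
  measurable [set y | Q' y] -> measurable [set y | Q y -> Q' y].
Proof.
move=> mQ mQ'; rewrite (_ : [set y | _] = ~` [set y | Q y] `|` [set y | Q' y]).
  by apply: measurableU => //; exact: measurableC.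
apply/seteqP; split=> y /=; last by move=> [nq q|q _].
by move=> H; have [/H|] := pselect (Q y); [right|left].
Qed.

Lemma measurable_const (Q : Prop) : measurable [set _ : U | Q].
Proof.
have [q|nq] := pselect Q.
  by rewrite (_ : [set _ | Q] = setT)//; apply/seteqP; split.
by rewrite (_ : [set _ | Q] = set0)//; apply/seteqP; split.
Qed.

Lemma measurable_lee_set (f g : U -> \bar R) : measurable_fun setT f ->
  measurable_fun setT g -> measurable [set y | (f y <= g y)%E].
Proof.
by move=> mf mg; rewrite -[X in measurable X]setTI; exact: measurable_lee.
Qed.

Lemma measurable_ltoo (f : U -> \bar R) : measurable_fun setT f ->
  measurable [set y | (f y < +oo)%E].
Proof.
by move=> mf; rewrite -[X in measurable X]setTI; exact: emeasurable_fun_infty_o.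
Qed.

Lemma measurable_closest (L : U -> set nat) i j :
  (forall y, L y `<=` A) -> (forall k, measurable [set y | L y k]) ->
  measurable [set y | closest (x y) (L y) i j].
Proof.
move=> LA mL.
have [Ai|nAi] := pselect (A i); last first.
  rewrite (_ : [set y | _] = set0)//; apply/seteqP; split=> y //=.
  by move=> [/LA/nAi].
have [Aj|nAj] := pselect (A j); last first.
  rewrite (_ : [set y | _] = set0)//; apply/seteqP; split=> y //=.
  by move=> [_ /LA/nAj].
rewrite (_ : [set y | _] = [set y | L y i] `&` [set y | L y j] `&`
  [set y | (x y i j < +oo)%E] `&`
  [set y | forall k l, L y k -> L y l -> (x y i j <= x y k l)%E]).
  apply: measurableI; first apply: measurableI; first exact: measurableI.
    by apply: measurable_ltoo; exact: mx.
  apply: measurable_forall_nat => k; apply: measurable_forall_nat => l.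
  have [Ak|nAk] := pselect (A k); last first.
    rewrite (_ : [set y | _] = setT)//; apply/seteqP; split=> y //=.
    by move=> _ /LA/nAk.
  have [Al|nAl] := pselect (A l); last first.
    rewrite (_ : [set y | _] = setT)//; apply/seteqP; split=> y //=.
    by move=> _ _ /LA/nAl.
  apply: measurable_impl => //; apply: measurable_impl => //.
  by apply: measurable_lee_set; exact: mx.
by apply/seteqP; split=> y /=; [move=> [? ? ? ?]|move=> [[[? ?] ?] ?]].
Qed.

Lemma measurable_left_over k i : measurable [set y | left_over (x y) A k i].
Proof.
elim: k i => [|k IH] i /=; first exact: measurable_const.
rewrite (_ : [set y | _] = [set y | left_over (x y) A k i] `&`
  ~` [set y | exists j, closest (x y) (left_over (x y) A k) i j])//.
apply: measurableI => //; apply: measurableC.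
apply: measurable_exists_nat => j; apply: measurable_closest => // y.
exact: left_over_subset.
Qed.

Lemma measurable_hits i j : measurable [set y | hits (x y) A i j].
Proof.
apply: measurable_exists_nat => k; apply: measurable_closest => [y|].
  exact: left_over_subset.
by move=> l; exact: measurable_left_over.
Qed.

Lemma measurable_survives i : measurable [set y | survives (x y) A i].
Proof. by apply: measurable_forall_nat => k; exact: measurable_left_over. Qed.

End MeasurableDynamics.

Section MeasurableMeeting.
Context d (U : measurableType d) (R : realType).

Lemma measurable_invr : measurable_fun setT ((fun x => x^-1) : R -> R).
Proof.
rewrite (_ : (fun x : R => x^-1) =
  (fun x => if x < 0 then - powR (- x) (- 1) else powR x (- 1))); last first.
  apply/funext => x; case: ltP => x0; last by rewrite powR_inv1.
  by rewrite powR_inv1 ?oppr_ge0 ?ltW// invrN opprK.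
apply: measurable_fun_ifT.
- by apply: measurable_fun_ltr; [exact: measurable_id|exact: measurable_cst].
- apply: measurable_funN; apply: (measurableT_comp (measurable_powR _)).
  by apply: measurable_funN; exact: measurable_id.
- exact: measurable_powR.
Qed.

(** Only differences of firing times are required to be measurable: an event about a window then
    ignores the spacing before its first bullet, which the independence of past and future relies
    on. *)
Lemma measurable_meeting (f w : U -> nat -> R) i j :
  measurable_fun setT ((fun y => w y i) : U -> R) -> measurable_fun setT ((fun y => w y j) : U -> R) ->
  ((i < j)%N -> measurable_fun setT ((fun y => f y j - f y i) : U -> R)) ->
  ((j < i)%N -> measurable_fun setT ((fun y => f y i - f y j) : U -> R)) ->
  measurable_fun setT ((fun y => meeting (f y) (w y) i j) : U -> \bar R).
Proof.
move=> mi mj mij mji; rewrite /meeting.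
case: (ltngtP i j) => [/mij mf|/mji mf|_] /=; last exact: measurable_cst.
- apply: measurable_fun_ifT; [exact: measurable_fun_ltr| |exact: measurable_cst].
  apply/measurable_EFinP; apply: measurable_funM => //.
  by apply: (measurableT_comp measurable_invr); exact: measurable_funB.
- apply: measurable_fun_ifT; [exact: measurable_fun_ltr| |exact: measurable_cst].
  apply/measurable_EFinP; apply: measurable_funM => //.
  by apply: (measurableT_comp measurable_invr); exact: measurable_funB.
Qed.

End MeasurableMeeting.

Lemma fire_time_diff (R : realType) (z : nat -> R) i j : (i <= j)%N ->
  fire_time z j - fire_time z i = \sum_(i <= l < j) z l.+1.
Proof.
elim: j => [|j IH]; first by rewrite leqn0 => /eqP ->; rewrite subrr big_geq.
rewrite leq_eqVlt => /orP[/eqP ->|ij]; first by rewrite subrr big_geq.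
by rewrite big_nat_recr//= -IH// fire_timeS addrAC.
Qed.

Section Coordinates.
Variable R : realType.
Implicit Types (y : coordinate -> R) (J : set coordinate).

Definition spacing y : nat -> R := fun i => y (inl i).
Definition slow y : nat -> R := fun i => y (inr i).

Definition update (w : nat -> R) (k : nat) (c : R) : nat -> R :=
  fun i => if i == k then c else w i.

Lemma updateE w k c : update w k c k = c.
Proof. by rewrite /update eqxx. Qed.

Lemma update_neq w k c i : i <> k -> update w k c i = w i.
Proof. by rewrite /update => /eqP/negbTE ->. Qed.

Lemma update_id w k : update w k (w k) = w.
Proof. by apply/funext => i; rewrite /update; case: eqP => // ->. Qed.

Lemma measurable_coordinate J k : J k ->
  measurable_fun setT ((fun y => y k) : g_sigma_algebraType (boxes (R := R) J) -> R).
Proof.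
move=> Jk _ B mB; rewrite setTI; exact: (coordinate_measurable Jk mB).
Qed.

Lemma measurable_window_meeting J a b (w : (coordinate -> R) -> nat -> R) :
  (forall i, (a < i <= b)%N -> J (inl i)) ->
  (forall i, window a b i -> measurable_fun setT
     ((fun y => w y i) : g_sigma_algebraType (boxes (R := R) J) -> R)) ->
  forall i j, window a b i -> window a b j ->
  measurable_fun setT ((fun y => meeting (fire_time (spacing y)) (w y) i j) :
    g_sigma_algebraType (boxes (R := R) J) -> \bar R).
Proof.
move=> HJ mw i j Wi Wj.
have mdiff p q : window a b p -> window a b q -> (p < q)%N -> measurable_fun setT
  ((fun y => fire_time (spacing y) q - fire_time (spacing y) p) :
     g_sigma_algebraType (boxes (R := R) J) -> R).
  move=> /andP[ap _] /andP[_ qb] pq.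
  apply: (@eq_measurable_fun _ _ (g_sigma_algebraType (boxes (R := R) J)) _ _
    (fun y : coordinate -> R => \sum_(l <- index_iota p q)
    (if (p <= l < q)%N then spacing y l.+1 else 0))).
    move=> y _; rewrite fire_time_diff ?(ltnW pq)//.
    by rewrite [RHS]big_nat_cond [RHS]big_mkcond; apply: eq_bigr => l _; rewrite andbT.
  apply: measurable_sum => l.
  case E : (p <= l < q)%N; last exact: measurable_cst.
  move/andP: E => [pl lq]; apply: measurable_coordinate; apply: HJ.
  by move: ap pl lq qb; clear; lia.
by apply: measurable_meeting; [exact: mw|exact: mw|exact: mdiff|exact: mdiff].
Qed.

Lemma measurable_update J k c i : (i <> k -> J (inr i)) ->
  measurable_fun setT ((fun y => update (slow y) k c i) :
    g_sigma_algebraType (boxes (R := R) J) -> R).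
Proof.
rewrite /update; case: eqP => [_ _|nk Ji]; first exact: measurable_cst.
by apply: measurable_coordinate; exact: Ji.
Qed.

End Coordinates.

(** * Events of the coupling *)

Section Events.
Variables (R : realType) (u1 u2 un : R).
Hypotheses (u12 : u1 < u2) (u2n : u2 < un).
Implicit Types (y : coordinate -> R).

Definition typical : set (coordinate -> R) :=
  [set y | forall i, 0 < spacing y i /\ admissible u1 u2 un (slow y i)].

(* [safe_left N]: a bullet of slowness [u2] would not be hit by the bullets
   fired before it if it were fired in position [N]. *)
Definition safe_left N : set (coordinate -> R) := [set y |
  survives (meeting (fire_time (spacing y)) (update (slow y) N u2)) (window 0 N) N].

(** Each window starts at [j], whose slowness is prescribed, so the event reads only coordinates
    after [j]. *)
Definition safe_right j N : set (coordinate -> R) := [set y | forall k, (j < k <= N)%N ->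
  ~ hits (meeting (fire_time (spacing y)) (update (slow y) j u2)) (window j k) j k].

Definition survivor N i : set (coordinate -> R) := [set y | slow y i = u2 /\
  survives (meeting (fire_time (spacing y)) (slow y)) (window 0 N) i].

(* [killed N i]: the bullet [i] survives among the first ones, but would be hit
   by the next bullet if that one had slowness [u1]. *)
Definition killed N i : set (coordinate -> R) := [set y | survivor N i y /\
  hits (meeting (fire_time (spacing y)) (update (slow y) N.+1 u1))
    (window 0 N.+1) i N.+1].

(** The two bounds on the spacings imply the gap condition of [pattern_no_loss]. The threshold 1 is
    arbitrary: it splits that condition into one bound per spacing, so that the event is a box. *)
Definition pattern p : set (coordinate -> R) := [set y | [/\ slow y p = un,
  slow y p.+1 = u2, 1 < spacing y p.+1 &
  spacing y p.+2 < (u2 - u1) / (un - u2)]].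

Section Typical.
Variable y : coordinate -> R.
Hypothesis ty : typical y.

Let f_incr : forall i j, (i < j)%N -> fire_time (spacing y) i < fire_time (spacing y) j.
Proof. by apply: fire_time_incr => i; exact: (ty i).1. Qed.

Let adm i : admissible u1 u2 un (slow y i).
Proof. exact: (ty i).2. Qed.

Let f := fire_time (spacing y).

Lemma survivesE w N i : (i <= N)%N -> survives (meeting f w) (window 0 N) i <->
  death (meeting f w) (window 0 N) i = +oo%E.
Proof. by move=> iN; apply: survivesP; exact: in_window. Qed.

Lemma safe_leftP N w : (forall i, (i < N)%N -> w i = slow y i) -> w N = u2 ->
  safe_left N y <-> death (meeting f w) (window 0 N) N = +oo%E.
Proof.
move=> we wN; rewrite /safe_left /= -survivesE//.
suff e k i : window 0 N i -> left_over (meeting f w) (window 0 N) k i <->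
    left_over (meeting f (update (slow y) N u2)) (window 0 N) k i.
  have W : window 0 N N by exact: in_window.
  by split=> H k; apply/(e k N W); exact: H.
move=> Wi; apply: (@left_over_image _ _ _ (window 0 N) (window 0 N) id) => //.
  by move=> j; exists j.
move=> p q Wp Wq; apply: meeting_eq.
  have [->|ne] := eqVneq p N; first by rewrite updateE.
  rewrite update_neq ?we//; first by move: ne Wp; clear; rewrite /window /=; lia.
  exact/eqP.
have [->|ne] := eqVneq q N; first by rewrite updateE.
rewrite update_neq ?we//; first by move: ne Wq; clear; rewrite /window /=; lia.
exact/eqP.
Qed.

Lemma survivor_step N i : (i <= N)%N -> survivor N i y ->
  survivor N.+1 i y \/ slow y N.+1 = u1 /\ killed N i y.
Proof.
move=> iN [wi si]; have Di := (survivesE _ iN).1 si.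
have aD := death_window f (slow y) 0 N.
have aD' := death_window f (slow y) 0 N.+1.
have [D'i|[oo D'i D'N]] := survives_extend f_incr u12 u2n iN aD aD' (fun j _ => adm j) wi Di.
  by left; split=> //; apply/survivesE => //; exact: leqW.
right; have [r [_ _ _ wN]] := meetingPlt f_incr (iN : (i < N.+1)%N) oo.
have wN1 : slow y N.+1 = u1.
  by case: (adm N.+1) wN => [//|->|/andP[]]; rewrite wi ?ltxx// => a _ /(lt_trans a); rewrite ltxx.
split=> //; split; first by split.
by rewrite -wN1 update_id; apply/hitsP => //; exact: meetingC.
Qed.

Lemma survivor_last N : slow y N = u2 -> safe_left N y -> survivor N N y.
Proof. by move=> wN; rewrite /safe_left /= -wN update_id; split. Qed.

Lemma killed_safe_left N i : (i <= N)%N -> killed N i y -> safe_left N.+1 y.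
Proof.
move=> iN [[wi si] h]; have Di := (survivesE _ iN).1 si.
move/(hitsP _ _ _ (meetingC _ _)): h => [_ _ DN].
apply/(safe_leftP (w := update (slow y) N.+1 u2)).
- by move=> j jN; rewrite update_neq// => e; rewrite e ltnn in jN.
- by rewrite updateE.
- have up j c : (j <= N)%N -> update (slow y) N.+1 c j = slow y j.
    by move=> jN; rewrite update_neq// => e; rewrite e ltnn in jN.
  exact: (last_survives f_incr u12 u2n iN (death_window f (slow y) 0 N)
    (death_window f _ 0 N.+1) (death_window f _ 0 N.+1) (fun j jN => up j u1 jN)
    (fun j jN => up j u2 jN) (updateE _ _ _) (updateE _ _ _)
    (fun j _ => adm j) wi Di DN).
Qed.

(** Both bullets have slowness [u2], and the next bullet cannot meet two parallel lines at the same
    position. *)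
Lemma killed_inj N i j : (i <= N)%N -> (j <= N)%N -> killed N i y ->
  killed N j y -> i = j.
Proof.
wlog ij : i j / (i < j)%N => [H iN jN ki kj|iN jN].
  by have [ij|ji|//] := ltngtP i j; [exact: H|apply/esym; exact: H].
move=> [[wi _] /(hitsP _ _ _ (meetingC _ _))[oi _ Di]].
move=> [[wj _] /(hitsP _ _ _ (meetingC _ _))[oj _ Dj]].
have [r [e r0 l _]] := meetingPlt f_incr (iN : (i < N.+1)%N) oi.
have [r' [e' r0' l' _]] := meetingPlt f_incr (jN : (j < N.+1)%N) oj.
have er : r = r' by apply: EFin_inj; rewrite -e -e' -Di -Dj.
move: l l'; rewrite er /line !updateE !update_neq ?wi ?wj.
- by move=> <- /addIr; rewrite /f => fe; have := f_incr ij; rewrite fe ltxx.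
- by move=> ee; move: jN; rewrite ee ltnn.
- by move=> ee; move: iN; rewrite ee ltnn.
Qed.

Lemma slow_le i : slow y i <= un.
Proof.
case: (adm i) => [->|->|/andP[//]]; last exact: ltW.
exact/ltW/(lt_trans u12).
Qed.

Lemma pattern_safe_left p : pattern p y -> safe_left p y -> safe_left p.+2 y.
Proof.
move=> [wp wp1 _ _].
move/(safe_leftP (w := update (slow y) p u2)) => D0.
apply/(safe_leftP (w := update (slow y) p.+2 u2)).
- by move=> j jN; rewrite update_neq// => e; rewrite e ltnn in jN.
- by rewrite updateE.
- have up j c : (j < p.+2)%N -> update (slow y) p.+2 c j = slow y j.
    by move=> jN; rewrite update_neq// => e; rewrite e ltnn in jN.
  have up0 j c : (j < p)%N -> update (slow y) p c j = slow y j.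
    by move=> jN; rewrite update_neq// => e; rewrite e ltnn in jN.
  apply: (pattern_survives f_incr u2n _ _ _ (updateE (slow y) p u2) _ _
    (death_window f _ 0 p) (death_window f _ 0 p.+2)).
  + by rewrite up.
  + by rewrite up.
  + exact: updateE.
  + by move=> j jp; rewrite up0// up// ltnW// ltnW.
  + move=> j jp; rewrite up ?slow_le// ltnS leqW//.
  + apply: D0; last exact: updateE.
    by move=> j jN; rewrite up0.
Qed.

Lemma pattern_not_killed p i : pattern p y -> (i <= p.+1)%N -> ~ killed p.+1 i y.
Proof.
move=> [wp wp1 z1 z2] ip [[wi si] /(hitsP _ _ _ (meetingC _ _))[_ _ DN]].
have Di := (survivesE _ ip).1 si.
have up j : (j < p.+2)%N -> update (slow y) p.+2 u1 j = slow y j.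
  by move=> jN; rewrite update_neq// => e; rewrite e ltnn in jN.
have aD : annihilation (meeting f (update (slow y) p.+2 u1)) (window 0 p.+1)
    (death (meeting f (slow y)) (window 0 p.+1)).
  have [Da Db] := death_window f (slow y) 0 p.+1.
  have e a b : window 0 p.+1 a -> window 0 p.+1 b ->
    meeting f (update (slow y) p.+2 u1) a b = meeting f (slow y) a b.
    by move=> /andP[_ ap] /andP[_ bp]; apply: meeting_eq; exact: up.
  split=> [a b Wa Wb|a Wa oo]; first by rewrite e//; exact: Da.
  by have [b [Wb xb Db']] := Db a Wa oo; exists b; rewrite e.
apply: (pattern_no_loss f_incr u2n u12 _ _ (updateE _ _ _) _ _ aD
  (death_window f _ 0 p.+2) ip _ Di DN); rewrite ?up//; try exact: ltnW.
- by move=> j jp; rewrite up ?slow_le// ltnS leqW.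
- have e l : f l.+1 - f l = spacing y l.+1 by rewrite /f fire_timeS addrAC subrr add0r.
  have a0 : 0 < un - u2 by rewrite subr_gt0.
  have b0 : 0 < u2 - u1 by rewrite subr_gt0.
  rewrite !e; move: z2; rewrite ltr_pdivlMr// => z2; apply: (lt_trans z2).
  by rewrite -{1}(mul1r (u2 - u1)) ltr_pM2r.
Qed.

Lemma survivor_safe N i : (i <= N)%N -> survivor N i y ->
  safe_left i y /\ safe_right i N y.
Proof.
move=> iN [wi si]; have Di := (survivesE _ iN).1 si.
have aD := death_window f (slow y) 0 N.
split.
  apply/(safe_leftP (w := slow y)) => //.
  exact: (survives_prefix f_incr iN aD (death_window f (slow y) 0 i) Di).
move=> k /andP[ik kN]; rewrite -wi update_id.
apply: (survives_suffix f_incr u12 u2n aD _ (fun j _ => adm j) ik wi Di).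
exact: window_subset.
Qed.

Lemma safe_left0 : safe_left 0 y.
Proof.
apply/(safe_leftP (w := update (slow y) 0 u2)) => //.
apply: (unhit_survives f_incr (leqnn 0)) => i.
by rewrite ltn0 andbF.
Qed.

End Typical.

(** The spacing before bullet [N] belongs to its past, while its slowness belongs neither to
    [before N] nor to [after N]. *)
Definition before N : set coordinate :=
  [set k | match k with inl l => (l <= N)%N | inr l => (l < N)%N end].

Definition after N : set coordinate :=
  [set k | match k with inl l => (N < l)%N | inr l => (N < l)%N end].

Lemma measurable_survives_window J a b i (w : (coordinate -> R) -> nat -> R) :
  (forall i, (a < i <= b)%N -> J (inl i)) ->
  (forall i, window a b i -> measurable_fun setT
     ((fun y => w y i) : g_sigma_algebraType (boxes (R := R) J) -> R)) ->
  coordinate_algebra J [set y | survives (meeting (fire_time (spacing y)) (w y))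
    (window a b) i].
Proof. by move=> HJ mw; exact: (measurable_survives (measurable_window_meeting HJ mw)). Qed.

Lemma measurable_hits_window J a b i j (w : (coordinate -> R) -> nat -> R) :
  (forall i, (a < i <= b)%N -> J (inl i)) ->
  (forall i, window a b i -> measurable_fun setT
     ((fun y => w y i) : g_sigma_algebraType (boxes (R := R) J) -> R)) ->
  coordinate_algebra J [set y | hits (meeting (fire_time (spacing y)) (w y))
    (window a b) i j].
Proof. by move=> HJ mw; exact: (measurable_hits (measurable_window_meeting HJ mw)). Qed.

Lemma coordinate_algebraI J (A B : set (coordinate -> R)) :
  coordinate_algebra J A -> coordinate_algebra J B -> coordinate_algebra J (A `&` B).
Proof. by move=> mA mB; exact: (@measurableI _ (g_sigma_algebraType (boxes (R := R) J)) _ _ mA mB). Qed.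

Lemma coordinate_slow J i c : J (inr i) ->
  coordinate_algebra J [set y : coordinate -> R | slow y i = c].
Proof. by move=> Ji; exact: (coordinate_measurable Ji (measurable_set1 c)). Qed.

Lemma measurable_safe_left N : coordinate_algebra (before N) (safe_left N).
Proof.
apply: measurable_survives_window => [i /andP[]//|i /andP[_ iN]].
by apply: measurable_update => ne; rewrite /before /= ltn_neqAle iN andbT; exact/eqP.
Qed.

Lemma measurable_safe_right j N : coordinate_algebra (after j) (safe_right j N).
Proof.
apply: (@measurable_forall_nat _ (g_sigma_algebraType (boxes (R := R) (after j)))) => k.
apply: (@measurable_impl _ (g_sigma_algebraType (boxes (R := R) (after j)))).
  exact: (@measurable_const _ (g_sigma_algebraType (boxes (R := R) (after j)))).
apply: (@measurableC _ (g_sigma_algebraType (boxes (R := R) (after j)))).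
apply: measurable_hits_window => [i /andP[]//|i /andP[ji _]].
by apply: measurable_update => ne; rewrite /after /= ltn_neqAle ji andbT eq_sym; exact/eqP.
Qed.

Lemma measurable_survivor N i : (i <= N)%N ->
  coordinate_algebra (before N.+1) (survivor N i).
Proof.
move=> iN; apply: coordinate_algebraI; first exact: coordinate_slow.
apply: measurable_survives_window => [l /andP[_ lN]|l /andP[_ lN]].
  exact: leqW.
exact: measurable_coordinate.
Qed.

Lemma measurable_killed N i : (i <= N)%N ->
  coordinate_algebra (before N.+1) (killed N i).
Proof.
move=> iN; apply: coordinate_algebraI; first exact: measurable_survivor.
apply: measurable_hits_window => [l /andP[]//|l /andP[_ lN]].
by apply: measurable_update => ne; rewrite /before /= ltn_neqAle lN andbT; exact/eqP.
Qed.

End Events.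

(** * The expected number of survivors *)

Lemma measurable_gt0 (R : realType) : measurable [set x : R | 0 < x].
Proof.
by rewrite (_ : [set x | _] = `]0, +oo[%classic)//; apply/seteqP; split=> x /=;
  rewrite in_itv/= andbT.
Qed.

Section RealProbability.
Context d (T : measurableType d) (R : realType) (P : probability T R).
Implicit Types (A B C : set T).

Definition prob A : R := fine (P A).

Lemma prob_ge0 A : 0 <= prob A.
Proof. exact: fine_ge0. Qed.

Lemma probE A : measurable A -> P A = (prob A)%:E.
Proof. by move=> mA; rewrite fineK// fin_prob. Qed.

Lemma prob_le1 A : measurable A -> prob A <= 1.
Proof. by move=> mA; rewrite -lee_fin -probE// probability_le1. Qed.

Lemma prob_le A B : measurable A -> measurable B -> A `<=` B -> prob A <= prob B.
Proof.
by move=> mA mB AB; rewrite -lee_fin -!probE//; apply: le_measure; rewrite ?inE.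
Qed.

Lemma prob_setD A B : measurable A -> measurable B ->
  prob (A `\` B) + prob (A `&` B) = prob A.
Proof.
move=> mA mB; apply: EFin_inj; rewrite EFinD -!probE//; last 2 first.
- exact: measurableI.
- exact: measurableD.
rewrite -[in RHS](setDUK (@subIsetl _ A B)) measureU//.
- by rewrite addeC setDIr setDv set0U.
- exact: measurableI.
- by apply: measurableD => //; exact: measurableI.
- by apply/seteqP; split=> t //= [[? ?] [_ []]].
Qed.

Lemma prob_setI1 A B : measurable A -> measurable B -> prob B = 1 ->
  prob (A `&` B) = prob A.
Proof.
move=> mA mB B1; have := prob_setD mA mB.
have := prob_setD measurableT mB; rewrite setTI B1.
have -> : prob setT = 1 by rewrite /prob probability_setT.
have : prob (A `\` B) <= prob (setT `\` B).
  by apply: prob_le; [exact: measurableD|exact: measurableD|exact: setSD].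
have := prob_ge0 (A `\` B); lra.
Qed.

Variable G : set T.
Hypotheses (mG : measurable G) (G1 : prob G = 1).

Lemma prob_le_ae A B : measurable A -> measurable B -> A `&` G `<=` B ->
  prob A <= prob B.
Proof.
by move=> mA mB AB; rewrite -(prob_setI1 mA mG G1) prob_le//; exact: measurableI.
Qed.

Lemma prob_leU_ae A B C : measurable A -> measurable B -> measurable C ->
  A `&` G `<=` B `|` C -> prob A <= prob B + prob C.
Proof.
move=> mA mB mC AB; rewrite -(prob_setD mA mB) addrC lerD//.
  by apply: prob_le => //; exact: measurableI.
apply: prob_le_ae => //; first exact: measurableD.
by move=> t [[At nB] Gt]; have [] := AB t.
Qed.

Lemma sum_prob_le_ae n (F : nat -> set T) C : (forall i, (i < n)%N -> measurable (F i)) ->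
  measurable C -> (forall i, (i < n)%N -> F i `&` G `<=` C) ->
  (forall i j, (i < n)%N -> (j < n)%N -> F i `&` F j `&` G !=set0 -> i = j) ->
  \sum_(i < n) prob (F i) <= prob C.
Proof.
elim: n C => [|n IH] C mF mC FC tF; first by rewrite big_ord0 prob_ge0.
have mn := mF n (ltnSn n).
rewrite big_ord_recr/= -(prob_setD mC mn) lerD//.
  apply: IH => [i iN||i iN t [Ft Gt]|i j iN jN]; [exact/mF/leqW|exact: measurableD| |].
    split; first by apply: (FC i) => //; exact: leqW.
    move=> Fn; have e := tF i n (leqW iN) (ltnSn n).
    by move: iN; rewrite e ?ltnn//; exists t.
  by apply: tF; exact: leqW.
apply: prob_le_ae => //; first exact: measurableI.
by move=> t [Ft Gt]; split=> //; apply: (FC n).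
Qed.

End RealProbability.

Section CountableAlmostSure.
Context d (T : measurableType d) (R : realType) (P : probability T R).

Lemma prob_forall_nat (F : nat -> set T) : (forall n, measurable (F n)) ->
  (forall n, prob P (F n) = 1) -> prob P (\bigcap_n F n) = 1.
Proof.
move=> mF F1; have mI : measurable (\bigcap_n F n) by exact: bigcapT_measurable.
suff : P (~` \bigcap_n F n) = 0%E.
  rewrite probability_setC// (probE P mI) -EFinB => -[]; lra.
apply/measure_negligible; first exact: measurableC.
rewrite setC_bigcap; apply: negligible_bigcup => n.
have e : P (~` F n) = 0%E by rewrite probability_setC// (probE P (mF n)) F1 subee.
by apply/negligibleP; [exact: measurableC|exact: e].
Qed.

End CountableAlmostSure.

Section IidProcess.
Context d (T : measurableType d) (R : realType) (P : probability T R).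
Definition iid_process (Y : coordinate -> T -> R) :=
  [/\ forall k, measurable_fun setT (Y k), independent P Y,
      forall i j B, measurable B -> P (Y (inl i) @^-1` B) = P (Y (inl j) @^-1` B) &
      forall i j B, measurable B -> P (Y (inr i) @^-1` B) = P (Y (inr j) @^-1` B)].

Definition shift_index (a : nat) (k : coordinate) : coordinate :=
  match k with inl i => inl (a + i)%N | inr i => inr (a + i)%N end.

Lemma shift_index_inj a : injective (shift_index a).
Proof. by move=> [i|i] [j|j] //= [] /addnI ->. Qed.

Lemma prob_reindex Y (phi : coordinate -> coordinate) J C : iid_process Y -> injective phi ->
  (forall i, exists j, phi (inl i) = inl j) ->
  (forall i, exists j, phi (inr i) = inr j) -> coordinate_algebra J C ->
  prob P (joint (fun k => Y (phi k)) @^-1` C) = prob P (joint Y @^-1` C).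
Proof.
move=> [mY ind sl sr] iphi phil phir mC; rewrite /prob; congr fine.
apply: (@equal_laws _ _ _ _ _ P P _ _ _ _ _ _ _ _ _ _ mC) => //.
- move=> s B us mB.
  exact: (independent_comp iphi (fun=> @measurable_id _ _ setT) ind us mB).
- move=> [i|i] B mB.
    by have [j ->] := phil i; exact: sl.
  by have [j ->] := phir i; exact: sr.
Qed.

Section Core.
Variables (u1 u2 un : R) (Y : coordinate -> T -> R).
Hypotheses (u12 : u1 < u2) (u2n : u2 < un).
Hypothesis iidY : iid_process Y.
Hypothesis spacing_gt0 : prob P (Y (inl 0%N) @^-1` [set x | 0 < x]) = 1.
Hypothesis slow_admissible :
  prob P (Y (inr 0%N) @^-1` [set x | admissible u1 u2 un x]) = 1.

Let mY : forall k, measurable_fun setT (Y k). Proof. by case: iidY. Qed.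
Let ind : independent P Y. Proof. by case: iidY. Qed.

Definition pr (C : set (coordinate -> R)) : R := prob P (joint Y @^-1` C).

Let m J C : coordinate_algebra J C -> measurable (joint Y @^-1` C).
Proof. exact: measurable_joint. Qed.

Definition mass (c : R) : R := prob P (Y (inr 0%N) @^-1` [set c]).

Let mset_gt0 : measurable [set x : R | 0 < x] := @measurable_gt0 R.

Lemma measurable_admissible : measurable [set x : R | admissible u1 u2 un x].
Proof.
rewrite (_ : [set x | _] = [set u1] `|` [set u2] `|` `]u2, un]%classic).
  by apply: measurableU => //; exact: measurableU.
apply/seteqP; split=> x /=; rewrite /admissible in_itv/=.
  by move=> [-> | -> | ?]; [left; left|left; right|right].
by move=> [[]|]; [exact: Or31|exact: Or32|exact: Or33].
Qed.

Let G := joint Y @^-1` typical u1 u2 un.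

Let GE : G = \bigcap_i ((Y (inl i) @^-1` [set x | 0 < x]) `&`
  (Y (inr i) @^-1` [set x | admissible u1 u2 un x])).
Proof.
by apply/seteqP; split=> t /= H i; [move=> _; exact: H|exact: (H i I)].
Qed.

Let mYi k B : measurable B -> measurable (Y k @^-1` B).
Proof. by move=> mB; rewrite -[X in measurable X]setTI; exact: mY. Qed.

Let mGi i : measurable ((Y (inl i) @^-1` [set x | 0 < x]) `&`
  (Y (inr i) @^-1` [set x | admissible u1 u2 un x])).
Proof.
by apply: measurableI; apply: mYi => //; exact: measurable_admissible.
Qed.

Let mG : measurable G.
Proof. by rewrite GE; exact: bigcapT_measurable. Qed.

Let G1 : prob P G = 1.
Proof.
rewrite GE; apply: prob_forall_nat => // i; case: iidY => _ _ sl sr.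
rewrite prob_setI1//; try by apply: mYi => //; exact: measurable_admissible.
- by rewrite /prob (sl i 0%N).
- by rewrite /prob (sr i 0%N)//; exact: measurable_admissible.
Qed.

Lemma pr_slow J C i c : ~ J (inr i) -> coordinate_algebra J C ->
  pr (C `&` [set y | slow y i = c]) = pr C * mass c.
Proof.
move=> nJ mC.
have mS : coordinate_algebra [set inr i] [set y : coordinate -> R | slow y i = c].
  exact: coordinate_slow.
rewrite /pr /prob preimage_setI (independent_events mY ind _ mC mS).
  rewrite fineM ?fin_prob//; [|exact: m mC|exact: m mS].
  congr (_ * _); rewrite /mass /prob; case: iidY => _ _ _ sr.
  by rewrite -(sr i 0%N).
by apply/seteqP; split=> k //= [Jk ek]; apply: nJ; rewrite -ek.
Qed.

Definition safe_left_prob N := pr (safe_left u2 N).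
Definition safe_right_prob N := pr (safe_right u2 0 N).
Definition expected_survivors N := \sum_(i < N.+1) pr (survivor u2 N i).

Let mL N : coordinate_algebra (before N) (safe_left u2 N).
Proof. exact: measurable_safe_left. Qed.

Let mR j N : coordinate_algebra (after j) (safe_right u2 j N).
Proof. exact: measurable_safe_right. Qed.

Arguments mL : clear implicits.
Arguments mR : clear implicits.

Lemma survivor_drop N i : (i <= N)%N ->
  pr (survivor u2 N i) <= pr (survivor u2 N.+1 i) + mass u1 * pr (killed u1 u2 N i).
Proof.
move=> iN; have mK := measurable_killed u1 u2 iN.
rewrite mulrC -(pr_slow (J := before N.+1) (i := N.+1) u1 _ mK); last first.
  by rewrite /= ltnn.
have mS : coordinate_algebra setT [set y : coordinate -> R | slow y N.+1 = u1].
  exact: coordinate_slow.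
apply: (prob_leU_ae mG G1).
- exact: m (measurable_survivor u2 iN).
- exact: m (measurable_survivor u2 (leqW iN)).
- rewrite preimage_setI; apply: measurableI; [exact: m mK|exact: m mS].
move=> t [st Gt]; have [|[]] := survivor_step u12 u2n Gt iN st; first by left.
by move=> ? ?; right.
Qed.

Lemma survivor_new N : mass u2 * safe_left_prob N <= pr (survivor u2 N N).
Proof.
rewrite mulrC -(pr_slow (J := before N) (i := N) u2 _ (mL N)); last first.
  by rewrite /= ltnn.
have mS : coordinate_algebra setT [set y : coordinate -> R | slow y N = u2].
  exact: coordinate_slow.
apply: prob_le.
- rewrite preimage_setI; apply: measurableI; [exact: m (mL N)|exact: m mS].
- exact: m (measurable_survivor u2 (leqnn N)).
- by move=> t [? ?]; exact: survivor_last.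
Qed.

Lemma sum_killed0 : pr (killed u1 u2 0 0) <= safe_left_prob 1.
Proof.
apply: (prob_le_ae mG G1).
- exact: m (measurable_killed u1 u2 (leqnn 0)).
- exact: m (mL 1%N).
- move=> t [kt Gt]; exact: (killed_safe_left u12 u2n Gt (leqnn 0) kt).
Qed.

Definition kappa := prob P (Y (inl 0%N) @^-1` `]1, +oo[%classic) *
  prob P (Y (inl 0%N) @^-1` `]-oo, (u2 - u1) / (un - u2)[%classic).

Let pattern_box p (k : coordinate) : set R := match k with
  | inl l => if l == p.+1 then `]1, +oo[%classic else `]-oo, (u2 - u1) / (un - u2)[%classic
  | inr l => if l == p then [set un] else [set u2] end.

Let pattern_seq p : seq coordinate := [:: inr p; inr p.+1; inl p.+1; inl p.+2].

Let patternE p : pattern u1 u2 un p =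
  [set y | forall k, k \in pattern_seq p -> pattern_box p k (y k)].
Proof.
have n1 : (p.+2 == p.+1) = false by rewrite eqSS gtn_eqF.
have n2 : (p.+1 == p) = false by rewrite gtn_eqF.
apply/seteqP; split=> y /=.
  move=> [w0 w1 z1 z2] k; rewrite !inE => /or4P[]/eqP -> /=;
    rewrite ?eqxx ?n1 ?n2//= in_itv/= ?z1//.
move=> H; have := H (inr p); have := H (inr p.+1); have := H (inl p.+1).
have := H (inl p.+2); rewrite !inE !eqxx ?orbT /= !eqxx n1 n2 /= !in_itv/= andbT.
by move=> /(_ isT) ? /(_ isT) ? /(_ isT) ? /(_ isT) ?.
Qed.

Let mbox p k : measurable (pattern_box p k).
Proof. by case: k => l /=; case: ifP. Qed.

Let useq p : uniq (pattern_seq p).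
Proof.
rewrite /= !inE !(inj_eq inl_inj, inj_eq inr_inj).
by rewrite /= ltn_eqF// ltn_eqF.
Qed.

Lemma pattern_prob p : pr (pattern u1 u2 un p) = mass un * mass u2 * kappa.
Proof.
rewrite /pr /prob patternE joint_box (ind (useq p) (mbox p)).
rewrite !big_cons big_nil mule1 /= !eqxx gtn_eqF// [p.+2 == _]gtn_eqF//.
case: iidY => _ _ sl sr.
rewrite (sr p 0%N)// (sr p.+1 0%N)// (sl p.+1 0%N)// (sl p.+2 0%N)//.
rewrite !(probE P)//; try by apply: mYi.
by rewrite -!EFinM /= !mulrA.
Qed.

Lemma pattern_gain p : pr (safe_left u2 p `&` pattern u1 u2 un p) =
  safe_left_prob p * (mass un * mass u2 * kappa).
Proof.
have mP : coordinate_algebra [set k | k \in pattern_seq p] (pattern u1 u2 un p).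
  apply: sub_gen_smallest; exists (pattern_seq p), (pattern_box p); split.
  - exact: useq.
  - by [].
  - exact: mbox.
  - exact: patternE.
rewrite /pr /prob preimage_setI (independent_events mY ind _ (mL p) mP).
  rewrite fineM ?fin_prob//; [|exact: m (mL p)|exact: m mP].
  by congr (_ * _); exact: pattern_prob.
apply/seteqP; split=> k //=; rewrite !inE => -[+ /or4P[]/eqP ek].
all: rewrite ek /= ?ltnn//.
- by rewrite ltnNge leqnSn.
- by rewrite ltnNge (leq_trans (leqnSn p)).
Qed.

(** The events [killed] are almost surely disjoint and imply [safe_left] in position [p.+2]. They
    exclude the pattern, and after the pattern [safe_left] in position [p] also implies it in
    position [p.+2]; so an independent share is left over. *)
Lemma sum_killed p : \sum_(i < p.+2) pr (killed u1 u2 p.+1 i) <=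
  safe_left_prob p.+2 - safe_left_prob p * (mass un * mass u2 * kappa).
Proof.
have mP : coordinate_algebra setT (pattern u1 u2 un p).
  apply: sub_gen_smallest; exists (pattern_seq p), (pattern_box p); split.
  - exact: useq.
  - by [].
  - exact: mbox.
  - exact: patternE.
have mGain : measurable (joint Y @^-1` (safe_left u2 p `&` pattern u1 u2 un p)).
  by rewrite preimage_setI; apply: measurableI; [exact: m (mL p)|exact: m mP].
have m2 := m (mL p.+2).
rewrite -pattern_gain lerBrDr /safe_left_prob /pr -(prob_setD P m2 mGain) lerD//.
  apply: (sum_prob_le_ae mG G1 (F := fun i => joint Y @^-1` killed u1 u2 p.+1 i)).
  - by move=> i ip; apply: m (measurable_killed u1 u2 _).
  - exact: measurableD.
  - move=> i ip t [kt Gt]; split; first exact: (killed_safe_left u12 u2n Gt _ kt).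
    by move=> [_ pt]; exact: (pattern_not_killed u12 u2n Gt pt ip kt).
  - by move=> i j ip jp [t [[ki kj] Gt]]; exact: (@killed_inj R u1 u2 un (joint Y t) Gt p.+1 i j ip jp ki kj).
apply: (prob_le_ae mG G1) => //; first exact: measurableI.
by move=> t [[sl pt] Gt]; split=> //; exact: (pattern_safe_left u12 u2n Gt pt sl).
Qed.

Lemma expected_survivors0 : mass u2 * safe_left_prob 0 <= expected_survivors 0.
Proof. by rewrite /expected_survivors big_ord1; exact: survivor_new. Qed.

Lemma expected_survivors_step N : expected_survivors N - mass u1 * \sum_(i < N.+1) pr (killed u1 u2 N i) +
  mass u2 * safe_left_prob N.+1 <= expected_survivors N.+1.
Proof.
rewrite /expected_survivors [leRHS]big_ord_recr/= lerD ?survivor_new// lerBlDr mulr_sumr -big_split/=.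
by apply: ler_sum => i _; apply: survivor_drop; rewrite -ltnS.
Qed.

Lemma safe_left_prob_ge0 N : 0 <= safe_left_prob N. Proof. exact: prob_ge0. Qed.
Lemma safe_left_prob_le1 N : safe_left_prob N <= 1. Proof. exact: prob_le1 (m (mL N)). Qed.
Lemma safe_right_prob_ge0 N : 0 <= safe_right_prob N. Proof. exact: prob_ge0. Qed.
Lemma safe_right_prob_le1 N : safe_right_prob N <= 1. Proof. exact: prob_le1 (m (mR 0 N)). Qed.

Lemma safe_left_prob0 : safe_left_prob 0 = 1.
Proof.
apply/eqP; rewrite eq_le safe_left_prob_le1 -{1}G1 /=; apply: prob_le => //.
  exact: m (mL 0%N).
by move=> t Gt; exact: (safe_left0 Gt).
Qed.

Lemma safe_right_prob_anti N M : (N <= M)%N -> safe_right_prob M <= safe_right_prob N.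
Proof.
move=> NM; apply: prob_le; [exact: m (mR 0 M)|exact: m (mR 0 N)|].
by move=> t H k /andP[k0 kN]; apply: H; rewrite k0 (leq_trans kN).
Qed.

Lemma safe_right_shift y j N : (j <= N)%N ->
  safe_right u2 j N y <-> safe_right u2 0 (N - j)%N (fun k => y (shift_index j k)).
Proof.
move=> jN.
have e k : hits (meeting (fire_time (spacing (fun k => y (shift_index j k))))
    (update (slow (fun k => y (shift_index j k))) 0 u2)) (window 0 k) 0 k <->
  hits (meeting (fire_time (spacing y)) (update (slow y) j u2))
    (window j (j + k)%N) j (j + k)%N.
  have -> : update (slow (fun k => y (shift_index j k))) 0 u2 =
      shifted j (update (slow y) j u2).
    apply/funext => i; rewrite /update /shifted.
    by rewrite (_ : (j + i == j)%N = (i == 0)%N)// -{2}(addn0 j) eqn_add2l.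
  suff H : hits (meeting (fire_time (spacing (fun k => y (shift_index j k))))
      (shifted j (update (slow y) j u2))) (window 0 k) 0 k <->
    hits (meeting (fire_time (spacing y)) (update (slow y) j u2))
      (window j (j + k)%N) (j + 0)%N (j + k)%N by rewrite addn0 in H.
  apply: (hits_image (phi := addn j)).
  - by move=> i; rewrite /window /= leq_add2l leq_addr.
  - move=> i; rewrite /window /= => /andP[ji ik]; exists (i - j)%N; last by rewrite subnKC.
    by rewrite leq_subLR.
  - by move=> p q _ _; rewrite -meeting_shift.
  - exact: in_window.
  - exact: in_window.
split=> H k /andP[jk kN].
  by move=> /e; apply: H; rewrite -{1}(addn0 j) ltn_add2l jk /= -leq_subRL.
have := H (k - j)%N; rewrite subn_gt0 jk leq_sub2r// => /(_ isT) H' hk.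
by apply: H'; apply/e; rewrite subnKC// ltnW.
Qed.

Lemma prob_safe_right j N : (j <= N)%N -> pr (safe_right u2 j N) = safe_right_prob (N - j)%N.
Proof.
move=> jN; rewrite /safe_right_prob /pr -(prob_reindex iidY (@shift_index_inj j) _ _ (mR 0 (N - j)%N)).
- congr (prob P _); apply/seteqP; split=> t /=.
    by move/(safe_right_shift (joint Y t) jN).
  by move=> H; apply/(safe_right_shift (joint Y t) jN).
- by move=> i; exists (j + i)%N.
- by move=> i; exists (j + i)%N.
Qed.

(** The two safety events and the slowness of [i] read disjoint sets of coordinates, hence the
    product. *)
Lemma survivor_le N i : (i <= N)%N ->
  pr (survivor u2 N i) <= mass u2 * (safe_left_prob i * safe_right_prob (N - i)%N).
Proof.
move=> iN; rewrite -prob_safe_right//.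
have mS : coordinate_algebra setT [set y : coordinate -> R | slow y i = u2].
  exact: coordinate_slow.
have -> : mass u2 * (safe_left_prob i * pr (safe_right u2 i N)) =
    pr ((safe_left u2 i `&` safe_right u2 i N) `&` [set y | slow y i = u2]).
  rewrite (pr_slow (J := before i `|` after i)).
  - rewrite mulrC; congr (_ * _); rewrite /safe_left_prob /pr /prob preimage_setI.
    rewrite (independent_events mY ind _ (mL i) (mR i N)).
      by rewrite fineM ?fin_prob//; [exact: m (mL i)|exact: m (mR i N)].
    apply/seteqP; split=> -[l|l] //= [].
      by move=> li il; move: (leq_ltn_trans li il); rewrite ltnn.
    by move=> li il; move: (ltn_trans li il); rewrite ltnn.
  - by rewrite /= !ltnn => -[].
  - apply: coordinate_algebraI.
      by apply: coordinate_algebra_sub (mL i) => k; left.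
    by apply: coordinate_algebra_sub (mR i N) => k; right.
apply: (prob_le_ae mG G1).
- exact: m (measurable_survivor u2 iN).
- rewrite !preimage_setI; apply: measurableI; last exact: m mS.
  by apply: measurableI; [exact: m (mL i)|exact: m (mR i N)].
- move=> t [st Gt]; have [? ?] := survivor_safe u12 u2n Gt iN st.
  by split; [split|case: st].
Qed.

Lemma expected_survivors_le N : expected_survivors N <= mass u2 * \sum_(i < N.+1) safe_left_prob i * safe_right_prob (N - i)%N.
Proof.
by rewrite mulr_sumr; apply: ler_sum => i _; apply: survivor_le; rewrite -ltnS.
Qed.

End Core.
End IidProcess.

(** * A renewal inequality *)

Section RenewalInequality.
Variables (R : realType) (h rho a K : nat -> R) (m1 m2 c : R).
Hypotheses (h_ge0 : forall i, 0 <= h i) (h_le1 : forall i, h i <= 1) (h0 : h 0 = 1).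
Hypotheses (rho_ge0 : forall i, 0 <= rho i) (rho_le1 : forall i, rho i <= 1)
  (rho_anti : forall i j, (i <= j)%N -> rho j <= rho i).
Hypotheses (m2_ge0 : 0 <= m2) (m21 : m2 <= m1) (c_ge0 : 0 <= c).
Hypotheses (a0_ge : m2 * h 0 <= a 0)
  (a_step : forall N, a N - m1 * K N + m2 * h N.+1 <= a N.+1)
  (K0 : K 0 <= h 1) (KS : forall p, K p.+1 <= h p.+2 - h p * c)
  (a_le : forall N, a N <= m2 * \sum_(i < N.+1) h i * rho (N - i)%N).

Let S N := \sum_(i < N) h i.

Let S_rec N : S N.+1 = S N + h N. Proof. by rewrite /S big_ord_recr. Qed.

Let S_mono N M : (N <= M)%N -> S N <= S M.
Proof.
move=> /subnKC <-; elim: (M - N)%N => [|k IH]; first by rewrite addn0.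
by rewrite addnS S_rec (le_trans IH)// lerDl.
Qed.

Let S_lip N M : S (N + M)%N - S N <= M%:R.
Proof.
elim: M => [|M IH]; first by rewrite addn0 subrr.
by rewrite addnS S_rec addrAC -natr1 lerD.
Qed.

Let m1_ge0 : 0 <= m1. Proof. exact: le_trans m21. Qed.

(** By [a_step] and [KS], the increment of [a] from [N] to [N.+1] is at least
    [m1 * c * h N.-1 - (m1 - m2) * h N.+1] for positive [N]; sum these. The first increment has no
    term in [c], hence the induction on two consecutive indices. *)
Let a_ge N : m1 * c * S N.-1 - (m1 - m2) * S N.+1 <= a N.
Proof.
have d0 : 0 <= m1 - m2 by rewrite subr_ge0.
suff H : (m1 * c * S N.-1 - (m1 - m2) * S N.+1 <= a N) /\
   (m1 * c * S N - (m1 - m2) * S N.+2 <= a N.+1) by case: H.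
elim: N => [|p [_ IH]].
  have e0 : S 0 = 0 by rewrite /S big_ord0.
  have s1 : S 1 = 1 by rewrite S_rec e0 h0 add0r.
  rewrite /= e0 mulr0 !sub0r; split.
    apply: le_trans a0_ge; rewrite h0 mulr1; apply: le_trans m2_ge0.
    by rewrite oppr_le0 mulr_ge0// s1.
  apply: le_trans (a_step 0); rewrite S_rec s1.
  have : m1 * K 0 <= m1 * h 1 by rewrite ler_wpM2l.
  move: a0_ge; rewrite h0 => a0 k0.
  have : 0 <= m1 by []. lra.
split=> //; apply: le_trans (a_step p.+1); rewrite [S p.+3]S_rec [S p.+1]S_rec.
have : m1 * K p.+1 <= m1 * (h p.+2 - h p * c) by rewrite ler_wpM2l.
move: IH; rewrite /=; lra.
Qed.

(** Where [N - i] is at least [M], bound [rho] by [rho M]; in the last [M] terms, bound it by 1. *)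
Let conv_le N M : (M <= N.+1)%N ->
  \sum_(i < N.+1) h i * rho (N - i)%N <= rho M * S N.+1 + (S N.+1 - S (N.+1 - M)%N).
Proof.
move=> MN.
have e : S N.+1 - S (N.+1 - M)%N = \sum_(i < N.+1 | (N.+1 - M <= i)%N) h i.
  rewrite /S -(big_mkord xpredT) (@big_cat_nat _ _ _ (N.+1 - M)%N)//=; last exact: leq_subr.
  rewrite big_mkord addrAC subrr add0r -(big_mkord (fun i => (N.+1 - M <= i)%N)).
  by rewrite (big_nat_widenl _ 0%N).
rewrite e [X in _ + X]big_mkcond mulr_sumr -big_split/=; apply: ler_sum => i _.
case: leqP => iM; rewrite ?addr0.
  by rewrite -[leLHS]add0r lerD// ?mulr_ge0// -[leRHS]mulr1 ler_wpM2l.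
rewrite mulrC ler_wpM2r// rho_anti//.
by move: iM; clear; lia.
Qed.

(* If the bound failed, the partial sums [S] would be bounded and at the same
   time would grow by a definite amount over each window of [M] indices. *)
Lemma renewal_bound M : m1 * c - (m1 - m2) <= m2 * rho M.
Proof.
rewrite leNgt; apply/negP => lt.
(* A length of at least 2 gives [N.+1 - L <= N.-1], which absorbs the shift of index in [a_ge]. *)
pose L := M.+2.
have ltL : m2 * rho L < m1 * c - (m1 - m2).
  by apply: le_lt_trans lt; rewrite ler_wpM2l// rho_anti//; apply: leqW; exact: leqnSn.
pose e := m1 * c - (m1 - m2) - m2 * rho L.
have e0 : 0 < e by rewrite subr_gt0.
pose q := m1 * c + m2.
have C0 : 0 <= m1 * c by rewrite mulr_ge0.
have q0 : 0 <= q by rewrite addr_ge0.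
(* Comparing the two bounds on [a N]: the last [L] values of [h] make up a fixed fraction of the
   whole sum. *)
have key N : (L <= N.+1)%N -> e * S N.+1 <= q * (S N.+1 - S (N.+1 - L)%N).
  move=> LN; have := le_trans (a_ge N) (a_le N).
  have c1 := conv_le LN.
  have c2 : m2 * (\sum_(i < N.+1) h i * rho (N - i)%N) <=
     m2 * (rho L * S N.+1 + (S N.+1 - S (N.+1 - L)%N)) by rewrite ler_wpM2l.
  have c3 : m1 * c * S (N.+1 - L)%N <= m1 * c * S N.-1.
    by rewrite ler_wpM2l// S_mono// /L; clear; lia.
  rewrite /e /q; lra.
have S1 N : 1 <= S N.+1.
  by apply: le_trans (S_mono (ltn0Sn N)); rewrite S_rec /S big_ord0 h0 add0r.
have L0 : (0 < L)%N by [].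
have bounded N : (L <= N.+1)%N -> e * S N.+1 <= q * L%:R.
  move=> LN; apply: le_trans (key N LN) _; rewrite ler_wpM2l//.
  by rewrite -{1}(subnK LN); exact: S_lip.
have grow k : k%:R * e <= q * S (k * L)%N.
  elim: k => [|k IH]; first by rewrite mul0r mul0n /S big_ord0 mulr0.
  have := key (k.+1 * L).-1; rewrite prednK ?muln_gt0//.
  rewrite mulSn leq_addr addKn => /(_ isT).
  have := S1 (L + k * L).-1; rewrite prednK ?addn_gt0//.
  move=> s1 kk; rewrite -natr1 mulrDl mul1r.
  have : e <= e * S (L + k * L)%N by rewrite -[leLHS]mulr1 ler_wpM2l// ltW.
  lra.
have qe0 : 0 <= q * q * L%:R / (e * e).
  by rewrite mulr_ge0 ?invr_ge0 ?mulr_ge0// ltW.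
pose k := Num.bound (q * q * L%:R / (e * e)).
have kP : q * q * L%:R < k.+1%:R * (e * e).
  rewrite -ltr_pdivrMr ?mulr_gt0//; apply: lt_trans (archi_boundP qe0) _.
  by rewrite ltr_nat.
have := bounded (k.+1 * L).-1; rewrite prednK ?muln_gt0// mulSn leq_addr -mulSn.
move=> /(_ isT) b1; have b2 : q * (e * S (k.+1 * L)%N) <= q * (q * L%:R).
  by rewrite ler_wpM2l.
have b3 : e * (k.+1%:R * e) <= e * (q * S (k.+1 * L)%N).
  by rewrite ler_wpM2l// ltW.
lra.
Qed.

End RenewalInequality.

Section CoreBound.
Context d (T : measurableType d) (R : realType) (P : probability T R).
Variables (u1 u2 un : R) (Y : coordinate -> T -> R).
Hypotheses (u12 : u1 < u2) (u2n : u2 < un).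
Hypothesis iidY : iid_process P Y.
Hypothesis spacing_gt0 : prob P (Y (inl 0%N) @^-1` [set x | 0 < x]) = 1.
Hypothesis slow_admissible :
  prob P (Y (inr 0%N) @^-1` [set x | admissible u1 u2 un x]) = 1.

(** The left-hand side does not depend on [M], so the bound passes to the limit of the decreasing
    events. *)
Lemma core_bound M : mass P Y u2 <= mass P Y u1 ->
  mass P Y u1 * (mass P Y un * mass P Y u2 * kappa P u1 u2 un Y) -
    (mass P Y u1 - mass P Y u2) <=
  pr P Y (safe_right u2 0 M `&` [set y | slow y 0 = u2]).
Proof.
move=> m21; have m0 c : 0 <= mass P Y c by exact: prob_ge0.
have -> : pr P Y (safe_right u2 0 M `&` [set y | slow y 0 = u2]) =
    mass P Y u2 * safe_right_prob P u2 Y M.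
  rewrite mulrC /safe_right_prob; apply: (pr_slow iidY (J := after 0)) => //.
  exact: measurable_safe_right.
apply: (@renewal_bound R (safe_left_prob P u2 Y) (safe_right_prob P u2 Y) (expected_survivors P u2 Y)
  (fun N => \sum_(i < N.+1) pr P Y (killed u1 u2 N i))).
- by move=> i; exact: safe_left_prob_ge0.
- by move=> i; exact: (safe_left_prob_le1 u2 iidY).
- exact: (safe_left_prob0 iidY spacing_gt0 slow_admissible).
- by move=> i; exact: safe_right_prob_ge0.
- by move=> i; exact: (safe_right_prob_le1 u2 iidY).
- by move=> i j; exact: (safe_right_prob_anti u2 iidY).
- exact: m0.
- exact: m21.
- by rewrite !mulr_ge0 ?prob_ge0.
- exact: (expected_survivors0 u2 iidY).
- exact: (expected_survivors_step u12 u2n iidY spacing_gt0 slow_admissible).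
- by rewrite big_ord1; exact: (sum_killed0 u12 u2n iidY spacing_gt0 slow_admissible).
- exact: (sum_killed u12 u2n iidY spacing_gt0 slow_admissible).
- exact: (expected_survivors_le u12 u2n iidY spacing_gt0 slow_admissible).
Qed.

End CoreBound.

(** * Time reversal *)

Section Reversal.
Variable R : realType.

(** Spacing [l] separates the bullets [l - 1] and [l], hence goes to [j + 1 - l], whereas slowness
    [l] goes to [j - l]. Spacing 0 and everything beyond [j] stay fixed, which makes the map an
    involution. *)
Definition reverse_index (j : nat) (k : coordinate) : coordinate := match k with
  | inl l => if (0 < l <= j)%N then inl (j.+1 - l)%N else inl l
  | inr l => if (l <= j)%N then inr (j - l)%N else inr l end.

Lemma reverse_index_inj j : injective (reverse_index j).
Proof.
apply: (can_inj (g := reverse_index j)) => -[l|l] /=.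
  case: (boolP (0 < l <= j)%N) => [lj|/negbTE e]; rewrite /= ?e//.
  rewrite (_ : (0 < j.+1 - l <= j)%N); last by move: lj; clear; lia.
  by congr inl; move: lj; clear; lia.
case: (leqP l j) => lj /=; last by rewrite leqNgt lj.
by rewrite leq_subr subKn.
Qed.

Definition opposite (k : coordinate) (x : R) : R := if k is inr _ then - x else x.

Definition reversed j (y : coordinate -> R) : coordinate -> R :=
  fun k => opposite k (y (reverse_index j k)).

Lemma fire_time_reversed j y l : (l <= j)%N ->
  fire_time (spacing (reversed j y)) l - fire_time (spacing (reversed j y)) 0 =
  fire_time (spacing y) j - fire_time (spacing y) (j - l)%N.
Proof.
elim: l => [|l IH] lj.
  by rewrite subn0 [LHS]subrr [RHS]subrr.
rewrite fire_timeS addrAC (IH (ltnW lj)).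
have -> : spacing (reversed j y) l.+1 = spacing y (j - l)%N.
  by rewrite /spacing /reversed /= lj subSS.
have -> : (j - l = (j - l.+1).+1)%N by move: lj; clear; lia.
by rewrite fire_timeS; lra.
Qed.

(** Negating firing times and slownesses reflects every line without moving the positions of the
    crossings. *)
Lemma meeting_reversed j y p q : (p <= j)%N -> (q <= j)%N ->
  meeting (fire_time (spacing (reversed j y))) (slow (reversed j y)) p q =
  meeting (fire_time (spacing y)) (slow y) (j - p)%N (j - q)%N.
Proof.
move=> pj qj.
have w l : (l <= j)%N -> slow (reversed j y) l = - slow y (j - l)%N.
  by move=> lj; rewrite /slow /reversed /= lj.
have fd a b : (a <= j)%N -> (b <= j)%N ->
    fire_time (spacing (reversed j y)) b - fire_time (spacing (reversed j y)) a =
    fire_time (spacing y) (j - a)%N - fire_time (spacing y) (j - b)%N.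
  move=> aj bj; have := fire_time_reversed y aj; have := fire_time_reversed y bj; lra.
rewrite /meeting !w// !ltrN2 !fd// !opprK.
have e1 : (j - p < j - q)%N = (q < p)%N by move: pj qj; clear; lia.
have e2 : (j - q < j - p)%N = (p < q)%N by move: pj qj; clear; lia.
rewrite e1 e2; case: (ltngtP p q) => //= _.
- by case: ifP => // _; congr (_ / _)%:E; rewrite addrC.
- by case: ifP => // _; congr (_ / _)%:E; rewrite addrC.
Qed.

Lemma hits_reversed j y k : (k <= j)%N ->
  hits (meeting (fire_time (spacing (reversed j y))) (slow (reversed j y)))
    (window 0 k) 0 k <->
  hits (meeting (fire_time (spacing y)) (slow y)) (window (j - k)%N j) (j - k)%N j.
Proof.
move=> kj.
suff : hits (meeting (fire_time (spacing (reversed j y))) (slow (reversed j y)))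
    (window 0 k) 0 k <-> hits (meeting (fire_time (spacing y)) (slow y))
      (window (j - k)%N j) (j - 0)%N (j - k)%N.
  rewrite subn0 => H; apply: (iff_trans H).
  by split; apply: hits_sym; exact: meetingC.
apply: (hits_image (phi := fun i => (j - i)%N)).
- by move=> i; rewrite /window /=; move: kj; clear; lia.
- move=> i; rewrite /window /= => Wi; exists (j - i)%N; move: kj Wi; clear; lia.
- move=> p q /andP[_ pk] /andP[_ qk].
  by apply: meeting_reversed; [exact: leq_trans pk kj|exact: leq_trans qk kj].
- exact: in_window.
- exact: in_window.
Qed.

Context d (T : measurableType d) (P : probability T R).

Lemma iid_reversed j (Y : coordinate -> T -> R) : iid_process P Y ->
  iid_process P (fun k t => reversed j (joint Y t) k).
Proof.
move=> [mY ind sl sr].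
have mo k : measurable_fun setT (opposite k).
  by case: k => l /=; [exact: measurable_id|apply: measurable_funN; exact: measurable_id].
have mop k B : measurable B -> measurable (opposite k @^-1` B).
  by move=> mB; rewrite -[X in measurable X]setTI; exact: mo.
split.
- by move=> k; apply: (measurableT_comp (mo k)); exact: mY.
- move=> s B us mB.
  exact: (independent_comp (@reverse_index_inj j) mo ind us mB).
- move=> p q B mB; have s0 l : P ((fun t => reversed j (joint Y t) (inl l)) @^-1` B) =
      P (Y (inl 0%N) @^-1` B).
    by rewrite /reversed /=; case: ifP => _; exact: sl.
  by rewrite !s0.
- move=> p q B mB; have s0 l : P ((fun t => reversed j (joint Y t) (inr l)) @^-1` B) =
      P (Y (inr 0%N) @^-1` (opposite (inr 0%N) @^-1` B)).
    rewrite /reversed /=; case: ifP => _.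
      exact: (sr (j - l)%N 0%N _ (mop (inr 0%N) B mB)).
    exact: (sr l 0%N _ (mop (inr 0%N) B mB)).
  by rewrite !s0.
Qed.

End Reversal.

(** * Measurability of the survival event *)

Section MeasurableSurvival.
Context d (U : measurableType d) (R : realType).
Variables (z s : U -> nat -> R).
Hypotheses (mz : forall i, measurable_fun setT (fun y => z y i))
  (ms : forall i, measurable_fun setT (fun y => s y i)).

(** Measurability is needed on the whole sample space, hence a closed form without any regularity,
    covering equal speeds and spacings or speeds of any sign. *)
Lemma first_meetingE_general (z0 s0 : nat -> R) i j : first_meeting z0 s0 i j =
  if i == j then +oo%E else
  if s0 i == s0 j then
    (if s0 i * (fire_time z0 j - fire_time z0 i) == 0
     then (Num.max (fire_time z0 i) (fire_time z0 j))%:E else +oo%E)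
  else
    (if Num.max (fire_time z0 i) (fire_time z0 j) <=
       (s0 i * fire_time z0 i - s0 j * fire_time z0 j) * (s0 i - s0 j)^-1
     then ((s0 i * fire_time z0 i - s0 j * fire_time z0 j) * (s0 i - s0 j)^-1)%:E
     else +oo%E).
Proof.
have none : (forall u, ~ meet z0 s0 i j u) -> first_meeting z0 s0 i j = +oo%E.
  move=> N; apply/eqP; rewrite -leye_eq leNgt; apply/negP.
  by move=> /first_meeting_oo[u /N].
case: eqP => [ij|ij]; first by apply: none => u [].
case: (eqVneq (s0 i) (s0 j)) => sij.
  case: eqP => e.
    apply: first_meeting_meet.
      split=> //; rewrite ?le_max ?lexx ?orbT//.
      by rewrite /position -sij !mulrBr; move: e; rewrite mulrBr; lra.
    by move=> v [_ iv jv _]; rewrite ge_max iv jv.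
  by apply: none => u [_ _ _]; rewrite /position -sij => e'; apply: e; lra.
have ds : s0 i - s0 j != 0 by rewrite subr_eq0.
have sol u : position z0 s0 i u = position z0 s0 j u ->
    u = (s0 i * fire_time z0 i - s0 j * fire_time z0 j) * (s0 i - s0 j)^-1.
  rewrite /position => e; apply: (mulIf ds); rewrite mulfVK//; lra.
case: ifP => le.
  apply: first_meeting_meet; last first.
    by move=> v [_ _ _ /sol <-].
  move: le; rewrite ge_max => /andP[li lj]; split=> //.
  rewrite /position; apply: (mulIf ds); field.
  by rewrite subr_eq0 in ds; rewrite subr_eq0.
apply: none => u [_ iu ju /sol e]; move/negP: le; apply.
by rewrite -e ge_max iu ju.
Qed.

Lemma measurable_fire_time i : measurable_fun setT (fun y => fire_time (z y) i).
Proof. by apply: measurable_sum => l; exact: mz. Qed.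

Lemma measurable_first_meeting i j :
  measurable_fun setT ((fun y => first_meeting (z y) (s y) i j) : U -> \bar R).
Proof.
apply: (eq_measurable_fun (fun y => if i == j then +oo%E else
  if s y i == s y j then
    (if s y i * (fire_time (z y) j - fire_time (z y) i) == 0
     then (Num.max (fire_time (z y) i) (fire_time (z y) j))%:E else +oo%E)
  else
    (if Num.max (fire_time (z y) i) (fire_time (z y) j) <=
       (s y i * fire_time (z y) i - s y j * fire_time (z y) j) * (s y i - s y j)^-1
     then ((s y i * fire_time (z y) i - s y j * fire_time (z y) j) *
       (s y i - s y j)^-1)%:E
     else +oo%E))).
  by move=> y _; rewrite first_meetingE_general.
have mf := measurable_fire_time.
case: (i == j); first exact: measurable_cst.
have mmax : measurable_fun setT (fun y =>
    Num.max (fire_time (z y) i) (fire_time (z y) j)).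
  exact: measurable_maxr.
have msol : measurable_fun setT (fun y => (s y i * fire_time (z y) i -
    s y j * fire_time (z y) j) * (s y i - s y j)^-1).
  apply: measurable_funM.
    by apply: measurable_funB; exact: measurable_funM.
  by apply: (measurableT_comp (@measurable_invr R)); exact: measurable_funB.
apply: measurable_fun_ifT.
- exact: measurable_fun_eqr.
- apply: measurable_fun_ifT.
  + apply: measurable_fun_eqr; last exact: measurable_cst.
    by apply: measurable_funM => //; exact: measurable_funB.
  + exact/measurable_EFinP.
  + exact: measurable_cst.
- apply: measurable_fun_ifT.
  + exact: measurable_fun_ler.
  + exact/measurable_EFinP.
  + exact: measurable_cst.
Qed.

Lemma measurable_first_survives :
  measurable [set y | first_survives (z y) (s y)].
Proof.
rewrite (_ : [set y | _] = ~` [set y | exists i, (0 < i)%N /\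
    s y 0%N < s y i /\ hits (first_meeting (z y) (s y)) setT i 0]); last first.
  apply/seteqP; split=> y /= N [i]; last first.
    by move=> [i0 si /collideE h]; apply: N; exists i.
  by move=> [i0 [si /collideE h]]; apply: N; exists i; split.
apply: measurableC; apply: measurable_exists_nat => i.
rewrite (_ : [set y | _] = [set y | (0 < i)%N] `&` ([set y | s y 0%N < s y i] `&`
  [set y | hits (first_meeting (z y) (s y)) setT i 0]))//.
apply: measurableI; first exact: measurable_const.
apply: measurableI.
  rewrite (_ : [set y | _] = setT `&` (s ^~ i \- s ^~ 0%N) @^-1` `]0, +oo[%classic).
    exact: (measurable_funB (ms i) (ms 0%N)).
  by rewrite setTI; apply/seteqP; split=> y /=; rewrite in_itv/= andbT subr_gt0.
apply: (measurable_hits (x := fun y => first_meeting (z y) (s y)) (A := setT)).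
by move=> k l _ _; exact: measurable_first_meeting.
Qed.

End MeasurableSurvival.

(** * Exponential spacings *)

Section ExponentialSpacings.
Context d (T : measurableType d) (R : realType) (P : probability T R).
Variable X : T -> R.
Hypothesis mX : measurable_fun setT X.
Hypothesis expX : forall B, measurable B -> P (X @^-1` B) = exponential_prob 1 B.

Let mp B : measurable B -> measurable (X @^-1` B).
Proof. by move=> mB; rewrite -[Y in measurable Y]setTI; exact: mX. Qed.

Let pE B : measurable B -> prob P (X @^-1` B) = fine (exponential_prob 1 B).
Proof. by move=> mB; rewrite /prob expX. Qed.

Let p0 : prob P (X @^-1` [set 0]) = 0.
Proof. by rewrite pE// /exponential_prob integral_set1. Qed.

Let pneg : prob P (X @^-1` `]-oo, 0[%classic) = 0.
Proof.
rewrite pE// /exponential_prob integral0_eq// => x /=.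
by rewrite in_itv/= => x0; rewrite lt0_exponential_pdf.
Qed.

Let pitv (x : R) : 0 < x -> prob P (X @^-1` `[0, x]%classic) = 1 - expR (- x).
Proof. by move=> x0; rewrite pE// exponential_prob_itv0c// mulN1r. Qed.

Lemma exponential_gt0 : prob P (X @^-1` [set x | 0 < x]) = 1.
Proof.
have -> : X @^-1` [set x | 0 < x] = setT `\` X @^-1` `]-oo, 0]%classic.
  by apply/seteqP; split=> t /=; rewrite in_itv/= ltNge => H; [split=> //; apply/negP|
    case: H => _ /negP].
have := prob_setD P measurableT (mp (measurable_itv `]-oo, (0:R)])).
rewrite setTI (_ : prob P setT = 1); last by rewrite /prob probability_setT.
suff -> : prob P (X @^-1` `]-oo, 0]%classic) = 0 by rewrite addr0.
have := prob_setD P (mp (measurable_itv `]-oo, (0:R)])) (mp (measurable_set1 (0:R))).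
rewrite (_ : X @^-1` _ `\` _ = X @^-1` `]-oo, 0[%classic); last first.
  apply/seteqP; split=> t /=; rewrite !in_itv/=.
    by move=> [le /eqP ne]; rewrite lt_neqAle ne.
  by move=> lt; split; [exact: ltW|move=> e; rewrite e ltxx in lt].
rewrite (_ : X @^-1` _ `&` _ = X @^-1` [set 0]); last first.
  by apply/seteqP; split=> t /=; rewrite in_itv/=; [case|move=> ->; split].
by rewrite pneg p0 addr0.
Qed.

Lemma exponential_lt_gt0 (x : R) : 0 < x ->
  0 < prob P (X @^-1` `]-oo, x[%classic).
Proof.
move=> x0; have x20 : 0 < x / 2 by rewrite divr_gt0.
apply: (@lt_le_trans _ _ (prob P (X @^-1` `[0, x / 2]%classic))).
  by rewrite pitv// subr_gt0 expR_lt1 oppr_lt0.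
apply: prob_le; [exact: mp|exact: mp|].
move=> t /=; rewrite !in_itv/= => /andP[_ /le_lt_trans]; apply; lra.
Qed.

Lemma exponential_le1 : prob P (X @^-1` `]-oo, 1]%classic) < 1.
Proof.
have := prob_setD P (mp (measurable_itv `]-oo, (1:R)])) (mp (measurable_itv `]-oo, (0:R)[)).
rewrite (_ : X @^-1` _ `\` _ = X @^-1` `[0, 1]%classic); last first.
  apply/seteqP; split=> t /=; rewrite !in_itv/=.
    by move=> [-> /negP]; rewrite -leNgt => ->.
  by move=> /andP[t0 ->]; split=> //; apply/negP; rewrite -leNgt.
rewrite (_ : X @^-1` _ `&` _ = X @^-1` `]-oo, 0[%classic); last first.
  apply/seteqP; split=> t /=; rewrite !in_itv/=; first by case.
  by move=> t0; split=> //; apply: ltW; apply: lt_trans t0 _.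
by rewrite pneg addr0 pitv// => <-; rewrite ltrBlDr ltrDl expR_gt0.
Qed.

Lemma exponential_gt1 : 0 < prob P (X @^-1` `]1, +oo[%classic).
Proof.
have := prob_setD P measurableT (mp (measurable_itv `]-oo, (1:R)])).
rewrite setTI (_ : prob P setT = 1); last by rewrite /prob probability_setT.
rewrite (_ : setT `\` _ = X @^-1` `]1, +oo[%classic).
  by have := exponential_le1; lra.
apply/seteqP; split=> t /=; rewrite !in_itv/= andbT ltNge.
  by move=> [_ /negP].
by move=> /negP.
Qed.

End ExponentialSpacings.

(** * Almost sure divergence of the firing times *)

Section RegularAlmostSure.
Context d (T : measurableType d) (R : realType) (P : probability T R).
Variable Y : coordinate -> T -> R.
Hypothesis iidY : iid_process P Y.
Hypothesis expY : forall B, measurable B ->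
  P (Y (inl 0%N) @^-1` B) = exponential_prob 1 B.

Let mY : forall k, measurable_fun setT (Y k). Proof. by case: iidY. Qed.

Let mp k B : measurable B -> measurable (Y k @^-1` B).
Proof. by move=> mB; rewrite -[X in measurable X]setTI; exact: mY. Qed.

Let q := prob P (Y (inl 0%N) @^-1` `]-oo, 1]%classic).

Let small m k := Y (inl (m + k)%N) @^-1` `]-oo, 1]%classic.

Let prob_small m K : prob P (\bigcap_k small m k) <= q ^+ K.
Proof.
have [_ ind sl _] := iidY.
pose s : seq coordinate := [seq inl (m + k)%N | k <- iota 0 K].
have us : uniq s.
  by rewrite map_inj_uniq ?iota_uniq// => a b [] /addnI.
have mB (k : coordinate) : measurable (`]-oo, 1]%classic : set R) by [].
have pE : prob P (\big[setI/setT]_(k <- s) (Y k @^-1` `]-oo, 1]%classic)) = q ^+ K.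
  rewrite /prob (ind s (fun=> `]-oo, 1]%classic) us mB) big_map.
  rewrite (eq_bigr (fun=> q%:E)); last first.
    by move=> k _; rewrite (sl _ 0%N)// probE//; exact: mp.
  elim: K {s us} => [|K IH]; first by rewrite big_nil expr0.
  rewrite -addn1 iotaD big_cat/= add0n big_cons big_nil mule1.
  rewrite exprD expr1 fineM//; first by rewrite IH.
  elim: (iota 0 K) => [|k l IHl]; first by rewrite big_nil.
  by rewrite big_cons fin_numM.
rewrite -pE; apply: prob_le.
- by apply: bigcapT_measurable => k; exact: mp.
- by apply: bigsetI_measurable => k _; exact: mp.
- move=> t H; rewrite /s big_map; elim: (iota 0 K) => [|k l IHl].
    by rewrite big_nil.
  by rewrite big_cons; split=> //; exact: H.
Qed.

Let often m := \bigcup_k (Y (inl (m + k)%N) @^-1` `]1, +oo[%classic).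

Let m_often m : measurable (often m).
Proof. by apply: bigcupT_measurable => k; exact: mp. Qed.

Let prob_often m : prob P (often m) = 1.
Proof.
have q1 : q < 1 := exponential_le1 (mY (inl 0%N)) expY.
have q0 : 0 <= q by exact: prob_ge0.
have mS : measurable (\bigcap_k small m k).
  by apply: bigcapT_measurable => k; exact: mp.
have p0 : prob P (\bigcap_k small m k) = 0.
  apply/eqP; rewrite eq_le prob_ge0 andbT.
  have cq : (fun K => q ^+ K) @ \oo --> (0 : R) by apply: cvg_expr; rewrite ger0_norm.
  rewrite -(cvg_lim _ cq)//; apply: limr_ge; first by apply/cvg_ex; exists 0.
  by near=> K; exact: prob_small.
have -> : often m = setT `\` \bigcap_k small m k.
  rewrite setTD setC_bigcap; apply: eq_bigcupr => k _.
  by apply/seteqP; split=> t /=; rewrite /small /= !in_itv/= andbT ltNge => /negP.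
have := prob_setD P measurableT mS; rewrite setTI p0 addr0 => ->.
by rewrite /prob probability_setT.
Unshelve. all: by end_near. Qed.

(** Beyond every index some spacing exceeds 1, so the firing times are unbounded. *)
Definition regular_event : set T := (\bigcap_i (Y (inl i) @^-1` [set x | 0 < x])) `&`
  (\bigcap_m often m).

Let mset_gt0 : measurable [set x : R | 0 < x] := @measurable_gt0 R.

Lemma measurable_regular_event : measurable regular_event.
Proof.
by apply: measurableI; apply: bigcapT_measurable => // i; exact: mp.
Qed.

Lemma prob_regular_event : prob P regular_event = 1.
Proof.
rewrite prob_setI1.
- apply: prob_forall_nat => i; first exact: mp.
  have [_ _ sl _] := iidY; rewrite /prob (sl i 0%N)//.
  exact: (exponential_gt0 (mY (inl 0%N)) expY).
- by apply: bigcapT_measurable => i; exact: mp.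
- exact: bigcapT_measurable.
- exact: prob_forall_nat.
Qed.

Lemma regular_eventP t (s : nat -> R) : regular_event t -> (forall i, 0 < s i) ->
  regular (fun i => Y (inl i) t) s.
Proof.
move=> [z0 oft] s0; split=> //; first by move=> i; exact: (z0 i I).
have z0' i : 0 < Y (inl i) t by exact: (z0 i I).
have incr := fire_time_incr z0'.
have unb k : exists i, k%:R < fire_time (fun i => Y (inl i) t) i.
  elim: k => [|k [i ki]].
    by exists 0%N; rewrite /fire_time big_ord1.
  have [l _] := oft i.+1 I; rewrite /= in_itv/= andbT => l1.
  exists (i.+1 + l)%N; rewrite addSn fire_timeS -natr1; apply: ltrD => //.
  apply: lt_le_trans ki _; case: l {l1} => [|l]; first by rewrite addn0.
  by rewrite ltW// incr// -{1}(addn0 i) ltn_add2l.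
move=> M; have [i Mi] := unb (Num.bound `|M|).
exists i; apply: le_lt_trans Mi; apply: (le_trans (ler_norm M)).
exact/ltW/archi_boundP.
Qed.

End RegularAlmostSure.

(* The probability structure of [exponential_prob r] depends on a proof of
   [0 < r], hence is not found by unification. *)
Lemma exponential_variable (R : realType) : exists (d : measure_display)
  (T : measurableType d) (P : probability T R) (X : T -> R),
  measurable_fun setT X /\
  forall B, measurable B -> P (X @^-1` B) = exponential_prob 1 B.
Proof.
eexists; eexists.
exists (exponential_distribution_exponential_prob__canonical__probability_measure_Probability
  (@ltr01 R)).
by exists id; split; [exact: measurable_id|].
Qed.

(** [kappa] in terms of the exponential law alone: in the third claim the measure is chosen before
    any process is given. *)
Definition pattern_weight (R : realType) (b : R) : R :=
  fine (exponential_prob 1 `]1, +oo[%classic) *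
  fine (exponential_prob 1 `]-oo, b[%classic).

Lemma pattern_weight_gt0 (R : realType) (b : R) : 0 < b -> 0 < pattern_weight b.
Proof.
move=> b0; have [d [T [P [X [mX expX]]]]] := exponential_variable R.
rewrite /pattern_weight -!expX//; apply: mulr_gt0.
  exact: (exponential_gt1 mX expX).
exact: (exponential_lt_gt0 mX expX b0).
Qed.

(** * Survival of the second fastest bullet *)

Section Bullets.
Variables (R : realType) (n : nat) (v : nat -> R).
Hypotheses (n_ge3 : (3 <= n)%N) (v_gt0 : 0 < v n)
  (v_decr : forall i : nat, (1 <= i < n)%N -> v i.+1 < v i).

Lemma speed_lt i j : (1 <= i)%N -> (i < j)%N -> (j <= n)%N -> v j < v i.
Proof.
move=> i1; elim: j => // j IH; rewrite ltnS leq_eqVlt => /orP[/eqP <-|ij] jn.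
  by apply: v_decr; rewrite i1.
apply: (lt_trans (v_decr _)); first by rewrite (leq_trans i1 (ltnW ij)).
exact: IH (ltnW jn).
Qed.

Lemma speed_gt0 i : (1 <= i <= n)%N -> 0 < v i.
Proof.
move=> /andP[i1]; rewrite leq_eqVlt => /orP[/eqP -> //|lt].
exact: lt_trans (speed_lt i1 lt (leqnn n)).
Qed.

Definition pace i : R := (v i)^-1.

Lemma pace_lt i j : (1 <= i)%N -> (i < j)%N -> (j <= n)%N -> pace i < pace j.
Proof.
move=> i1 ij jn; rewrite /pace ltf_pV2 ?posrE ?speed_gt0//.
- exact: speed_lt.
- by rewrite i1 (leq_trans (ltnW ij)).
- by rewrite (leq_trans i1 (ltnW ij)).
Qed.

Lemma pace_inj i j : (1 <= i <= n)%N -> (1 <= j <= n)%N -> pace i = pace j -> i = j.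
Proof.
move=> /andP[i1 ni] /andP[j1 nj] e; have [ij|ji|//] := ltngtP i j.
  by have := pace_lt i1 ij nj; rewrite e ltxx.
by have := pace_lt j1 ji ni; rewrite e ltxx.
Qed.

Lemma pace12 : pace 1 < pace 2.
Proof. by apply: pace_lt => //; apply: leq_trans n_ge3. Qed.

Lemma pace2n : pace 2 < pace n.
Proof. by apply: pace_lt. Qed.

Lemma admissible_pace i : (1 <= i <= n)%N ->
  admissible (pace 1) (pace 2) (pace n) (pace i).
Proof.
move=> /andP[i1 ni]; have [i2|i2] := leqP i 2.
  have [->|->] : i = 1%N \/ i = 2%N by move: i1 i2; clear; lia.
  - exact: Or31.
  - exact: Or32.
apply: Or33; rewrite pace_lt//=; move: ni; rewrite leq_eqVlt => /orP[/eqP ->//|lt].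
by rewrite ltW// pace_lt.
Qed.

(* The same speeds seen in the time-reversed process. *)
Lemma admissible_opp_pace i : (1 <= i <= n)%N ->
  admissible (- pace n) (- pace n.-1) (- pace 1) (- pace i).
Proof.
have n1 : n.-1.+1 = n by move: n_ge3; clear; lia.
move=> /andP[i1 ni]; have [ni1|ni1] := leqP n.-1 i.
  have [->|->] : i = n \/ i = n.-1 by move: ni ni1 n_ge3; clear; lia.
  - exact: Or31.
  - exact: Or32.
apply: Or33; rewrite ltrN2 lerN2 pace_lt//=; last by rewrite leq_pred.
move: i1; rewrite leq_eqVlt => /orP[/eqP <-//|lt].
by rewrite ltW// pace_lt.
Qed.

Section Process.
Variable mu : probability R R.
Hypothesis mu_speeds : mu (speed_set n v) = 1%E.
Context d (T : measurableType d) (P : probability T R).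
Variables (zeta speed : nat -> {RV P >-> R}).
Hypothesis bp : bullet_process mu zeta speed.

Definition coordinates (k : coordinate) (t : T) : R :=
  match k with inl i => zeta i t | inr i => (speed i t)^-1 end.

Let mspeed i : measurable_fun setT (speed i : T -> R). Proof. by []. Qed.

Let lawzeta i B : measurable B -> P (zeta i @^-1` B) = exponential_prob 1 B.
Proof. by move=> mB; case: bp => lz _ _; exact: lz. Qed.

Lemma law_speed i B : measurable B -> P (speed i @^-1` B) = mu B.
Proof. by move=> mB; case: bp => _ ls _; exact: ls. Qed.

Let minv B : measurable B -> measurable ((fun x : R => x^-1) @^-1` B).
Proof. by move=> mB; rewrite -[Y in measurable Y]setTI; exact: measurable_invr. Qed.

Lemma iid_coordinates : iid_process P coordinates.
Proof.
case: bp => _ _ ind; split.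
- by move=> [i|i] //=; apply: (measurableT_comp (@measurable_invr R)).
- move=> s B us mB.
  pose X (k : coordinate) : T -> R := match k with inl i => zeta i | inr i => speed i end.
  pose g (k : coordinate) (x : R) : R := if k is inr _ then x^-1 else x.
  have indX : independent P X.
    move=> s' B' us' mB'; have := ind s' B' us' mB'.
    rewrite (eq_bigr (fun k => X k @^-1` B' k)); last by case.
    by move=> ->; apply: eq_bigr => -[].
  have mg k : measurable_fun setT (g k).
    by case: k => k; [exact: measurable_id|exact: measurable_invr].
  have := independent_comp (@inj_id coordinate) mg indX us mB.
  rewrite (eq_bigr (fun k => coordinates k @^-1` B k)); last by case.
  by move=> ->; apply: eq_bigr => -[].
- by move=> i j B mB /=; rewrite !lawzeta.
- move=> i j B mB.
  rewrite (_ : coordinates (inr i) @^-1` B = speed i @^-1` ((fun x : R => x^-1) @^-1` B))//.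
  rewrite (_ : coordinates (inr j) @^-1` B = speed j @^-1` ((fun x : R => x^-1) @^-1` B))//.
  by rewrite !law_speed//; exact: minv.
Qed.

Lemma law_spacing B : measurable B ->
  P (coordinates (inl 0%N) @^-1` B) = exponential_prob 1 B.
Proof. exact: lawzeta. Qed.

Lemma measurable_speed_set : measurable (speed_set n v).
Proof.
apply: countable_measurable; first exact: measurable_set1.
apply: finite_set_countable; apply: finite_image.
apply: sub_finite_set (finite_window 0 n) => i /andP[_ ?].
exact: in_window.
Qed.

Lemma speed_set_as : prob P (\bigcap_i (speed i @^-1` speed_set n v)) = 1.
Proof.
have mS i : measurable (speed i @^-1` speed_set n v).
  rewrite -[Y in measurable Y]setTI; exact: (mspeed i measurableT measurable_speed_set).
apply: prob_forall_nat => // i.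
by rewrite /prob law_speed ?mu_speeds//; exact: measurable_speed_set.
Qed.

Lemma mass_pace k : (1 <= k <= n)%N ->
  mass P coordinates (pace k) = fine (mu [set v k]).
Proof.
move=> kn; rewrite /mass /prob -(law_speed 0 (measurable_set1 (v k))); congr (fine (P _)).
apply/seteqP; split=> t /=; last by move=> ->.
by rewrite /pace => /invr_inj.
Qed.

Lemma admissible_as : prob P (coordinates (inr 0%N) @^-1`
  [set x | admissible (pace 1) (pace 2) (pace n) x]) = 1.
Proof.
have mA := measurable_admissible (pace 1) (pace 2) (pace n).
have mA' : measurable (coordinates (inr 0%N) @^-1`
  [set x | admissible (pace 1) (pace 2) (pace n) x]).
  rewrite -[Y in measurable Y]setTI; case: iid_coordinates => mY _ _ _.
  exact: (mY (inr 0%N) measurableT _ mA).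
have mS : measurable (speed 0%N @^-1` speed_set n v).
  rewrite -[Y in measurable Y]setTI; exact: (mspeed 0 measurableT measurable_speed_set).
apply/eqP; rewrite eq_le prob_le1//=.
have <- : prob P (speed 0%N @^-1` speed_set n v) = 1.
  by rewrite /prob law_speed ?mu_speeds//; exact: measurable_speed_set.
apply: prob_le => // t [i /= ni e]; rewrite /= -e.
exact: admissible_pace.
Qed.

Lemma kappaE u1 u2 un :
  kappa P u1 u2 un coordinates = pattern_weight ((u2 - u1) / (un - u2)).
Proof. by rewrite /kappa /pattern_weight /prob !law_spacing. Qed.

Definition good_event : set T := regular_event coordinates `&`
  \bigcap_i (speed i @^-1` speed_set n v).

Lemma measurable_good_event : measurable good_event.
Proof.
apply: measurableI; first exact: (measurable_regular_event iid_coordinates).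
apply: bigcapT_measurable => i; rewrite -[Y in measurable Y]setTI.
exact: (mspeed i measurableT measurable_speed_set).
Qed.

Lemma prob_good_event : prob P good_event = 1.
Proof.
rewrite prob_setI1 ?speed_set_as//.
- exact: (prob_regular_event iid_coordinates law_spacing).
- exact: (measurable_regular_event iid_coordinates).
- apply: bigcapT_measurable => i; rewrite -[Y in measurable Y]setTI.
  exact: (mspeed i measurableT measurable_speed_set).
Qed.

Lemma good_speed t i : good_event t -> exists2 k, (1 <= k <= n)%N & speed i t = v k.
Proof. by move=> [_ /(_ i I)[k kn e]]; exists k. Qed.

Lemma good_regular t : good_event t ->
  regular (fun i => zeta i t) (fun i => speed i t).
Proof.
move=> gt; have [reg _] := gt; apply: (regular_eventP reg) => i.
by have [k kn ->] := good_speed i gt; exact: speed_gt0.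
Qed.

Lemma measurable_first_survival (c : R) : measurable
  ([set t | first_survives (fun i => zeta i t) (fun i => speed i t)] `&`
   [set t | speed 0%N t = c]).
Proof.
apply: measurableI; first exact: measurable_first_survives.
rewrite (_ : [set t | _] = setT `&` speed 0%N @^-1` [set c]); last by rewrite setTI.
exact: (mspeed 0 measurableT (measurable_set1 c)).
Qed.

Lemma first_survival_probE k : (1 <= k <= n)%N ->
  first_survival_prob zeta speed (v k) =
  prob P ([set t | first_survives (fun i => zeta i t) (fun i => speed i t)] `&`
   [set t | speed 0%N t = v k]) / fine (mu [set v k]).
Proof.
move=> kn; rewrite /first_survival_prob /cond_prob; congr (_ / fine _).
exact: (law_speed 0 (measurable_set1 (v k))).
Qed.

(** By [caught_hits], surviving follows from the events [B M] for all [M]. These decrease with [M]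
    and their probabilities have a common lower bound, which continuity from above passes on to the
    intersection. *)
Lemma survival_lower_bound (m1 m2 mn : R) :
  m1 = fine (mu [set v 1%N]) -> m2 = fine (mu [set v 2%N]) ->
  mn = fine (mu [set v n]) -> m2 <= m1 ->
  m1 * (mn * m2 * pattern_weight ((pace 2 - pace 1) / (pace n - pace 2))) - (m1 - m2)
  <= prob P ([set t | first_survives (fun i => zeta i t) (fun i => speed i t)] `&`
      [set t | speed 0%N t = v 2%N]).
Proof.
have n1 : (1 <= 1 <= n)%N by move: n_ge3; clear; lia.
have n2 : (1 <= 2 <= n)%N by move: n_ge3; clear; lia.
have nn : (1 <= n <= n)%N by move: n_ge3; clear; lia.
rewrite -!mass_pace// => m1E m2E mnE m21.
have spgt0 := exponential_gt0 (let: And4 mY _ _ _ := iid_coordinates in mY (inl 0%N))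
  law_spacing.
pose B M := joint coordinates @^-1`
  (safe_right (pace 2) 0 M `&` [set y | slow y 0 = pace 2]).
have mB M : measurable (B M).
  apply: (@measurable_joint _ _ _ P _ coordinates setT); first by case: iid_coordinates.
  apply: coordinate_algebraI; last exact: coordinate_slow.
  exact: (coordinate_algebra_sub (@subsetT _ (after 0)) (@measurable_safe_right _ _ 0 M)).
have bound M : m1 * (mn * m2 * pattern_weight ((pace 2 - pace 1) / (pace n - pace 2))) -
    (m1 - m2) <= prob P (B M).
  rewrite -kappaE m1E m2E mnE.
  apply: (core_bound pace12 pace2n iid_coordinates spgt0 admissible_as M).
  by rewrite -m1E -m2E.
have mBI : measurable (\bigcap_M B M) by exact: bigcapT_measurable.
apply: (@le_trans _ _ (prob P (\bigcap_M B M))); last first.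
  apply: (prob_le_ae measurable_good_event prob_good_event) => //.
    exact: measurable_first_survival.
  move=> t [Bt gt]; have reg := good_regular gt.
  have s0 : slow (joint coordinates t) 0 = pace 2 by have [] := Bt 0%N I.
  split; last by apply: invr_inj; exact: s0.
  apply: contrapT => /(caught_hits reg)[k k0 hk].
  have [sr _] := Bt k I; apply: (sr k); first by rewrite k0 leqnn.
  by rewrite -s0 update_id.
have dB : nonincreasing_seq B.
  apply/nonincreasing_seqP => M; apply/subsetPset => t [sr s0]; split=> //.
  by move=> k /andP[k0 kM]; apply: sr; rewrite k0 (leqW kM).
have cv : (P \o B) @ \oo --> P (\bigcap_M B M).
  apply: nonincreasing_cvg_mu => //.
  exact: le_lt_trans (probability_le1 P (mB 0%N)) (ltry 1).
rewrite -lee_fin -probE// -(cvg_lim _ cv)//; apply: lime_ge.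
  by apply/cvg_ex; eexists; exact: cv.
by apply: nearW => M /=; rewrite probE// lee_fin.
Qed.

End Process.
End Bullets.

(** * Extinction of the slowest bullet *)

Section TailEvents.
Variables (R : realType) (c c' : R).
Implicit Types (y : coordinate -> R).

Definition survive_from a : set (coordinate -> R) := [set y |
  first_survives (shifted a (spacing y)) (shifted a (fun i => (slow y i)^-1)) /\
  slow y a = c].

Definition unhit j : set (coordinate -> R) := [set y | slow y j = c' /\
  forall k, (k < j)%N ->
    ~ hits (meeting (fire_time (spacing y)) (slow y)) (window k j) k j].

Definition upto (j : nat) : set coordinate :=
  [set k | match k with inl l => (l <= j)%N | inr l => (l <= j)%N end].

Definition from (a : nat) : set coordinate :=
  [set k | match k with inl l => (a <= l)%N | inr l => (a <= l)%N end].

Lemma measurable_survive_from a : coordinate_algebra (from a) (survive_from a).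
Proof.
apply: coordinate_algebraI; last by apply: coordinate_slow => /=.
apply: (@measurable_first_survives _ (g_sigma_algebraType (boxes (R := R) (from a))) R
  (fun y => shifted a (spacing y)) (fun y => shifted a (fun i => (slow y i)^-1))).
  by move=> i; apply: measurable_coordinate; rewrite /from /= leq_addr.
move=> i; apply: (measurableT_comp (@measurable_invr R)).
by apply: measurable_coordinate; rewrite /from /= leq_addr.
Qed.

Lemma measurable_unhit j : coordinate_algebra (upto j) (unhit j).
Proof.
apply: coordinate_algebraI; first by apply: coordinate_slow => /=.
apply: (@measurable_forall_nat _ (g_sigma_algebraType (boxes (R := R) (upto j)))) => k.
apply: (@measurable_impl _ (g_sigma_algebraType (boxes (R := R) (upto j)))).
  exact: (@measurable_const _ (g_sigma_algebraType (boxes (R := R) (upto j)))).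
apply: (@measurableC _ (g_sigma_algebraType (boxes (R := R) (upto j)))).
apply: measurable_hits_window => [i /andP[]//|i /andP[ji ?]].
exact: measurable_coordinate.
Qed.

End TailEvents.

Section Slowest.
Variables (R : realType) (n : nat) (v : nat -> R).
Hypotheses (n_ge3 : (3 <= n)%N) (v_gt0 : 0 < v n)
  (v_decr : forall i : nat, (1 <= i < n)%N -> v i.+1 < v i).
Variable mu : probability R R.
Hypothesis mu_uniform : uniform_on n (speed_set n v) mu.
Context d (T : measurableType d) (P : probability T R).
Variables (zeta speed : nat -> {RV P >-> R}).
Hypothesis bp : bullet_process mu zeta speed.

Let mu_speeds : mu (speed_set n v) = 1%E. Proof. by case: mu_uniform. Qed.

Let Y := coordinates zeta speed.

Let iidY : iid_process P Y := iid_coordinates bp.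

Let uniform_mass k : (1 <= k <= n)%N -> fine (mu [set v k]) = n%:R^-1.
Proof. by move=> kn; case: mu_uniform => _ ->//; exists k. Qed.

Let n0 : (0 : R) < n%:R^-1.
Proof. by rewrite invr_gt0 ltr0n; move: n_ge3; clear; lia. Qed.

(** The bound of [core_bound] for the reversed process, whose slownesses [- pace v n],
    [- pace v n.-1] and [- pace v 1] play the parts of [u1], [u2] and [un]. *)
Let bound : R := n%:R^-1 * (n%:R^-1 * n%:R^-1 *
  pattern_weight ((- pace v n.-1 - - pace v n) / (- pace v 1 - - pace v n.-1))).

Let n1 : n.-1.+1 = n. Proof. by move: n_ge3; clear; lia. Qed.

Let pace_n1 : pace v n.-1 < pace v n.
Proof.
by apply: (pace_lt v_gt0 v_decr); move: n_ge3; clear; lia.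
Qed.

Let pace_1 : pace v 1 < pace v n.-1.
Proof.
by apply: (pace_lt v_gt0 v_decr); move: n_ge3; clear; lia.
Qed.

Let bound_gt0 : 0 < bound.
Proof.
apply: mulr_gt0 => //; apply: mulr_gt0; first exact: mulr_gt0.
apply: pattern_weight_gt0.
by rewrite divr_gt0// opprK addrC subr_gt0.
Qed.

Lemma reversed_mass j k : (1 <= k <= n)%N ->
  mass P (fun k t => reversed j (joint Y t) k) (- pace v k) = n%:R^-1.
Proof.
move=> kn; rewrite -(uniform_mass kn) -(mass_pace v bp kn) /mass /prob.
have [_ _ _ sr] := iidY; rewrite -(sr j 0%N)//; congr (fine (P _)).
apply/seteqP; split=> t; rewrite /reversed /= subn0.
  by move/oppr_inj.
by move=> e; congr (- _); exact: e.
Qed.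

(** Reversal at [j] turns bullet [j] into the first one, and being hit by one of the next [j]
    bullets into catching one of the previous ones. *)
Lemma prob_unhit j : bound <= pr P Y (unhit (pace v n.-1) j).
Proof.
have m1 : (1 <= n <= n)%N by move: n_ge3; clear; lia.
have m2 : (1 <= n.-1 <= n)%N by move: n_ge3; clear; lia.
have m3 : (1 <= 1 <= n)%N by move: n_ge3; clear; lia.
pose Yj := fun k t => reversed j (joint Y t) k.
have iidj : iid_process P Yj := iid_reversed j iidY.
have lt1 : - pace v n < - pace v n.-1 by rewrite ltrN2.
have lt2 : - pace v n.-1 < - pace v 1 by rewrite ltrN2.
have spgt0 : prob P (Yj (inl 0%N) @^-1` [set x | 0 < x]) = 1.
  exact: (exponential_gt0 (let: And4 mY _ _ _ := iidY in mY (inl 0%N)) (law_spacing bp)).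
have adm : prob P (Yj (inr 0%N) @^-1`
    [set x | admissible (- pace v n) (- pace v n.-1) (- pace v 1) x]) = 1.
  have [mYj _ _ _] := iidj.
  have mA := measurable_admissible (- pace v n) (- pace v n.-1) (- pace v 1).
  have mA' : measurable (Yj (inr 0%N) @^-1`
      [set x | admissible (- pace v n) (- pace v n.-1) (- pace v 1) x]).
    by rewrite -[X in measurable X]setTI; exact: (mYj (inr 0%N) measurableT _ mA).
  apply/eqP; rewrite eq_le prob_le1//=.
  rewrite -(prob_good_event mu_speeds bp); apply: prob_le => //.
    exact: (measurable_good_event n v bp).
  move=> t gt; have [k kn e] := good_speed j gt.
  rewrite /Yj /reversed /= subn0 /joint /Y /coordinates e.
  exact: (admissible_opp_pace n_ge3 v_gt0 v_decr kn).
have := core_bound lt1 lt2 iidj spgt0 adm j.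
rewrite !reversed_mass// lexx subrr subr0 => /(_ isT).
have -> : kappa P (- pace v n) (- pace v n.-1) (- pace v 1) Yj =
    pattern_weight ((- pace v n.-1 - - pace v n) / (- pace v 1 - - pace v n.-1)).
  by rewrite /kappa /pattern_weight /prob !(law_spacing bp).
move/le_trans; apply.
apply: prob_le.
- apply: (@measurable_joint _ _ _ P _ Yj setT); first by case: iidj.
  apply: coordinate_algebraI; last exact: coordinate_slow.
  exact: (coordinate_algebra_sub (@subsetT _ (after 0)) (@measurable_safe_right _ _ 0 j)).
- apply: (@measurable_joint _ _ _ P _ Y (upto j)); first by case: iidY.
  exact: measurable_unhit.
move=> t [sr s0]; have sj : slow (joint Y t) j = pace v n.-1.
  apply: oppr_inj; move: s0; rewrite /slow /joint /Yj /reversed /= subn0.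
  by [].
split=> // k kj h; apply: (sr (j - k)%N); first by rewrite subn_gt0 kj leq_subr.
rewrite -s0 update_id; apply/(hits_reversed (joint Y t) (leq_subr k j)).
by rewrite subKn// ltnW.
Qed.

Let speedsE t : (fun i => (slow (joint Y t) i)^-1) = (fun i => speed i t).
Proof. by apply/funext => i; rewrite /slow /joint /Y /= invrK. Qed.

Let theta := prob P ([set t | first_survives (fun i => zeta i t) (fun i => speed i t)] `&`
   [set t | speed 0%N t = v n]).

Lemma prob_survive_from a : pr P Y (survive_from (pace v n) a) = theta.
Proof.
have m0 := @measurable_survive_from R (pace v n) 0.
transitivity (pr P Y (survive_from (pace v n) 0)).
  rewrite /pr -(prob_reindex iidY (@shift_index_inj a) _ _ m0).
  - congr (prob P _); apply/seteqP; split=> t; rewrite /survive_from /=.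
      by move=> [fs sa]; split=> //; rewrite -sa /slow /joint /= addn0.
    by move=> [fs sa]; split=> //; rewrite -sa /slow /joint /= addn0.
  - by move=> i; exists (a + i)%N.
  - by move=> i; exists (a + i)%N.
rewrite /theta /pr; congr (prob P _); apply/seteqP; split=> t; rewrite /survive_from /=.
  by rewrite speedsE => -[fs /invr_inj].
by rewrite speedsE => -[fs e]; split=> //; rewrite /slow /joint /Y /= e.
Qed.

Let E j : set T := joint Y @^-1` (unhit (pace v n.-1) j `&` survive_from (pace v n) j.+1).

Let mE j : measurable (E j).
Proof.
have [mY _ _ _] := iidY.
rewrite /E preimage_setI; apply: measurableI.
  exact: (@measurable_joint _ _ _ P _ Y (upto j) _ mY (@measurable_unhit _ _ j)).
exact: (@measurable_joint _ _ _ P _ Y (from j.+1) _ mY (@measurable_survive_from _ _ j.+1)).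
Qed.

Let prob_E j : bound * theta <= prob P (E j).
Proof.
have [mY ind _ _] := iidY.
have mU := @measurable_unhit R (pace v n.-1) j.
have mS := @measurable_survive_from R (pace v n) j.+1.
have -> : prob P (E j) = pr P Y (unhit (pace v n.-1) j) * theta.
  rewrite -(prob_survive_from j.+1) /E /pr /prob preimage_setI.
  rewrite (independent_events mY ind _ mU mS).
    rewrite fineM// fin_prob//.
      exact: (@measurable_joint _ _ _ P _ Y (upto j) _ mY mU).
    exact: (@measurable_joint _ _ _ P _ Y (from j.+1) _ mY mS).
  apply/seteqP; split=> -[l|l] //= [].
    by move=> lj jl; have := leq_ltn_trans lj jl; rewrite ltnn.
  by move=> lj jl; have := leq_ltn_trans lj jl; rewrite ltnn.
by rewrite ler_wpM2r ?prob_unhit// prob_ge0.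
Qed.

(** The surviving slowest bullet of [E i] has index [i.+1]; it must be fired strictly before [j] for
    [no_two_survivors] to apply. *)
Let E_disjoint t i j : good_event n v zeta speed t -> (i.+1 < j)%N -> E i t -> ~ E j t.
Proof.
move=> gt ij [_ [fsi si]] [[sj nh] [fsj sj1]].
rewrite speedsE in fsi; rewrite speedsE in fsj.
apply: (@no_two_survivors R (fun i => zeta i t) (fun i => speed i t) (pace v n) i.+1 j
  (good_regular v_gt0 v_decr gt) _ si sj1 _ ij fsi fsj).
- move=> l; have [k kn e] := good_speed l gt; rewrite /slowness e.
  have /andP[k1] := kn; rewrite leq_eqVlt => /orP[/eqP -> //|lt].
  by rewrite ltW// (pace_lt v_gt0 v_decr).
- by rewrite (_ : slowness _ j = pace v n.-1)//; exact: sj.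
- by move=> k /andP[_ kj]; exact: nh.
Qed.

Lemma slowest_dies : first_survival_prob zeta speed (v n) = 0.
Proof.
have nn : (1 <= n <= n)%N by move: n_ge3; clear; lia.
rewrite (first_survival_probE v bp nn) -/theta.
suff -> : theta = 0 by rewrite mul0r.
apply/eqP; rewrite eq_le prob_ge0 andbT leNgt; apply/negP => th0.
have bt : 0 < bound * theta by rewrite mulr_gt0.
(* Even indices are pairwise non-adjacent, so the events [E i.*2] are disjoint almost surely while
   their probabilities are bounded below. *)
have le1 N : N%:R * (bound * theta) <= 1.
  apply: (@le_trans _ _ (\sum_(i < N) prob P (E i.*2))).
    rewrite mulr_natl -[N in _ *+ N]card_ord -sumr_const; apply: ler_sum => i _.
    exact: prob_E.
  apply: le_trans (prob_le1 P measurableT).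
  apply: (sum_prob_le_ae (measurable_good_event n v bp) (prob_good_event mu_speeds bp)
    (F := fun i => E i.*2)) => //.
  move=> i j _ _ [t [[Ei Ej] gt]]; have [ij|ji|//] := ltngtP i j.
    have lt : ((i.*2).+1 < j.*2)%N by rewrite -doubleS leq_double.
    by have := E_disjoint gt lt Ei Ej.
  have lt : ((j.*2).+1 < i.*2)%N by rewrite -doubleS leq_double.
  by have := E_disjoint gt lt Ej Ei.
have ge0 : 0 <= (bound * theta)^-1 by rewrite invr_ge0 ltW.
have := le1 (Num.bound (bound * theta)^-1); rewrite leNgt => /negP; apply.
by rewrite -ltr_pdivrMr// div1r; exact: archi_boundP.
Qed.

End Slowest.

(** * A perturbation of the uniform law *)

Section DiscreteLaw.
Variables (R : realType) (n : nat) (x q : nat -> R).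
Hypotheses (q_ge0 : forall k, 0 <= q k) (q_sum : \sum_(k < n) q k = 1).

Definition discrete_law : set R -> \bar R :=
  msum (fun k => mscale (NngNum (q_ge0 k)) (dirac (x k))) n.

HB.instance Definition _ := Measure.on discrete_law.

Lemma discrete_lawE A : discrete_law A = (\sum_(k < n) q k * \1_A (x k))%:E.
Proof.
rewrite /discrete_law /msum -sumEFin; apply: eq_bigr => k _.
change ((q k)%:E * dirac (x k) A = (q k * \1_A (x k))%:E)%E.
by rewrite diracE indicE EFinM.
Qed.

Let discrete_law_setT : discrete_law setT = 1%E.
Proof.
rewrite discrete_lawE -q_sum; congr (_%:E); apply: eq_bigr => k _.
by rewrite indicE in_setT mulr1.
Qed.

HB.instance Definition _ :=
  @Measure_isProbability.Build _ _ R discrete_law discrete_law_setT.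

Lemma discrete_probability : exists mu : probability R R,
  forall A, mu A = (\sum_(k < n) q k * \1_A (x k))%:E.
Proof. by exists discrete_law => A; exact: discrete_lawE. Qed.

End DiscreteLaw.

(** A mass [t / n] is moved from the second speed to the first. In the proof indices start from 0,
    hence [v k.+1]. *)
Lemma perturbed_law (R : realType) (n : nat) (v : nat -> R) (t : R) :
  (3 <= n)%N -> 0 < t < 1 ->
  (forall i j, (1 <= i <= n)%N -> (1 <= j <= n)%N -> v i = v j -> i = j) ->
  exists mu : probability R R, [/\ mu (speed_set n v) = 1%E,
    mu [set v 1%N] = (n%:R^-1 * (1 + t))%:E, mu [set v 2%N] = (n%:R^-1 * (1 - t))%:E &
    forall k, (3 <= k <= n)%N -> mu [set v k] = n%:R^-1%:E].
Proof.
move=> n3 /andP[t0 t1] inj.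
have r0 : (0 : R) < n%:R^-1 by rewrite invr_gt0 ltr0n; move: n3; clear; lia.
pose q (k : nat) : R := n%:R^-1 * (1 + t * ((k == 0%N)%:R - (k == 1%N)%:R)).
have q_ge0 k : 0 <= q k.
  rewrite mulr_ge0 ?(ltW r0)//; case: eqP => [->|_] /=; first by lra.
  by case: eqP => _ /=; lra.
have q_sum : \sum_(k < n) q k = 1.
  rewrite -mulr_sumr big_split/= sumr_const card_ord -mulr_sumr sumrB.
  have d c : (c < n)%N -> \sum_(k < n) ((k == c :> nat)%:R : R) = 1.
    move=> cn; rewrite (bigD1 (Ordinal cn))//= eqxx big1 ?addr0// => k ne.
    by rewrite (_ : (k == c :> nat) = false)//; apply: negbTE.
  rewrite !d; try by move: n3; clear; lia.
  by rewrite subrr mulr0 addr0 mulVf// gt_eqF// -invr_gt0.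
have [mu muE] := discrete_probability (fun k => v k.+1) q_ge0 q_sum.
have at_point k : (k < n)%N -> mu [set v k.+1] = (q k)%:E.
  move=> kn; rewrite muE (bigD1 (Ordinal kn))//= indicE mem_set// mulr1.
  rewrite big1 ?addr0// => l ne; rewrite indicE memNset ?mulr0//= => e.
  move: ne; rewrite -val_eqE /= => /eqP; apply.
  by apply: succn_inj; apply: (inj _ _ _ _ e); rewrite ?ltn_ord.
exists mu; split.
- rewrite muE -q_sum; congr (_%:E); apply: eq_bigr => k _.
  rewrite indicE mem_set ?mulr1//; exists k.+1; last by [].
  exact: ltn_ord.
- by rewrite at_point ?/q/= ?subr0 ?mulr1//; move: n3; clear; lia.
- rewrite at_point; last by move: n3; clear; lia.
  by rewrite /q /= sub0r mulrN1.
- move=> k /andP[k3 kn]; case: k k3 kn => // k k3 kn; rewrite at_point// /q.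
  by rewrite !gtn_eqF//= ?subrr ?mulr0 ?addr0 ?mulr1//; move: k3; clear; lia.
Qed.

Theorem mainTheorem5 (R : realType) (n : nat) (v : nat -> R)
    (n_ge3 : (3 <= n)%N)
    (v_gt0 : 0 < v n)
    (v_decr : forall i : nat, (1 <= i < n)%N -> v i.+1 < v i) :
  [/\ (forall mu : probability R R, uniform_on n (speed_set n v) mu ->
        forall (d : measure_display) (T : measurableType d)
          (P : probability T R) (zeta speed : nat -> {RV P >-> R}),
        bullet_process mu zeta speed ->
        0 < first_survival_prob zeta speed (v 2%N)),
      (forall mu : probability R R, uniform_on n (speed_set n v) mu ->
        forall (d : measure_display) (T : measurableType d)
          (P : probability T R) (zeta speed : nat -> {RV P >-> R}),
        bullet_process mu zeta speed ->
        first_survival_prob zeta speed (v n) = 0) &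
      (exists mu : probability R R,
        [/\ supported_on (speed_set n v) mu,
            (mu [set v 2%N] < mu [set v 1%N])%E &
            forall (d : measure_display) (T : measurableType d)
              (P : probability T R) (zeta speed : nat -> {RV P >-> R}),
            bullet_process mu zeta speed ->
            0 < first_survival_prob zeta speed (v 2%N)])].
Proof.
have r0 : (0 : R) < n%:R^-1 by rewrite invr_gt0 ltr0n; move: n_ge3; clear; lia.
have n2 : (1 <= 2 <= n)%N by move: n_ge3; clear; lia.
set b := (pace v 2 - pace v 1) / (pace v n - pace v 2).
have b0 : 0 < b.
  by rewrite divr_gt0// subr_gt0; [exact: pace12 n_ge3 v_gt0 v_decr|
    exact: pace2n n_ge3 v_gt0 v_decr].
have k0 := pattern_weight_gt0 b0.
split.
- move=> mu [mu1 muE] d T P zeta speed bp.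
  have mass k : (1 <= k <= n)%N -> n%:R^-1 = fine (mu [set v k]) :> R.
    by move=> kn; rewrite muE//; exists k.
  have := survival_lower_bound n_ge3 v_gt0 v_decr mu1 bp (mass 1%N _) (mass 2%N n2)
    (mass n _) (lexx _).
  rewrite subrr subr0 (first_survival_probE v bp n2) -(mass 2%N n2) => H.
  rewrite divr_gt0//; apply: (lt_le_trans _ (H _ _)).
  + by apply: mulr_gt0 => //; apply: mulr_gt0 => //; exact: mulr_gt0.
  + by move: n_ge3; clear; lia.
  + by move: n_ge3; clear; lia.
- move=> mu umu d T P zeta speed bp.
  exact: (slowest_dies n_ge3 v_gt0 v_decr umu bp).
- pose e := n%:R^-1 * n%:R^-1 * pattern_weight b.
  have e0 : 0 < e by apply: mulr_gt0 => //; exact: mulr_gt0.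
  (* With these masses the lower bound equals [((1 - t * t) * e - 2 * t) / n]. The choice of [t]
     gives both [8 * t < 1] and [8 * t < e], hence [t * t * e < e / 64] and [2 * t < e / 4], so the
     bound is positive. *)
  pose t := e / (8 * (1 + e)).
  have te : t * (8 * (1 + e)) = e by rewrite /t mulfVK// gt_eqF// mulr_gt0// addr_gt0.
  have t0 : 0 < t by rewrite divr_gt0// mulr_gt0// addr_gt0.
  have te0 : 0 < t * e by rewrite mulr_gt0.
  have t8 : 8 * t < 1.
    rewrite ltNge; apply/negP => ge; have : 0 <= (8 * t - 1) * e.
      by rewrite mulr_ge0 ?subr_ge0// ltW.
    lra.
  have te8 : 8 * t < e by lra.
  have [||mu [mu1 muv1 muv2 muk]] := @perturbed_law R n v t n_ge3.
  + by apply/andP; split=> //; lra.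
  + move=> i j ni nj e'; apply: (pace_inj v_gt0 v_decr ni nj).
    by rewrite /pace e'.
  exists mu; split.
  + split=> // _ [k /= kn <-].
    have [k3|k3] := leqP 3 k.
      by rewrite muk ?lte_fin//; move: kn k3; clear; lia.
    have [->|->] : k = 1%N \/ k = 2%N by move: kn k3; clear; lia.
      by rewrite muv1 lte_fin mulr_gt0//; lra.
    by rewrite muv2 lte_fin mulr_gt0//; lra.
  + by rewrite muv1 muv2 lte_fin ltr_pM2l//; lra.
  + move=> d T P zeta speed bp.
    have m1 : n%:R^-1 * (1 + t) = fine (mu [set v 1%N]) by rewrite muv1.
    have m2 : n%:R^-1 * (1 - t) = fine (mu [set v 2%N]) by rewrite muv2.
    have mn : n%:R^-1 = fine (mu [set v n]).
      by rewrite muk//; move: n_ge3; clear; lia.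
    have m21 : n%:R^-1 * (1 - t) <= n%:R^-1 * (1 + t).
      by rewrite ler_pM2l//; lra.
    have := survival_lower_bound n_ge3 v_gt0 v_decr mu1 bp m1 m2 mn m21.
    rewrite (first_survival_probE v bp n2) -m2 -/b => H.
    rewrite divr_gt0//; last by rewrite mulr_gt0//; lra.
    apply: lt_le_trans H.
    rewrite [X in 0 < X](_ : _ = n%:R^-1 * ((1 - t * t) * e - 2 * t)); last first.
      by rewrite /e; ring.
    rewrite mulr_gt0// subr_gt0.
    have : t * t * e < e / 64.
      have : t * t < 1 / 64 by nra.
      nra.
    lra.
Qed.
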